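(* Let $X=(X_t)_{t\in[0,T]}$ be given by $X=G+J$, where $G$ is a continuous Gaussian Volterra process with covariance function $R$, increasing function $v$ and Volterra kernel $K$ (in the sense of the definition in the context), and $J$ is a compound Poisson process, independent of $G$, with intensity $\lambda$ and square-integrable jump distribution $F$; that is, $J_t=\sum_{k=1}^{N_t}\xi_k$, where $N=(N_t)_{t\in[0,T]}$ is a Poisson process with intensity $\lambda$ and the jumps $\xi_k$, $k\in\mathbb{N}$, are i.i.d. with common distribution $F$ and independent of $N$ and $G$. Let $\mu_1=\mathbb{E}[\xi_k]$ and $\mu_2=\mathbb{E}[\xi_k^2]$. Then, for $s,t,u\in[0,T]$ with $u\le\min(s,t)$, $$\hat m^X_t(u) = X_u - \int_0^u \Psi(t,r|u)\, dG_r + \lambda(t-u)\mu_1,$$ $$\hat R_X(t,s|u) = R(t,s) - \int_0^u K(t,x)K(s,x)\, dv(x) + \lambda(t\wedge s-u)\mu_2,$$ $$\hat P^X_t(dx|u) = \int_{y\in\mathbb{R}} \Phi\left(dx-y;\hat m^G_t(u),\hat R_G(t,t|u)\right)\sum_{n=0}^\infty \frac{e^{-\lambda(t-u)}(\lambda(t-u))^n}{n!}\,F^{*n}(dy-J_u),$$ where $\hat m^G_t(u)=G_u-\int_0^u\Psi(t,r|u)\,dG_r$ and $\hat R_G(t,t|u)=R(t,t)-\int_0^u K(t,x)^2\,dv(x)$ are the conditional mean and conditional variance of $G_t$ given $\mathcal{F}^G_u$.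
   Context: Setting. Fix $T>0$ and a complete probability space $(\Omega,\mathcal{F},\mathbb{P})$. For a stochastic process $Y$, $\mathcal{F}^Y_u$ is the $\sigma$-algebra generated by $Y_r$, $r\le u$, and $$\hat m^Y_t(u)=\mathbb{E}[Y_t\mid\mathcal{F}^Y_u],\qquad \hat R_Y(t,s|u)=\mathrm{Cov}[Y_t,Y_s\mid\mathcal{F}^Y_u],\qquad \hat P^Y_t(dy|u)=\mathbb{P}[Y_t\in dy\mid\mathcal{F}^Y_u]$$ are the conditional mean, conditional covariance and conditional law. Kernels and operators. Write $\mathbf{1}_t=\mathbf{1}_{[0,t)}$. A Volterra kernel is a function $K:[0,T]^2\to\mathbb{R}$ with $K(t,s)=0$ whenever $t<s$. Its adjoint associated operator $\mathrm{K}^*$ is given by extending linearly the relation $\mathrm{K}^*[\mathbf{1}_t](s)=K(t,s)$. Gaussian Volterra process. A centered Gaussian process $G=(G_t)_{t\in[0,T]}$ with $G_0=0$ and covariance function $R:[0,T]^2\to\mathbb{R}$ is a Gaussian Volterra process if: (i) there exist an increasing function $v:[0,T]\to\mathbb{R}$ and a Volterra kernel $K:[0,T]^2\to\mathbb{R}$ such that $\int_0^tK(t,s)^2\,dv(s)<\infty$ for all $t\in[0,T]$ and $R(t,s)=\int_0^{t\wedge s}K(t,x)K(s,x)\,dv(x)$; and (ii) for each $t\in[0,T]$ the equation $\mathrm{K}^*[K^{-1}(t,\cdot)](s)=\mathbf{1}_t(s)$ admits a solution $K^{-1}(t,\cdot)$. Let $\Lambda$ (the space of Wiener integrands) be the closure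 of the indicator functions $\mathbf{1}_t$, $t\in[0,T]$, in the inner product $\langle\mathbf{1}_t,\mathbf{1}_s\rangle_\Lambda=R(t,s)$. For a Gaussian Volterra process, $\mathrm{K}^*$ extends to an isometry from $\Lambda$ to $L^2([0,T],dv)$, and it is invertible, with $(\mathrm{K}^* )^{-1}[\mathbf{1}_t](s)=K^{-1}(t,s)$. The abstract Wiener integral $f\mapsto\int_0^T f(t)\,dG_t$ is the isometry from $\Lambda$ onto the closure in $L^2(\Omega,\mathcal{F},\mathbb{P})$ of the random variables $G_t$, $t\in[0,T]$, that extends $\mathbf{1}_t\mapsto G_t$; integrals $\int_0^u f(s)\,dG_s$ are the corresponding abstract Wiener integrals over $[0,u]$. Prediction kernel. For $u\le t$, $\Psi(t,s|u)=(\mathrm{K}^* )^{-1}\big[K(t,\cdot)-K(u,\cdot)\big](s)$. Distributions. $\Phi(dx;\mu,\sigma^2)=\frac{1}{\sqrt{2\pi\sigma^2}}e^{-\frac12\frac{(x-\mu)^2}{\sigma^2}}\,dx$. For a measure $\rho$ on $\mathbb{R}$ and $a\in\mathbb{R}$, $\rho(dx-a)$ denotes the measure $A\mapsto\rho(A-a)$. $F^{*n}$ is the $n$-fold convolution of $F$: $F^{*1}(dx)=F(dx)$, $F^{*n}(dx)=\int_{y\in\mathbb{R}}F(dx-y)\,F^{*(n-1)}(dy)$, and $F^{*0}$ is the unit mass at $0$.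
   Formalization: The prediction kernel is Ψ(t,·|u)=(K* )^{-1}[K(u,·)−K(t,·)], inverse over [0,u] (the printed sign fails, e.g. for G_t=W_t+∫_0^t W_s ds), and in (ii) K^{-1}(t,·) must be an integrand over [0,t], without which the variance formula can fail. *)

(* Defs.v *)
From HB Require Import structures.
From mathcomp Require Import all_boot all_order all_algebra.
From mathcomp Require Import all_classical all_reals all_analysis.
Import Order.TTheory GRing.Theory Num.Theory.
Import numFieldNormedType.Exports.

Set Implicit Arguments.
Unset Strict Implicit.
Unset Printing Implicit Defensive.

Local Open Scope classical_set_scope.
Local Open Scope ring_scope.

Definition choose_or (A : Type) (x0 : A) (Q : A -> Prop) : A :=
  if pselect (exists x, Q x) is left h then sval (cid h) else x0.

Record increasing_on (R : realType) (T : R) := IncreasingOn {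
  incr_fun :> R -> R;
  incr_funP : {in `[0, T] &, {homo incr_fun : x y / x <= y}} }.

Section stieltjes.
Context {R : realType} {T : R} (v : increasing_on T).

Definition incr_ext (x : R) : R := v (Num.max 0 (Num.min x T)).

(* right limit v(x+) of the extension *)
Definition incr_rlim (x : R) : R := inf [set incr_ext y | y in `]x, +oo[].

Hypothesis T_ge0 : 0 <= T.

Lemma incr_ext_nd : {homo incr_ext : x y / x <= y}.
Proof.
move=> x y xy; apply: incr_funP.
- by rewrite in_itv/= le_max lexx/= ge_max T_ge0/= ge_min lexx orbT.
- by rewrite in_itv/= le_max lexx/= ge_max T_ge0/= ge_min lexx orbT.
- by rewrite ge_max le_max lexx/= le_max le_min !ge_min xy lexx/= !orbT.
Qed.

Let lb x : lbound [set incr_ext y | y in `]x, +oo[] (incr_ext x).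
Proof.
by move=> _ [y + <-]; rewrite /= in_itv/= andbT => /ltW; exact: incr_ext_nd.
Qed.

Let ne x : [set incr_ext y | y in `]x, +oo[] !=set0.
Proof. by exists (incr_ext (x + 1)), (x + 1) => //=; rewrite in_itv/= andbT ltrDl. Qed.

Let hi x : has_inf [set incr_ext y | y in `]x, +oo[].
Proof. by split; [exact: ne | exists (incr_ext x); exact: lb]. Qed.

Lemma incr_rlim_nd : nondecreasing incr_rlim.
Proof.
move=> x y xy; apply: lb_le_inf; first exact: ne.
move=> _ [z + <-]; rewrite /= in_itv/= andbT => yz.
apply: ge_inf; first by exists (incr_ext x); exact: lb.
by exists z => //=; rewrite in_itv/= andbT (le_lt_trans xy).
Qed.

Lemma incr_rlim_rc : right_continuous incr_rlim.
Proof.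
move=> x; apply/(@cvgrPdist_lt _ R^o) => e e0.
have [_ [y /=] + <-] := inf_adherent e0 (hi x).
rewrite in_itv/= andbT => xy ye; near=> z.
have xz : x < z by near: z; exact: nbhs_right_gt.
have zy : z < y by near: z; exact: nbhs_right_lt.
rewrite distrC ger0_norm ?subr_ge0; last by apply: incr_rlim_nd; exact: ltW.
rewrite ltrBlDl; apply: le_lt_trans ye.
apply: ge_inf; first by exists (incr_ext z); exact: lb.
by exists y => //=; rewrite in_itv/= andbT.
Unshelve. all: by end_near. Qed.

Definition incr_cumulative : cumulative R R :=
  HB.pack incr_rlim
    (isCumulative.Build R _ R incr_rlim incr_rlim_nd incr_rlim_rc).

End stieltjes.

(* The measure dv, with dv [a, b[ = v(b-) - v(a-) for 0 <= a <= b <= T,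
   where v(0-) = v 0. Since 1_t is the indicator of [0, t[, the integral from
   0 to t against dv is over [0, t[; this only matters at the atoms of dv. *)
Definition stieltjes (R : realType) (T : R) (T_ge0 : 0 <= T)
    (v : increasing_on T) : set (measurableTypeR R) -> \bar R :=
  lebesgue_stieltjes_measure (incr_cumulative v T_ge0).
HB.instance Definition _ (R : realType) (T : R) (T_ge0 : 0 <= T)
    (v : increasing_on T) :=
  SigmaFiniteMeasure.on (stieltjes T_ge0 v).

(* [:: (a_1, t_1); ...; (a_n, t_n)] stands for the sum of the a_i 1_(t_i) *)
Definition step (R : realType) := seq (R * R).

Definition step_on (R : realType) (u : R) (f : step R) : Prop :=
  forall p, p \in f -> 0 <= p.2 <= u.

Definition step_sub (R : realType) (f g : step R) : step R :=
  f ++ [seq (- p.1, p.2) | p <- g].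

(* <1_t, 1_s> = C t s, extended bilinearly *)
Definition lambda_dot (R : realType) (C : R -> R -> R) (f g : step R) : R :=
  \sum_(p <- f) \sum_(q <- g) p.1 * q.1 * C p.2 q.2.

(* The elements of the closure of the 1_t, t in [0, u], are represented by the
   sequences of step functions that are Cauchy for lambda_dot C. Two of them are
   the same integrand if their difference tends to 0; the operations below do
   not depend on the representative. *)
Definition integrand_on (R : realType) (C : R -> R -> R) (u : R)
    (f : nat -> step R) : Prop :=
  (forall n, step_on u (f n)) /\
  (forall e, 0 < e -> exists n0, forall m n, (n0 <= m)%N -> (n0 <= n)%N ->
    lambda_dot C (step_sub (f m) (f n)) (step_sub (f m) (f n)) < e).

(* K^*[1_t] = K t as an element of L^2([0, T[, dv). The factor 1_t s discards
   the value K t t, which plays no role in the covariance of the process; it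
   is relevant only if dv has an atom at t, and then makes K^* isometric. *)
Definition Kstar_step (R : realType) (K : R -> R -> R) (f : step R) (s : R) : R :=
  \sum_(p <- f) p.1 * (K p.2 s * \1_`[0, p.2[%classic s).

(* K^*[f] = g in L^2([0, b[, dv) *)
Definition Kstar_eq (R : realType) (K : R -> R -> R) (dv : set (measurableTypeR R) -> \bar R)
    (b : R) (f : nat -> step R) (g : R -> R) : Prop :=
  (fun n => \int[dv]_(s in `[0%R, b[) ((Kstar_step K (f n) s - g s) ^+ 2)%:E)%E
    @ \oo --> 0%E.

(* (K^* )^-1[g], as an integrand on [0, u] *)
Definition Kstar_inv (R : realType) (C : R -> R -> R) (K : R -> R -> R)
    (dv : set (measurableTypeR R) -> \bar R) (u : R) (g : R -> R) : nat -> step R :=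
  choose_or (fun=> [::])
    (fun f => integrand_on C u f /\ Kstar_eq K dv u f g).

(* Psi(t, . | u). The prediction formula
     E[G_t | F^G_u] = G_u - int_0^u Psi(t, r | u) dG_r,
   whose left-hand side is int_0^u K(t, .) dW with G_u = int_0^u K(u, .) dW,
   forces K^*[Psi(t, . | u)] = K(u, .) - K(t, .) on [0, u[: with the opposite
   difference, the integral would have to be added to G_u. *)
Definition Psi (R : realType) (C : R -> R -> R) (K : R -> R -> R)
    (dv : set (measurableTypeR R) -> \bar R) (t u : R) : nat -> step R :=
  Kstar_inv C K dv u (fun s => K u s - K t s).

(* Phi(dx; m, s2), the unit mass at m if s2 = 0 *)
Definition Phi (R : realType) (m s2 : R) : set R -> \bar R :=
  if s2 == 0 then \d_m else normal_prob m (Num.sqrt s2).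

(* rho(dx - a) *)
Definition translate (R : realType) (rho : set R -> \bar R) (a : R) :
    set R -> \bar R :=
  fun A => rho [set x - a | x in A].

Fixpoint conv_pow (R : realType) (F : set R -> \bar R) (n : nat) :
    set R -> \bar R :=
  match n with
  | 0 => \d_(0 : R)
  | 1 => F
  | n'.+1 => fun A => (\int[conv_pow F n']_y translate F y A)%E
  end.

(* Not poisson_pmf, which is constantly 1 at rate 0. *)
Definition poisson_weight (R : realType) (r : R) (n : nat) : R :=
  expR (- r) * r ^+ n / n`!%:R.

Section conditioning.
Context {R : realType} {d : measure_display} {Omega : measurableType d}
  (P : probability Omega R).

Definition sigma_gen {I : Type} {d' : measure_display} {E : measurableType d'}
    (D : set I) (Y : I -> Omega -> E) : set (set Omega) :=
  <<s \bigcup_(i in D) preimage_set_system setT (Y i) measurable >>.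

(* F^Y_u *)
Definition natural_filtration {d' : measure_display} {E : measurableType d'}
    (Y : R -> Omega -> E) (u : R) : set (set Omega) :=
  sigma_gen `[0, u] Y.

Definition independent (A B : set (set Omega)) : Prop :=
  forall X Y, A X -> B Y -> P (X `&` Y) = (P X * P Y)%E.

Definition is_cond_exp (F : set (set Omega)) (Y Z : Omega -> R) : Prop :=
  [/\ forall B, measurable B -> F (Z @^-1` B),
      P.-integrable setT (EFin \o Z) &
      forall A, F A -> (\int[P]_(w in A) (Z w)%:E = \int[P]_(w in A) (Y w)%:E)%E].

(* A version of E[Y | F] *)
Definition cond_exp (F : set (set Omega)) (Y : Omega -> R) : Omega -> R :=
  choose_or (fun=> 0) (is_cond_exp F Y).

Definition cond_cov (F : set (set Omega)) (Y Z : Omega -> R) : Omega -> R :=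
  cond_exp F (fun w => (Y w - cond_exp F Y w) * (Z w - cond_exp F Z w)).

Definition is_cond_law (F : set (set Omega)) (Y : Omega -> R)
    (kappa : Omega -> probability R R) : Prop :=
  forall B, measurable B ->
    is_cond_exp F (\1_(Y @^-1` B)) (fun w => fine (kappa w B)).

(* A regular version of P[Y in dy | F] *)
Definition cond_law (F : set (set Omega)) (Y : Omega -> R) :
    Omega -> probability R R :=
  choose_or (fun=> \d_(0 : R) : probability R R) (is_cond_law F Y).

End conditioning.

Section processes.
Context {R : realType} {d : measure_display} {Omega : measurableType d}
  (P : probability Omega R).

Definition step_integral (G : R -> Omega -> R) (f : step R) (w : Omega) : R :=
  \sum_(p <- f) p.1 * G p.2 w.

Definition is_wiener_integral (G : R -> Omega -> R) (f : nat -> step R)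
    (Z : Omega -> R) : Prop :=
  measurable_fun setT Z /\
  (fun n => \int[P]_w ((step_integral G (f n) w - Z w) ^+ 2)%:E)%E @ \oo --> 0%E.

(* int_0^u f dG, for an integrand f on [0, u] *)
Definition wiener_integral (G : R -> Omega -> R) (f : nat -> step R) :
    Omega -> R :=
  choose_or (fun=> 0) (is_wiener_integral G f).

(* All finite linear combinations are normal, possibly degenerate. *)
Definition gaussian_process (T : R) (G : R -> Omega -> R) : Prop :=
  forall f : step R, step_on T f ->
    exists m s2, 0 <= s2 /\
      forall B, measurable B -> P (step_integral G f @^-1` B) = Phi m s2 B.

Record gaussian_volterra (T : R) (G : R -> {RV P >-> R}) (C : R -> R -> R)
    (dv : {measure set (measurableTypeR R) -> \bar R}) (K : R -> R -> R) : Prop := {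
  gv_gaussian : gaussian_process T G;
  gv_start : {ae P, forall w, G 0 w = 0};
  gv_centered : forall t, 0 <= t <= T -> ('E_P[G t] = 0)%E;
  gv_cov : forall t s, 0 <= t <= T -> 0 <= s <= T ->
    covariance P (G t) (G s) = (C t s)%:E;
  gv_volterra : forall t s, 0 <= t <= T -> 0 <= s <= T -> t < s -> K t s = 0;
  gv_measurable : forall t, 0 <= t <= T -> measurable_fun `[0, T] (K t);
  gv_square : forall t, 0 <= t <= T ->
    (\int[dv]_(s in `[0%R, t[) ((K t s) ^+ 2)%:E < +oo)%E;
  gv_factor : forall t s, 0 <= t <= T -> 0 <= s <= T ->
    C t s = \int[dv]_(x in `[0, Num.min t s[) (K t x * K s x);
  (* K^-1(t, .) is an integrand over [0, t], not merely over [0, T]: otherwise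
     the closed span of the G_s, s <= u, could miss part of L^2([0, u[, dv) *)
  gv_inverse : forall t, 0 <= t <= T ->
    exists f, integrand_on C t f /\ Kstar_eq K dv T f \1_`[0, t[%classic }.

Record poisson_process (T lambda : R) (N : R -> {RV P >-> nat}) : Prop := {
  pp_start : {ae P, forall w, N 0 w = 0%N};
  pp_nondecreasing : {ae P, forall w, forall r s,
    0 <= r -> r <= s -> s <= T -> (N r w <= N s w)%N};
  pp_right_continuous : {ae P, forall w, forall r,
    0 <= r < T -> \forall s \near r^'+, N s w = N r w};
  pp_law : forall s t k, 0 <= s -> s <= t -> t <= T ->
    P [set w | (N t w - N s w)%N = k] = (poisson_weight (lambda * (t - s)) k)%:E;
  pp_independent : forall s t, 0 <= s -> s <= t -> t <= T ->
    independent P (natural_filtration N s)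
      (preimage_set_system setT (fun w => (N t w - N s w)%N) measurable) }.

(* The jumps are indexed from 0. *)
Record compound_poisson (T lambda : R) (F : probability R R)
    (N : R -> {RV P >-> nat}) (xi : nat -> {RV P >-> R})
    (J : R -> Omega -> R) : Prop := {
  cp_poisson : poisson_process T lambda N;
  cp_law : forall k B, measurable B -> P (xi k @^-1` B) = F B;
  cp_iid : forall n (B : nat -> set R), (forall k, measurable (B k)) ->
    P (\bigcap_(k in `I_n) xi k @^-1` B k) =
    (\prod_(k < n) fine (P (xi k @^-1` B k)))%:E;
  cp_sum : forall t w, 0 <= t <= T -> J t w = \sum_(k < N t w) xi k w }.

End processes.

(* Main.v *)
Require Import Defs.
From HB Require Import structures.
From mathcomp Require Import all_boot all_order all_algebra.
From mathcomp Require Import all_classical all_reals all_analysis.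
From mathcomp Require Import measurable_realfun ring lra.
Import Order.TTheory GRing.Theory Num.Theory.
Import numFieldNormedType.Exports.

Set Implicit Arguments.
Unset Strict Implicit.
Unset Printing Implicit Defensive.

Local Open Scope classical_set_scope.
Local Open Scope ring_scope.

(** A residual of the Gaussian part that is orthogonal to the past is independent
    of the past, because laws are determined by weighted moment generating
    functions. The inverse kernels K^{-1}(r, .), r <= u, make the functions
    K^*[1_r] total in L^2([0, u[, dv), so that Psi(t, .|u) exists, and under the
    isometry G_r |-> K(r, .) the variable U_t = G_t - G_u + int_0^u Psi dG
    corresponds to K(t, .) 1_[u, t[, whence its orthogonality and its covariances.

    On {N_u = n} an event of F^J_u is described by (N_r), r <= u, and by the first n
    jumps, hence J_t - J_u is independent of F^J_u and is a Poisson mixture of the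
    convolution powers of F.

    Finally G is continuous, so the jumps of X are those of J and are read off
    the increments of X on finer and finer grids. Therefore G_r and J_r, r <= u,
    have F^X_u-measurable versions, and X_t is the sum of the F^X_u-measurable
    X_u - int_0^u Psi dG and of U_t + (J_t - J_u), which is independent of F^X_u.
    The conditional mean, covariance and law follow from this decomposition. *)

(** * Uniqueness of weighted moment generating functions *)

(** Real exponentials take the place of characteristic functions: Gaussian variables have all
    exponential moments, the integrals stay real, and exponentials of further coordinates serve as
    weights.

    Two features of the definitions shape the rest. [cond_exp], [cond_law], [wiener_integral] and
    [Psi] are arbitrary choices among the objects with a defining property, with a default value if
    there is none; existence must therefore be proved before the chosen object can be described, and
    the description holds up to null sets. Moreover the filtrations are not completed, and the
    chosen Wiener integral is only known to be measurable for the ambient sigma-algebra. Hence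
    decompositions are written with versions that are measurable for the small sigma-algebra at
    every point and agree almost surely with the given variables, whereas independence passes by
    inclusion from the join of F^G_u and F^J_u to F^X_u.

    For the covariance, polarization reduces a pair of innovations to each of them and their sum, so
    that independence of the past is only ever stated for a scalar variable. *)

Section sum_indic.
Context {T : Type} {R : realType}.
Implicit Types F : (set T)^nat.

Lemma sum_indic_trivIset F n (x : T) : trivIset setT F ->
  \sum_(0 <= i < n) \1_(F i) x = \1_(\bigcup_(i in `I_n) F i) x :> R.
Proof.
move=> tF; elim: n => [|n ih].
  by rewrite big_geq// II0 bigcup_set0 indic0.
rewrite big_nat_recr//= ih !indicE.
have [Fx|Fx] := pselect (F n x).
  rewrite [x \in F n]mem_set// [x \in \bigcup_(_ in `I_n.+1) _]mem_set; last by exists n => /=.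
  rewrite memNset ?add0r// => -[i /= ni Fi].
  suff : i = n by move=> ein; move: ni; rewrite ein ltnn.
  by apply: tF => //; exists x.
rewrite [x \in F n]memNset// addr0; congr (_ %:R); congr nat_of_bool.
apply/idP/idP => /set_mem [i /= ni Fi]; apply/mem_set; exists i => //=.
  exact: ltnW.
by move: ni; rewrite ltnS leq_eqVlt => /predU1P[ein|//]; move: Fi; rewrite ein.
Qed.

Lemma cvg_sum_indic_trivIset F (x : T) : trivIset setT F ->
  (\sum_(0 <= i < n) \1_(F i) x : R) @[n --> \oo] --> (\1_(\bigcup_i F i) x : R).
Proof.
move=> tF; have [Fx|Fx] := pselect ((\bigcup_i F i) x).
  case: (Fx) => i _ Fi; apply: (@cvg_trans _ (cst (\1_(\bigcup_i F i) x : R) @ \oo)); last exact: cvg_cst.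
  apply: near_eq_cvg; exists i.+1 => // n /= ni.
  by rewrite sum_indic_trivIset// !indicE !mem_set//; exists i.
apply: (@cvg_trans _ (cst (\1_(\bigcup_i F i) x : R) @ \oo)); last exact: cvg_cst.
apply: near_eq_cvg; apply: nearW => n.
rewrite sum_indic_trivIset// !indicE !memNset// => -[i _ Fi].
by apply: Fx; exists i.
Qed.

End sum_indic.

Section exp_growth.
Context {R : realType}.
Implicit Types (x y c : R) (f g : R -> R).

Lemma expR_sub1_le y : expR y - 1 <= y * expR y.
Proof.
have := expR_ge1Dx (- y); rewrite expRN => h.
have e0 := expR_gt0 y.
have : (1 + - y) * expR y <= 1 by rewrite -ler_pdivlMr// div1r.
by lra.
Qed.

Lemma expR_sub1_ge y : y <= expR y - 1.
Proof. by have := expR_ge1Dx y; lra. Qed.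

Lemma norm_le_expR x : `|x| <= expR `|x|.
Proof. by have := expR_ge1Dx `|x|; lra. Qed.

Lemma norm_expR_sub1 y : `|expR y - 1| <= `|y| * expR `|y|.
Proof.
have [y0|y0] := leP 0 y.
  rewrite !ger0_norm// ?expR_sub1_le// subr_ge0 -expR0 ler_expR//.
have := expR_sub1_ge y => h.
rewrite ler0_norm; last by rewrite subr_le0 -expR0 ler_expR ltW.
rewrite [`|y|](ler0_norm (ltW y0)).
have e1 : 1 <= expR (- y) by rewrite -expR0 ler_expR; lra.
have y1 : 0 < - y by lra.
have : 0 <= - y * (expR (- y) - 1) by apply: mulr_ge0; [exact: ltW|rewrite subr_ge0].
by lra.
Qed.

(** Squeezed between [c_ n] and [c_ n * expR (c_ n * delta n)] by y <= e^y - 1 <= y e^y. The slope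
    varies with n because the exponent of a Gaussian mgf at 1/n is linear in 1/n only up to a
    quadratic term. *)
Lemma cvg_expR_sub1_seq (c_ delta : nat -> R) (c : R) :
  (forall n, 0 < delta n) -> delta n @[n --> \oo] --> 0 -> c_ n @[n --> \oo] --> c ->
  ((delta n)^-1 * (expR (c_ n * delta n) - 1)) @[n --> \oo] --> c.
Proof.
move=> d0 cd cc.
have cx : (c_ n * delta n) @[n --> \oo] --> 0.
  by rewrite -(mulr0 c); apply: cvgM.
have ce : (c_ n * expR (c_ n * delta n)) @[n --> \oo] --> c.
  rewrite [X in _ --> X](_ : c = c * expR 0); last by rewrite expR0 mulr1.
  apply: cvgM; first exact: cc.
  by apply: continuous_cvg; [exact: continuous_expR|exact: cx].
apply: (@squeeze_cvgr _ _ _ _ c_ _ _ _ _ cc ce).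
apply: nearW => n; apply/andP; split => /=.
  by rewrite mulrC ler_pdivlMr// expR_sub1_ge.
rewrite ler_pdivrMl//; apply: le_trans (expR_sub1_le _) _.
by rewrite [c_ n * delta n]mulrC mulrA.
Qed.

Lemma cvg_expR_sub1 x : (n.+1%:R * (expR (x / n.+1%:R) - 1)) @[n --> \oo] --> x.
Proof.
rewrite (_ : (fun n => _) = fun n => (n.+1%:R^-1)^-1 * (expR (x / n.+1%:R) - 1)); last first.
  by apply/funext => n; rewrite invrK.
apply: (@cvg_expR_sub1_seq (cst x)); [|exact: cvg_harmonic|exact: cvg_cst].
by move=> n; rewrite invr_gt0 ltr0n.
Qed.

(** With 1 + |x| instead of |x| in the exponent, constant factors are absorbed by enlarging [c],
    which closes the class under sums. *)
Definition exp_bounded c f := forall x, `|f x| <= expR (c * (1 + `|x|)).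

Lemma exp_boundedM c1 c2 f g :
  exp_bounded c1 f -> exp_bounded c2 g -> exp_bounded (c1 + c2) (f \* g).
Proof.
by move=> fc gc x /=; rewrite normrM mulrDl expRD ler_pM.
Qed.

Lemma exp_boundedX c f n : exp_bounded c f -> exp_bounded (n%:R * c) (fun x => f x ^+ n).
Proof.
by move=> fc x; rewrite normrX -mulrA expRM_natl lerXn2r// nnegrE ?normr_ge0 ?expR_ge0.
Qed.

Lemma exp_boundedW c1 c2 f : c1 <= c2 -> exp_bounded c1 f -> exp_bounded c2 f.
Proof.
move=> c12 fc x; apply: le_trans (fc x) _.
by rewrite ler_expR ler_wpM2r// addr_ge0.
Qed.

Lemma exp_bounded1 c f : 0 <= c -> (forall x, `|f x| <= 1) -> exp_bounded c f.
Proof.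
move=> c0 f1 x; apply: le_trans (f1 x) _.
by rewrite -expR0 ler_expR mulr_ge0// addr_ge0.
Qed.

Lemma exp_bounded_cst c : exp_bounded `|c| (cst c).
Proof.
move=> x /=; apply: le_trans (norm_le_expR _) _.
by rewrite ler_expR ler_peMr// lerDl.
Qed.

Lemma exp_boundedD c1 c2 f g : 0 <= c1 -> 0 <= c2 ->
  exp_bounded c1 f -> exp_bounded c2 g -> exp_bounded (c1 + c2 + 1) (f \+ g).
Proof.
move=> c10 c20 fc gc x /=; apply: le_trans (ler_normD _ _) _.
have h1 : `|f x| <= expR ((c1 + c2) * (1 + `|x|)).
  by apply: exp_boundedW (fc) _; rewrite lerDl.
have h2 : `|g x| <= expR ((c1 + c2) * (1 + `|x|)).
  by apply: exp_boundedW (gc) _; rewrite lerDr.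
rewrite [(_ + 1) * _]mulrDl mul1r expRD.
have e2 : 2 <= expR (1 + `|x|).
  by have := expR_ge1Dx (1 + `|x|); have := normr_ge0 x; lra.
apply: (@le_trans _ _ (expR ((c1 + c2) * (1 + `|x|)) * 2)); first by lra.
by rewrite ler_wpM2l// expR_ge0.
Qed.

Lemma exp_bounded_expR a : exp_bounded `|a| (fun x => expR (a * x)).
Proof.
move=> x; rewrite ger0_norm ?expR_ge0// ler_expR.
apply: le_trans (ler_norm _) _; rewrite normrM ler_wpM2l//.
by rewrite lerDr.
Qed.

(** The constant 2 is uniform in n, as |n (e^(x/n) - 1)| <= |x| e^|x| <= e^(2|x|); this makes the
    passage to the limit x dominated. *)
Lemma exp_bounded_quotient n :
  exp_bounded 2 (fun x => n.+1%:R * (expR (x / n.+1%:R) - 1)).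
Proof.
move=> x; have n0 : 0 < n.+1%:R :> R by rewrite ltr0n.
rewrite normrM (gtr0_norm n0).
apply: le_trans (ler_wpM2l (ltW n0) (norm_expR_sub1 _)) _.
rewrite normrM normfV (gtr0_norm n0) mulrA mulrCA mulfV ?gt_eqF// mulr1.
have h : `|x| / n.+1%:R <= `|x|.
  by rewrite ler_pdivrMr// ler_peMr// ler1n.
apply: (@le_trans _ _ (expR `|x| * expR `|x|)).
  by rewrite ler_pM ?norm_le_expR ?ler_expR ?expR_ge0.
by rewrite -expRD ler_expR; have := normr_ge0 x; lra.
Qed.

(* A class of functions containing the exponentials, linear and closed under
   exponentially dominated limits contains all Borel indicators: it contains
   x^k = lim ((e^(x/n) - 1) n)^k, then cos and sin by their power series, then the
   trigonometric polynomials (1 - w^k)^(2^k) with w = (1 + cos) / 2, which tend to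
   1 where w < 1/2 and to 0 where w > 1/2, and finally half-lines. *)
Variable S : (R -> R) -> Prop.
Hypothesis S_exp : forall a, S (fun x => expR (a * x)).
Hypothesis S_lin : forall k f g, S f -> S g -> S (fun x => k * f x + g x).
Hypothesis S_lim : forall (h : nat -> R -> R) f c, (forall n, S (h n)) ->
  (forall n, exp_bounded c (h n)) -> (forall x, h n x @[n --> \oo] --> f x) -> S f.

Let S_ext f g : f =1 g -> S f -> S g.
Proof. by move=> /funext ->. Qed.

Let S1 : S (cst 1).
Proof. by apply: S_ext (S_exp 0) => x /=; rewrite mul0r expR0. Qed.

Let S0 : S (cst 0).
Proof. by apply: S_ext (S_lin (-1) S1 S1) => x /=; lra. Qed.

Let S_scale k f : S f -> S (fun x => k * f x).
Proof. by move=> Sf; apply: S_ext (S_lin k Sf S0) => x /=; rewrite addr0. Qed.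

Let S_add f g : S f -> S g -> S (fun x => f x + g x).
Proof. by move=> Sf Sg; apply: S_ext (S_lin 1 Sf Sg) => x /=; rewrite mul1r. Qed.

Let S_sum (f : nat -> R -> R) n : (forall i, S (f i)) ->
  S (fun x => \sum_(0 <= i < n) f i x).
Proof.
move=> Sf; elim: n => [|n ih].
  by apply: S_ext S0 => x; rewrite big_geq.
by apply: S_ext (S_add ih (Sf n)) => x; rewrite big_nat_recr.
Qed.

(** [S] is linear but not assumed closed under products. The induction on k therefore carries an
    exponential factor for every [a], and multiplying by e^(bx) - 1 merely shifts [a]. *)
Lemma exp_class_quotientX a b N k :
  S (fun x => expR (a * x) * (N * (expR (b * x) - 1)) ^+ k).
Proof.
elim: k a => [|k ih] a.
  by apply: S_ext (S_exp a) => x; rewrite expr0 mulr1.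
apply: S_ext (S_lin (- N) (ih a) (S_scale N (ih (a + b)))) => x /=.
by rewrite mulrDl expRD exprS; ring.
Qed.

Lemma exp_classX k : S (fun x => x ^+ k).
Proof.
apply: (S_lim (h := fun n x => (n.+1%:R * (expR (x / n.+1%:R) - 1)) ^+ k)).
- move=> n; apply: S_ext (exp_class_quotientX 0 n.+1%:R^-1 n.+1%:R k) => x.
  by rewrite mul0r expR0 mul1r [_^-1 * _]mulrC.
- by move=> n; apply: exp_boundedX; exact: exp_bounded_quotient.
- move=> x; apply: (@continuous_cvg _ _ _ _ _ _ (fun y : R => y ^+ k)).
    exact: exprn_continuous.
  exact: cvg_expR_sub1.
Qed.

(** As |a n| <= 1, the partial sums are dominated by those of the exponential series, hence by
    e^|bx| uniformly in n, which is what [S_lim] asks for. *)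
Let exp_class_series (u : R -> nat -> R) (a : nat -> R) f (b : R) :
  (forall x n, u x n = a n * (b * x) ^+ n / n`!%:R) -> (forall n, `|a n| <= 1) ->
  (forall x, series (u x) @ \oo --> f x) -> S f.
Proof.
move=> uE a1 uf.
apply: (S_lim (h := fun n x => series (u x) n) (c := `|b|)) => //.
  move=> n; apply: (@S_sum (fun i x => u x i)) => i.
  apply: S_ext (S_scale (a i * b ^+ i / i`!%:R) (exp_classX i)) => x.
  by rewrite uE exprMn; ring.
move=> n x; apply: (@le_trans _ _ (expR (`|b * x|))); last first.
  by rewrite normrM ler_expR ler_wpM2l// lerDr.
apply: (@le_trans _ _ (series (exp_coeff `|b * x|) n)).
  rewrite /series/=; apply: le_trans (ler_norm_sum _ _ _) _.
  apply: ler_sum => i _; rewrite uE /exp_coeff/= !normrM normfV normrX normr_nat.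
  apply: ler_wpM2r; first by rewrite invr_ge0 ler0n.
  by rewrite -(normrM b x); apply: ler_piMl => //; rewrite exprn_ge0.
have nd : nondecreasing_seq (series (exp_coeff `|b * x|)).
  apply/nondecreasing_seqP => k; rewrite /series/= big_nat_recr//= lerDl.
  exact: exp_coeff_ge0.
exact: (nondecreasing_cvgn_le nd (@is_cvg_series_exp_coeff _ _)).
Qed.

Lemma exp_class_cos b : S (fun x => cos (b * x)).
Proof.
apply: (@exp_class_series (fun x => cos_coeff (b * x))
  (fun n => (~~ odd n)%:R * (-1) ^+ n./2) _ b) => //.
  move=> n; rewrite normrM normrX normrN normr1 expr1n mulr1 normr_nat.
  by rewrite lern1; case: odd.
by move=> x; rewrite unlock; exact: is_cvg_series_cos_coeff.
Qed.

Lemma exp_class_sin b : S (fun x => sin (b * x)).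
Proof.
apply: (@exp_class_series (fun x => sin_coeff (b * x))
  (fun n => (odd n)%:R * (-1) ^+ n.-1./2) _ b) => //.
  move=> n; rewrite normrM normrX normrN normr1 expr1n mulr1 normr_nat.
  by rewrite lern1; case: odd.
by move=> x; rewrite unlock; exact: is_cvg_series_sin_coeff.
Qed.

(** A substitute for closure under products: membership after multiplication by any wave is stable
    under one more wave, by the product-to-sum formula. *)
Let M f := forall a b, S (fun x => f x * cos (a * x + b)).

Let M1 : M (cst 1).
Proof.
move=> a b.
apply: S_ext (S_lin (cos b) (exp_class_cos a) (S_scale (- sin b) (exp_class_sin a))).
by move=> x /=; rewrite mul1r cosD; ring.
Qed.

Let M_lin k f g : M f -> M g -> M (fun x => k * f x + g x).
Proof.
by move=> Mf Mg a b; apply: S_ext (S_lin k (Mf a b) (Mg a b)) => x; ring.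
Qed.

Let M_ext f g : f =1 g -> M f -> M g.
Proof. by move=> /funext ->. Qed.

Let M_cos f a0 b0 : M f -> M (fun x => f x * cos (a0 * x + b0)).
Proof.
move=> Mf a b.
apply: S_ext (S_lin 2^-1 (Mf (a0 + a) (b0 + b)) (S_scale 2^-1 (Mf (a0 - a) (b0 - b)))).
move=> x /=.
have -> : (a0 + a) * x + (b0 + b) = (a0 * x + b0) + (a * x + b) by ring.
have -> : (a0 - a) * x + (b0 - b) = (a0 * x + b0) - (a * x + b) by ring.
by rewrite cosD cosB; field.
Qed.

Let M_wave f a0 b0 k : M f ->
  M (fun x => f x * ((1 + cos (a0 * x + b0)) / 2) ^+ k).
Proof.
move=> Mf; elim: k => [|k ih].
  by apply: M_ext Mf => x; rewrite expr0 mulr1.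
have M0 : M (fun x => 0 * cst 1 x).
  by apply: M_ext (M_lin (-1) M1 M1) => x /=; lra.
have h := M_lin 2^-1 ih (M_lin 2^-1 (M_cos a0 b0 ih) M0).
by apply: M_ext h => x /=; rewrite exprSr; field.
Qed.

Let M_step a0 b0 k m :
  M (fun x => (1 - ((1 + cos (a0 * x + b0)) / 2) ^+ k) ^+ m).
Proof.
elim: m => [|m ih]; first by apply: M_ext M1 => x; rewrite expr0.
apply: M_ext (M_lin (-1) (M_wave a0 b0 k ih) ih) => x /=.
by rewrite exprSr; ring.
Qed.

Let S_step a0 b0 k m :
  S (fun x => (1 - ((1 + cos (a0 * x + b0)) / 2) ^+ k) ^+ m).
Proof.
by apply: S_ext (@M_step a0 b0 k m 0 0) => x; rewrite mul0r add0r cos0 mulr1.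
Qed.

Let bernoulli_le (a : R) n : 0 <= a <= 1 -> 1 - n%:R * a <= (1 - a) ^+ n.
Proof.
move=> /andP[a0 a1]; elim: n => [|n ih]; first by rewrite mul0r subr0 expr0.
rewrite exprS; apply: (@le_trans _ _ ((1 - a) * (1 - n%:R * a))); last first.
  by apply: ler_wpM2l => //; rewrite subr_ge0.
rewrite -natr1; have := ler0n R n; set m := n%:R => m0.
have : 0 <= m * a * a by rewrite !mulr_ge0.
by lra.
Qed.

Let bernoulli_ge (a : R) n : 0 <= a <= 1 -> (1 - a) ^+ n * (1 + n%:R * a) <= 1.
Proof.
move=> /andP[a0 a1]; elim: n => [|n ih]; first by rewrite mul0r addr0 expr0 mulr1.
apply: le_trans ih; rewrite exprSr -mulrA; apply: ler_wpM2l.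
  by rewrite exprn_ge0// subr_ge0.
rewrite -natr1; have := ler0n R n; set m := n%:R => m0.
have : 0 <= m * a * a by rewrite !mulr_ge0.
by nra.
Qed.

(** The limit at the tie w = 1/2. It exists by monotonicity, is bounded by 1, and disappears once
    half-lines are approached by thresholds placed to their left. *)
Let ell : R := limn (fun k => (1 - 2^-1 ^+ k) ^+ (2 ^ k) : R).

Let half01 k : 0 <= (2^-1 : R) ^+ k <= 1.
Proof. by rewrite exprn_ge0 ?exprn_ile1//; lra. Qed.

Let cvg_ell : (1 - 2^-1 ^+ k) ^+ (2 ^ k) @[k --> \oo] --> ell.
Proof.
apply: (@nondecreasing_is_cvgn _ (fun k => (1 - 2^-1 ^+ k) ^+ (2 ^ k))).
  (* With q = 2^-k the next term is ((1 - q/2)^2)^(2^k), and (1 - q/2)^2 >= 1 - q. *)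
  apply/nondecreasing_seqP => k; rewrite expnS exprM.
  have := half01 k; rewrite [2^-1 ^+ k.+1]exprS; set q := _ ^+ k => /andP[q0 q1].
  rewrite lerXn2r// ?nnegrE; [lra|exact: sqr_ge0|].
  by have := sqr_ge0 q; rewrite expr2; lra.
by exists 1 => _ [k _ <-]; have /andP[h0 h1] := half01 k; rewrite exprn_ile1//; lra.
Qed.

Definition threshold (l w : R) : R :=
  if w < 2^-1 then 1 else if w == 2^-1 then l else 0.

(** As 2^k w^k = (2w)^k, Bernoulli's inequality bounds the power below by 1 - (2w)^k, which settles
    w < 1/2; its companion (1 - a)^n (1 + n a) <= 1 bounds it above by (2w)^-k, which settles w >
    1/2. *)
Let cvg_threshold w : 0 <= w <= 1 ->
  (1 - w ^+ k) ^+ (2 ^ k) @[k --> \oo] --> threshold ell w.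
Proof.
move=> /andP[w0 w1]; rewrite /threshold.
have w01 k : 0 <= w ^+ k <= 1 by rewrite exprn_ge0 ?exprn_ile1.
have wk k : (2 ^ k)%:R * w ^+ k = (2 * w) ^+ k by rewrite natrX exprMn.
case: ltgtP => wh; last by rewrite wh; exact: cvg_ell.
- have c : 1 - (2 * w) ^+ k @[k --> \oo] --> (1 : R).
    rewrite -[X in _ --> X](subr0 1); apply: cvgB; first exact: cvg_cst.
    by apply: cvg_expr; rewrite ger0_norm; lra.
  apply: (@squeeze_cvgr _ _ _ _ _ (cst 1) _ _ _ c); last exact: cvg_cst.
  apply: nearW => k; rewrite -wk bernoulli_le//=.
  by have /andP[h0 h1] := w01 k; rewrite exprn_ile1//; lra.
- have c : (2 * w)^-1 ^+ k @[k --> \oo] --> (0 : R).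
    apply: cvg_expr; rewrite ger0_norm ?invr_ge0; last by lra.
    by rewrite invf_lt1; lra.
  apply: (@squeeze_cvgr _ _ _ _ (cst 0) _ _ _ _ _ c); last exact: cvg_cst.
  apply: nearW => k /=; have /andP[w0k w1k] := w01 k.
  have u0 : 0 <= (1 - w ^+ k) ^+ (2 ^ k) by rewrite exprn_ge0// subr_ge0.
  rewrite u0/= exprVn -div1r ler_pdivlMr ?exprn_gt0//; last by lra.
  apply: le_trans (@bernoulli_ge (w ^+ k) (2 ^ k) (w01 k)).
  by rewrite wk ler_wpM2l// lerDr.
Qed.

Let S_threshold a b : S (fun x => threshold ell ((1 + cos (a * x + b)) / 2)).
Proof.
have c01 (y : R) : 0 <= (1 + cos y) / 2 <= 1.
  by have := cos_max y; rewrite ler_norml => /andP[]; lra.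
apply: (S_lim (h := fun k x => (1 - ((1 + cos (a * x + b)) / 2) ^+ k) ^+ (2 ^ k)) (c := 0)).
- by move=> n; exact: S_step.
- move=> n; apply: exp_bounded1 => // x.
  have /andP[] := c01 (a * x + b); set w := _ / 2 => c0 c1.
  have u0 : 0 <= w ^+ n by exact: exprn_ge0.
  have u1 : w ^+ n <= 1 by exact: exprn_ile1.
  by rewrite ger0_norm ?exprn_ge0 ?exprn_ile1//; lra.
- by move=> x; apply: cvg_threshold.
Qed.

Let ell01 : `|ell| <= 1.
Proof.
have ex : forall k, 0 <= (1 - (2^-1 : R) ^+ k) ^+ (2 ^ k) <= 1.
  move=> k; have /andP[h0 h1] := half01 k.
  by rewrite exprn_ge0 ?exprn_ile1//; lra.
have cv : cvgn (fun k => (1 - 2^-1 ^+ k) ^+ (2 ^ k) : R) by apply: cvgP cvg_ell.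
rewrite ger0_norm.
  by apply: limr_le => //; apply: nearW => k; have /andP[] := ex k.
by apply: limr_ge => //; apply: nearW => k; have /andP[] := ex k.
Qed.

Let threshold_norm w : `|threshold ell w| <= 1.
Proof.
by rewrite /threshold; case: ifPn => _; [rewrite normr1|case: ifPn; rewrite ?normr0].
Qed.

(** The phase -pi/2 turns the cosine into sin((x - p)/m), whose sign is that of x - p as long as |x
    - p| < m pi. Letting m grow pushes the other periods to infinity. *)
Let S_half p : S (fun x => if x < p then 1 else if x == p then ell else 0).
Proof.
pose h (m : nat) x := threshold ell ((1 + cos (m.+1%:R^-1 * x + (- (p / m.+1%:R) - pi / 2))) / 2).
apply: (S_lim (h := h) (c := 0)); first by move=> n; exact: S_threshold.
  by move=> n; apply: exp_bounded1 => // x; exact: threshold_norm.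
move=> x.
have hE m : h m x = threshold ell ((1 + sin ((x - p) / m.+1%:R)) / 2).
  by rewrite /h -cosBpihalf; congr (threshold _ ((1 + cos _) / 2)); rewrite mulrBl; ring.
apply: (@cvg_trans _ (cst (if x < p then 1 else if x == p then ell else 0) @ \oo)); last exact: cvg_cst.
apply: near_eq_cvg; near=> m.
rewrite hE /threshold/=.
have m0 : 0 < m.+1%:R :> R by rewrite ltr0n.
have xm : `|x - p| / m.+1%:R < pi.
  rewrite ltr_pdivrMr// -ltr_pdivrMl ?pi_gt0//.
  apply: (@lt_trans _ _ m%:R); last by rewrite ltr_nat.
  by near: m; exact: nbhs_infty_gtr.
case: (ltgtP x p) => xp.
- have : sin ((p - x) / m.+1%:R) > 0.
    apply: sin_gt0_pi; rewrite divr_gt0 ?subr_gt0//=.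
    by move: xm; rewrite ler0_norm ?opprB// subr_le0 ltW.
  by rewrite -opprB mulNr sinN => h0; rewrite ifT//; lra.
- have h0 : sin ((x - p) / m.+1%:R) > 0.
    apply: sin_gt0_pi; rewrite divr_gt0 ?subr_gt0//=.
    by move: xm; rewrite ger0_norm// subr_ge0 ltW.
  by rewrite ifF ?ifF//; [apply/eqP; lra|apply/negbTE; rewrite -leNgt; lra].
- by rewrite xp subrr mul0r sin0 addr0 div1r ltxx eqxx.
Unshelve. all: by end_near. Qed.

Lemma exp_class_indic (B : set R) : measurable B -> S \1_B.
Proof.
move=> mB; have mE := measurable_realfun.RGenInftyO.measurableE R.
have mB' : (@measurable_realfun.RGenInftyO.G R).-sigma.-measurable B by rewrite -mE.
apply: (@dynkin_induction _ _ (@measurable_realfun.RGenInftyO.G R)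
  [set B | S \1_B] mE _ _ _ _ _ B); [| | | | | exact: mB'].
- move=> _ _ [x ->] [y ->]; exists (Num.min x y).
  by apply/seteqP; split => z /=; rewrite !in_itv/= lt_min => /andP.
- by apply: S_ext S1 => x; rewrite indicT.
- move=> _ [p ->].
  (* Thresholds increasing to p from the left: for fixed x the tie occurs for no large n, so the
     value [ell] leaves no trace and the limit is the open half-line. *)
  apply: (S_lim (h := fun n x => if x < p - n.+1%:R^-1 then 1 else
    if x == p - n.+1%:R^-1 then ell else 0) (c := 0)).
  + by move=> n; exact: S_half.
  + move=> n; apply: exp_bounded1 => // x.
    by case: ifPn => _; [rewrite normr1|case: ifPn; rewrite ?normr0].
  + move=> x.
    apply: (@cvg_trans _ (cst (\1_(`]-oo, p[%classic) x : R) @ \oo)); last exact: cvg_cst.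
    have n0 n : 0 < n.+1%:R^-1 :> R by rewrite invr_gt0.
    apply: near_eq_cvg; have [xp|xp] := ltP x p.
      have px0 : 0 < p - x by rewrite subr_gt0.
      near=> n; rewrite /= indicE mem_setE in_itv/= xp ifT// ltrBrDr -ltrBrDl.
      by near: n; exact: (near_infty_natSinv_lt (PosNum px0)).
    near=> n; have := n0 n => {}n0; rewrite /= indicE mem_setE in_itv/= ltNge xp/=.
    have xn : p - n.+1%:R^-1 < x by rewrite ltrBlDr (le_lt_trans xp)// ltrDl.
    by rewrite ltNge (ltW xn)/= gt_eqF.
- move=> A mA SA; apply: S_ext (S_lin (-1) SA S1) => x /=.
  by rewrite indicC indicE; case: (x \in A) => /=; lra.
- move=> F mF tF SF.
  apply: (S_lim (h := fun n x => \sum_(0 <= i < n) \1_(F i) x) (c := 0)).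
  + by move=> n; apply: S_sum.
  + move=> n; apply: exp_bounded1 => // x.
    by rewrite sum_indic_trivIset// indicE normr_nat; case: (_ \in _).
  + by move=> x; exact: cvg_sum_indic_trivIset.
Unshelve. all: by end_near. Qed.

End exp_growth.

Section mgf_uniqueness.
Context {R : realType} {d1 d2 : measure_display}
  {T1 : measurableType d1} {T2 : measurableType d2}
  (mu1 : {measure set T1 -> \bar R}) (mu2 : {measure set T2 -> \bar R})
  (U1 Y1 : T1 -> R) (U2 Y2 : T2 -> R).

Lemma exp_bounded_le c (f : R -> R) : exp_bounded c f ->
  forall x, `|f x| <= expR c * (expR (c * x) + expR (- c * x)).
Proof.
move=> fc x; apply: le_trans (fc x) _; rewrite mulrDr mulr1 expRD.
rewrite ler_wpM2l ?expR_ge0//.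
have := expR_ge0 (c * x); have := expR_ge0 (- c * x).
case: (leP 0 x) => x0.
  by rewrite ger0_norm//; lra.
by rewrite ltr0_norm// mulrN mulNr; lra.
Qed.

Lemma exp_bounded_integrable d (T : measurableType d) (mu : {measure set T -> \bar R})
    (U Y : T -> R) c (f : R -> R) :
  measurable_fun setT U -> measurable_fun setT Y -> measurable_fun setT f ->
  (forall a, mu.-integrable setT (fun x => (expR (a * U x) * Y x)%:E)) ->
  exp_bounded c f -> mu.-integrable setT (fun x => (f (U x) * Y x)%:E).
Proof.
move=> mU mY mf ie fc.
have i1 := integrableZl measurableT (expR c) (integrableD measurableT (ie c) (ie (- c))).
apply: le_integrable i1 => //.
  apply/measurable_EFinP/measurable_funM => //.
  exact: measurableT_comp.
move=> x _; rewrite -EFinD -EFinM !abse_EFin lee_fin -mulrDl mulrA.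
set e := expR c * _; rewrite (normrM (f _)) (normrM e) ler_wpM2r//.
exact: le_trans (exp_bounded_le fc (U x)) (ler_norm _).
Qed.

Lemma exp_bounded_cvg_integral d (T : measurableType d) (mu : {measure set T -> \bar R})
    (U Y : T -> R) c (h : nat -> R -> R) (f : R -> R) :
  measurable_fun setT U -> measurable_fun setT Y ->
  (forall n, measurable_fun setT (h n)) -> measurable_fun setT f ->
  (forall a, mu.-integrable setT (fun x => (expR (a * U x) * Y x)%:E)) ->
  (forall n, exp_bounded c (h n)) -> (forall x, h n x @[n --> \oo] --> f x) ->
  (\int[mu]_x (h n (U x) * Y x)%:E @[n --> \oo] --> \int[mu]_x (f (U x) * Y x)%:E)%E.
Proof.
move=> mU mY mh mf ie hc hf.
have mc (g : R -> R) : measurable_fun setT g ->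
    measurable_fun setT (fun x => (g (U x) * Y x)%:E).
  by move=> mg; apply/measurable_EFinP/measurable_funM => //; exact: measurableT_comp.
pose g x := (`|expR (c * (1 + `|U x|)) * Y x|)%:E.
have mec : measurable_fun setT (fun x : R => expR (c * (1 + `|x|))).
  apply: measurableT_comp => //; apply: measurable_funM => //.
  by apply: measurable_funD => //; exact: measurableT_comp.
have ig : mu.-integrable setT g.
  have := @exp_bounded_integrable _ _ mu U Y c _ mU mY mec ie _.
  move=> /(_ _)/integrable_norm; apply=> x.
  by rewrite ger0_norm ?expR_ge0.
have [] := @dominated_convergence _ _ _ mu setT measurableT
  (fun n x => (h n (U x) * Y x)%:E) (fun x => (f (U x) * Y x)%:E) g
  (fun n => mc _ (mh n)) (mc _ mf) _ ig _.
- apply: aeW => x _; apply: cvg_EFin; first exact: nearW.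
  by apply: cvgM; [exact: hf|exact: cvg_cst].
- apply: aeW => x n _; rewrite abse_EFin lee_fin !normrM ler_wpM2r//.
  by rewrite (le_trans (hc n (U x)))// ler_norm.
- by move=> _ _.
Qed.

Hypotheses (mU1 : measurable_fun setT U1) (mY1 : measurable_fun setT Y1)
  (mU2 : measurable_fun setT U2) (mY2 : measurable_fun setT Y2).
Hypothesis i1 : forall a, mu1.-integrable setT (fun x => (expR (a * U1 x) * Y1 x)%:E).
Hypothesis i2 : forall a, mu2.-integrable setT (fun x => (expR (a * U2 x) * Y2 x)%:E).
Hypothesis e12 : forall a, (\int[mu1]_x (expR (a * U1 x) * Y1 x)%:E =
  \int[mu2]_x (expR (a * U2 x) * Y2 x)%:E)%E.

(** The weights [Y1] and [Y2] carry the information on the other coordinates, which turns a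
    one-dimensional uniqueness result into a tool for joint laws. *)
Lemma mgf_weight_unique (B : set R) : measurable B ->
  (\int[mu1]_x (\1_B (U1 x) * Y1 x)%:E = \int[mu2]_x (\1_B (U2 x) * Y2 x)%:E)%E.
Proof.
(* Measurability and exponential growth belong to the class because they make the integrals linear
   in f and the limits dominated. *)
move=> mB; pose S (f : R -> R) := [/\ measurable_fun setT f,
  exists c, 0 <= c /\ exp_bounded c f &
  (\int[mu1]_x (f (U1 x) * Y1 x)%:E = \int[mu2]_x (f (U2 x) * Y2 x)%:E)%E].
suff : S \1_B by case.
apply: exp_class_indic mB => [a|k f g [mf [c1 [c10 fc]] fE] [mg [c2 [c20 gc]] gE]|h f c Sh hc hf].
- split => //; first by apply: measurableT_comp => //; exact: measurable_funM.
  by exists `|a|; split => //; exact: exp_bounded_expR.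
- have kc := exp_boundedM (exp_bounded_cst k) fc.
  split.
  + by apply: measurable_funD => //; exact: measurable_funM.
  + exists (`|k| + c1 + c2 + 1); split; first by rewrite !addr_ge0.
    by apply: (exp_boundedD _ _ kc gc) => //; rewrite addr_ge0.
  + have key d (T : measurableType d) (mu : {measure set T -> \bar R}) (U Y : T -> R) :
      measurable_fun setT U -> measurable_fun setT Y ->
      (forall a, mu.-integrable setT (fun x => (expR (a * U x) * Y x)%:E)) ->
      (\int[mu]_x ((k * f (U x) + g (U x)) * Y x)%:E =
       k%:E * \int[mu]_x (f (U x) * Y x)%:E + \int[mu]_x (g (U x) * Y x)%:E)%E.
      move=> mU mY ie.
      have if_ := exp_bounded_integrable mU mY mf ie fc.
      have ig := exp_bounded_integrable mU mY mg ie gc.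
      rewrite -integralZl// -integralD//; last exact: integrableZl.
      by apply: eq_integral => x _; rewrite -EFinM -EFinD mulrDl mulrA.
    by rewrite !key// fE gE.
- have mh n : measurable_fun setT (h n) by case: (Sh n).
  have mf : measurable_fun setT f.
    apply: (@measurable_fun_cvg _ _ _ setT h) => //.
  split => //.
  + exists `|c|; split => // x.
    have h1 : `|h n x| @[n --> \oo] --> `|f x| by apply: cvg_norm; exact: hf.
    rewrite -(cvg_lim _ h1)//; apply: limr_le; first by apply: cvgP h1.
    apply: nearW => n; exact: (exp_boundedW (ler_norm c) (hc n)).
  + have c1 := exp_bounded_cvg_integral mU1 mY1 mh mf i1 hc hf.
    have c2 := exp_bounded_cvg_integral mU2 mY2 mh mf i2 hc hf.
    rewrite -(cvg_lim _ c1)// -(cvg_lim _ c2)//; congr (limn _).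
    by apply/funext => n; case: (Sh n).
Qed.

End mgf_uniqueness.

(** * Densities, and laws determined by their moment generating functions *)

Section density.
Context {R : realType} {d : measure_display} {T : measurableType d}
  (mu nu : {measure set T -> \bar R}) (p : T -> R).
Hypotheses (mp : measurable_fun setT p) (p0 : forall x, 0 <= p x)
  (nuE : forall A, measurable A -> (nu A = \int[mu]_(x in A) (p x)%:E)%E).
Local Open Scope ereal_scope.
Import HBNNSimple.

Lemma ge0_integral_density (g : T -> \bar R) : measurable_fun setT g ->
  (forall x, 0 <= g x) -> \int[nu]_x g x = \int[mu]_x (g x * (p x)%:E).
Proof.
move=> mg g0; pose f_ := nnsfun_approx measurableT mg.
have fg x : (f_ n x)%:E @[n --> \oo] --> g x by apply: cvg_nnsfun_approx.
have nd x : {homo (fun n => f_ n x) : m n / (m <= n)%N >-> (m <= n)%R}.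
  by move=> m n mn; exact/lefP/nd_nnsfun_approx.
transitivity (limn (fun n => \int[nu]_x (f_ n x)%:E)).
  rewrite -monotone_convergence//.
  - by apply: eq_integral => x _; apply/esym/cvg_lim.
  - by move=> n; exact/measurable_EFinP/measurable_funP.
  - by move=> n x _; rewrite lee_fin.
  - by move=> x _ m n mn; rewrite lee_fin; exact: nd.
transitivity (limn (fun n => \int[mu]_x ((f_ n x)%:E * (p x)%:E))); last first.
  rewrite -monotone_convergence//.
  - apply: eq_integral => x _; apply/cvg_lim => //.
    by apply: cvgeZr => //; exact: fg.
  - by move=> n; apply/measurable_EFinP/measurable_funM => //; exact: measurable_funP.
  - by move=> n x _; rewrite -EFinM lee_fin mulr_ge0.
  - by move=> x _ m n mn; rewrite -!EFinM lee_fin ler_wpM2r//; exact: nd.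
congr (limn _); apply/funext => n.
have mfn r : measurable (f_ n @^-1` [set r]).
  by rewrite -[X in measurable X]setTI; exact: measurable_funP.
have e1 : \int[nu]_x (f_ n x)%:E =
    \sum_(k \in range (f_ n)) k%:E * nu (f_ n @^-1` [set k]).
  by rewrite integralT_nnsfun sintegralE.
rewrite e1.
transitivity (\int[mu]_x \sum_(k \in range (f_ n)) (k%:E * (\1_(f_ n @^-1` [set k]) x * p x)%:E)).
  rewrite ge0_integral_fsum//.
  - apply: eq_fsbigr => r; rewrite inE => -[x _ rx].
    have r0 : (0 <= r)%R by rewrite -rx.
    rewrite ge0_integralZl_EFin//; last 2 first.
    + by move=> y _; rewrite lee_fin mulr_ge0.
    + by apply/measurable_EFinP/measurable_funM.
    congr (_ * _); rewrite nuE// integral_mkcond; apply: eq_integral => y _.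
    rewrite patchE indicE; case: ifPn => _; first by rewrite mul1r.
    by rewrite mul0r.
  - move=> r; apply/measurable_EFinP; apply: measurable_funM => //.
    by apply: measurable_funM.
  - move=> r x _; rewrite -EFinM lee_fin indicE.
    case: (boolP (x \in _)) => [/set_mem/= <-|_].
      by rewrite !mulr_ge0.
    by rewrite mul0r mulr0.
apply: eq_integral => x _.
rewrite [in RHS]fimfunE -fsumEFin//.
rewrite ge0_mule_fsuml; last first.
  move=> r; rewrite lee_fin indicE; case: (boolP (x \in _)) => [/set_mem/= <-|_].
    by rewrite mulr1.
  by rewrite mulr0.
by apply: eq_fsbigr => r _; rewrite -EFinM mulrA.
Qed.

End density.

Section mgf_law.
Context {R : realType} {d1 d2 : measure_display}
  {T1 : measurableType d1} {T2 : measurableType d2}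
  (mu1 : {measure set T1 -> \bar R}) (mu2 : {measure set T2 -> \bar R})
  (U1 : T1 -> R) (U2 : T2 -> R) (r : R -> R).
Hypotheses (mU1 : measurable_fun setT U1) (mU2 : measurable_fun setT U2).
Hypothesis e1 : forall a, (\int[mu1]_x (expR (a * U1 x))%:E = (r a)%:E)%E.
Hypothesis e2 : forall a, (\int[mu2]_x (expR (a * U2 x))%:E = (r a)%:E)%E.

Lemma mgf_integrable d (T : measurableType d) (mu : {measure set T -> \bar R})
    (U : T -> R) a q : measurable_fun setT U ->
  (\int[mu]_x (expR (a * U x))%:E = q%:E)%E ->
  mu.-integrable setT (fun x => (expR (a * U x))%:E).
Proof.
move=> mU e; apply/integrableP; split.
  by apply/measurable_EFinP; apply: measurableT_comp => //; exact: measurable_funM.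
under eq_integral do rewrite abse_EFin ger0_norm ?expR_ge0//.
by rewrite e ltry.
Qed.

Lemma mgf_law_unique (B : set R) : measurable B ->
  mu1 (U1 @^-1` B) = mu2 (U2 @^-1` B).
Proof.
move=> mB.
have int d (T : measurableType d) (mu : {measure set T -> \bar R}) (U : T -> R) :
    measurable_fun setT U ->
    mu (U @^-1` B) = (\int[mu]_x (\1_B (U x) * cst 1 x)%:E)%E.
  move=> mU; transitivity (\int[mu]_x (\1_(U @^-1` B) x)%:E)%E.
    by rewrite integral_indic ?setIT// -[X in measurable X]setTI; exact: mU.
  by apply: eq_integral => x _; rewrite mulr1.
rewrite !int//; apply: mgf_weight_unique => // a.
- by under eq_fun do rewrite mulr1; exact: mgf_integrable (e1 a).
- by under eq_fun do rewrite mulr1; exact: mgf_integrable (e2 a).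
- under eq_integral do rewrite mulr1; under [RHS]eq_integral do rewrite mulr1.
  by rewrite e1 e2.
Qed.

End mgf_law.

(** * Normal laws and their moments *)

Section normal_law.
Context {R : realType}.
Implicit Types (m s a : R).

(** [Phi] bundled as a probability, so that the theorems on integration apply to it. *)
Definition Phi_prob m s2 : probability (measurableTypeR R) R :=
  if s2 == 0 then \d_(m : measurableTypeR R) : probability (measurableTypeR R) R
  else normal_prob m (Num.sqrt s2) : probability (measurableTypeR R) R.

Lemma measurable_idR : measurable_fun setT (id : measurableTypeR R -> R).
Proof. by move=> _ B mB; rewrite setTI. Qed.

Let measurable_fun_expR a :
  measurable_fun setT (fun x : measurableTypeR R => (expR (a * (x : R)))%:E).
Proof.
have : measurable_fun setT (fun x : R => (expR (a * x))%:E).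
  by apply/measurable_EFinP; apply: measurableT_comp => //; exact: measurable_funM.
by move=> h; exact: (measurableT_comp h measurable_idR).
Qed.

Lemma Phi_probE m s2 : Phi_prob m s2 = Phi m s2 :> (set R -> \bar R).
Proof. by rewrite /Phi_prob /Phi; case: ifP. Qed.

(** Completing the square: an exponential tilt moves the mean and keeps the variance. *)
Lemma mgf_normal_pdf m s a x : s != 0 ->
  expR (a * x) * normal_pdf m s x =
  expR (a * m + a ^+ 2 * s ^+ 2 / 2) * normal_pdf (m + a * s ^+ 2) s x.
Proof.
move=> s0; rewrite !normal_pdfE// mulrCA [RHS]mulrCA; congr (_ * _).
rewrite /normal_fun -!expRD; congr expR.
by rewrite -mulr_natr; field.
Qed.

Lemma Phi_prob_mgf m s2 a : 0 <= s2 ->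
  (\int[Phi_prob m s2]_x (expR (a * x))%:E = (expR (a * m + a ^+ 2 * s2 / 2))%:E)%E.
Proof.
move=> s20; have mE := measurable_fun_expR a.
rewrite /Phi_prob; case: ifPn => [/eqP ->|s2n0].
  by rewrite integral_dirac//= diracT mul1e mulr0 mul0r addr0.
have s0 : Num.sqrt s2 != 0 by rewrite sqrtr_eq0 -ltNge lt_neqAle eq_sym s2n0.
rewrite (@ge0_integral_density _ _ _ lebesgue_measure _ (normal_pdf m (Num.sqrt s2)))//.
- under eq_integral do rewrite -EFinM mgf_normal_pdf// EFinM.
  rewrite ge0_integralZl_EFin ?expR_ge0//.
  + by rewrite integral_normal_pdf mule1 sqr_sqrtr.
  + by move=> x _; rewrite lee_fin normal_pdf_ge0.
  + by apply/measurable_EFinP; exact: measurable_normal_pdf.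
- exact: measurable_normal_pdf.
- by move=> x; exact: normal_pdf_ge0.
Qed.

(** Comparing mgfs treats the unit mass and the density case at once, with no change of
    variables. *)
Lemma Phi_prob_shift m s2 (B : set R) : 0 <= s2 -> measurable B ->
  Phi_prob m s2 B = Phi_prob 0 s2 [set x | B (x + m)].
Proof.
move=> s20 mB.
apply: (@mgf_law_unique _ _ _ _ _ (Phi_prob m s2) (Phi_prob 0 s2)
  id (fun x => (x : R) + m) (fun a => expR (a * m + a ^+ 2 * s2 / 2))) => //.
- by have := measurable_funD measurable_idR (@measurable_cst _ _ (measurableTypeR R) R setT m).
- by move=> a; exact: Phi_prob_mgf.
- move=> a; under eq_integral do rewrite mulrDr expRD mulrC EFinM.
  rewrite integralZl//; last exact: mgf_integrable (Phi_prob_mgf 0 a s20).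
  by rewrite Phi_prob_mgf// -EFinM -expRD; congr (expR _)%:E; ring.
Qed.

Context {d : measure_display} {T : measurableType d} (P : probability T R).
Variable Z : T -> R.
Hypothesis mZ : measurable_fun setT Z.

Lemma law_of_mgf s2 : 0 <= s2 ->
  (forall a, \int[P]_x (expR (a * Z x))%:E = (expR (a ^+ 2 * s2 / 2))%:E)%E ->
  forall B, measurable B -> P (Z @^-1` B) = Phi_prob 0 s2 B.
Proof.
move=> s20 mgf B mB; apply: (@mgf_law_unique _ _ _ _ _ P (Phi_prob 0 s2)
  Z id (fun a => expR (a ^+ 2 * s2 / 2))) => //.
by move=> a; rewrite Phi_prob_mgf// mulr0 add0r.
Qed.

Lemma mgf_of_law m s2 a : 0 <= s2 ->
  (forall B, measurable B -> P (Z @^-1` B) = Phi_prob m s2 B) ->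
  (\int[P]_x (expR (a * Z x))%:E = (expR (a * m + a ^+ 2 * s2 / 2))%:E)%E.
Proof.
move=> s20 law; rewrite -Phi_prob_mgf//.
pose f : T -> measurableTypeR R := Z.
have mf : measurable_fun setT f by move=> _ B mB; exact: mZ.
transitivity (\int[pushforward P f]_x (expR (a * (x : R)))%:E)%E.
  by rewrite ge0_integral_pushforward// => x _; rewrite lee_fin expR_ge0.
by apply: eq_measure_integral => B mB _; exact: law.
Qed.

Section moments.
Variables m s2 : R.
Hypothesis mgf : forall a,
  (\int[P]_x (expR (a * Z x))%:E = (expR (a * m + a ^+ 2 * s2 / 2))%:E)%E.

Let int a : P.-integrable setT (fun x => (expR (a * Z x))%:E).
Proof. exact: mgf_integrable (mgf a). Qed.

Let quot n (x : R) := n.+1%:R * (expR (x / n.+1%:R) - 1).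

Let mquot n : measurable_fun setT (quot n).
Proof.
apply: measurable_funM => //; apply: measurable_funB => //.
by apply: measurableT_comp => //; exact: measurable_funM.
Qed.

(** Moments as limits of linear combinations of mgf values; this replaces differentiation under the
    integral sign. *)
Let cvg_quot (k : nat) :
  (\int[P]_x (quot n (Z x) ^+ k)%:E @[n --> \oo] --> \int[P]_x (Z x ^+ k)%:E)%E.
Proof.
have h := @exp_bounded_cvg_integral _ _ _ P Z (cst 1) (k%:R * 2)
  (fun n x => quot n x ^+ k) (fun x => x ^+ k) mZ _ _ _ _ _ _.
have e (f : T -> R) : (\int[P]_x (f x)%:E = \int[P]_x (f x * cst 1 x)%:E)%E.
  by apply: eq_integral => x _; rewrite mulr1.
rewrite (e (fun x => Z x ^+ k)) (_ : (fun n => _) =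
  fun n => (\int[P]_x (quot n (Z x) ^+ k * cst 1 x)%:E)%E); last first.
  by apply/funext => n; rewrite -e.
apply: h => //.
- by move=> n; exact: measurable_funX.
- by move=> a; under eq_fun do rewrite mulr1.
- by move=> n; apply: exp_boundedX; exact: exp_bounded_quotient.
- move=> x; apply: (@continuous_cvg _ _ _ _ _ _ (fun y : R => y ^+ k)).
    exact: exprn_continuous.
  exact: cvg_expR_sub1.
Qed.

Let int1 : P.-integrable setT (cst 1%:E : T -> \bar R).
Proof. exact: finite_measure_integrable_cst. Qed.

Let integral1 : (\int[P]_x 1%:E = 1%:E)%E.
Proof.
rewrite -[LHS]/(\int[P]_x cst 1%:E x)%E integral_cst// -[RHS]mul1e.
by congr (_ * _)%E; exact: probability_setT.
Qed.

Lemma mean_of_mgf : (\int[P]_x (Z x)%:E = m%:E)%E.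
Proof.
transitivity (\int[P]_x (Z x ^+ 1)%:E)%E; first by apply: eq_integral.
rewrite -(cvg_lim _ (@cvg_quot 1%N))//; apply/cvg_lim => //.
rewrite (_ : (fun n => _) = EFin \o (fun n => (n.+1%:R^-1)^-1 *
   (expR ((m + n.+1%:R^-1 * (s2 / 2)) * n.+1%:R^-1) - 1))); last first.
  apply/funext => n /=; rewrite invrK; set N : R := n.+1%:R.
  under eq_integral do rewrite expr1 /quot -/N EFinM mulrC.
  rewrite integralZl//; last exact: (integrableB measurableT (int N^-1) int1).
  rewrite (integralB_EFin measurableT (int N^-1) int1)/=.
  by rewrite integral1 mgf -EFinB -EFinM; congr (_ * (expR _ - _))%:E; ring.
apply: cvg_EFin; first exact: nearW.
apply: cvg_expR_sub1_seq => //; first exact: cvg_harmonic.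
rewrite -[X in _ --> X]addr0 -[X in _ --> _ + X](mul0r (s2 / 2)).
apply: cvgD; first exact: cvg_cst.
by apply: cvgM; [exact: cvg_harmonic|exact: cvg_cst].
Qed.

Lemma second_moment_of_mgf : m = 0 -> (\int[P]_x (Z x ^+ 2)%:E = s2%:E)%E.
Proof.
move=> m0; rewrite -(cvg_lim _ (@cvg_quot 2%N))//; apply/cvg_lim => //.
(* With N = n + 1 and delta = N^-2, the mgf of the centered law is e^(s2 delta/2) at 1/N and e^(2 s2
   delta) at 2/N. The second difference is a combination of difference quotients of slopes 2 s2 and
   s2/2, with limit 2 s2 - 2 (s2/2) = s2. *)
pose delta n : R := n.+1%:R^-1 * n.+1%:R^-1.
have d0 n : 0 < delta n by rewrite mulr_gt0// invr_gt0.
have cd : delta n @[n --> \oo] --> 0.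
  rewrite -[X in _ --> X](mul0r 0).
  by apply: cvgM; exact: cvg_harmonic.
rewrite (_ : (fun n => _) = EFin \o (fun n =>
   (delta n)^-1 * (expR ((2 * s2) * delta n) - 1) -
   2 * ((delta n)^-1 * (expR ((s2 / 2) * delta n) - 1)))); last first.
  apply/funext => n /=; rewrite /delta invfM invrK; set N : R := n.+1%:R.
  have e x : quot n x ^+ 2 = (N * N) * (expR (2 / N * x) - 2 * expR (N^-1 * x) + 1).
    rewrite /quot -/N [N^-1 * x]mulrC (_ : 2 / N * x = x / N + x / N); last by ring.
    by rewrite expRD; ring.
  under eq_integral do rewrite e EFinM.
  have i2 : P.-integrable setT (EFin \o (fun x => 2 * expR (N^-1 * Z x))).
    exact: (integrableZl measurableT 2 (int N^-1)).
  have i3 : P.-integrable setT (EFin \o (fun x => expR (2 / N * Z x) - 2 * expR (N^-1 * Z x))).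
    exact: (integrableB measurableT (int (2 / N)) i2).
  rewrite integralZl//; last exact: (integrableD measurableT i3 int1).
  rewrite (integralD_EFin measurableT i3 int1)/=.
  rewrite integral1 (integralB_EFin measurableT (int (2 / N)) i2)/=.
  under [X in (_ - X)%E]eq_integral do rewrite EFinM.
  rewrite integralZl// !mgf m0; congr EFin.
  have -> : 2 / N * 0 + (2 / N) ^+ 2 * s2 / 2 = 2 * s2 * (N^-1 / N) by field.
  have -> : N^-1 * 0 + N^-1 ^+ 2 * s2 / 2 = s2 / 2 * (N^-1 / N) by ring.
  by ring.
apply: cvg_EFin; first exact: nearW.
rewrite [X in _ --> X](_ : s2 = 2 * s2 - 2 * (s2 / 2)); last by field.
by apply: cvgB; [|apply: cvgM; [exact: cvg_cst|]]; apply: cvg_expR_sub1_seq => //; exact: cvg_cst.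
Qed.

End moments.

(** [gaussian_process] only asserts that some parameters exist; here they are identified from the
    moments. *)
Lemma centered_law_mgf m s2 : 0 <= s2 ->
  (forall B, measurable B -> P (Z @^-1` B) = Phi_prob m s2 B) ->
  (\int[P]_x (Z x)%:E = 0)%E -> forall a,
  (\int[P]_x (expR (a * Z x))%:E =
   (expR (a ^+ 2 * fine (\int[P]_x (Z x ^+ 2)%:E) / 2))%:E)%E.
Proof.
move=> s20 law Z0 a.
have mgf b := mgf_of_law b s20 law.
have m0 : m = 0 by have := mean_of_mgf mgf; rewrite Z0 => -[].
by rewrite mgf (second_moment_of_mgf mgf m0) m0 mulr0 add0r.
Qed.

End normal_law.

(** * Independence and conditional expectation *)

Lemma choose_orP (A : Type) (x0 : A) (Q : A -> Prop) :
  (exists x, Q x) -> Q (choose_or x0 Q).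
Proof. by move=> h; rewrite /choose_or; case: pselect => // h'; exact: svalP. Qed.

Lemma prob_integral_cst (R : realType) (d : measure_display) (Omega : measurableType d)
    (P : probability Omega R) (r : R) : (\int[P]_x r%:E = r%:E)%E.
Proof.
rewrite -[LHS]/(\int[P]_x cst r%:E x)%E integral_cst// -[RHS]mule1.
by congr (_ * _)%E; exact: probability_setT.
Qed.

Section cylinders.
Context {Omega I E : Type}.
Implicit Types (Y : I -> Omega -> E) (l : seq (I * set E)).

(** With lists, an index may recur and the intersection of two cylinders is given by concatenation,
    so that the cylinders form a pi-system. *)
Definition cyl Y l : set Omega :=
  foldr (fun p A => Y p.1 @^-1` p.2 `&` A) setT l.

Lemma cyl_nil Y : cyl Y [::] = setT.
Proof. by []. Qed.

Lemma cyl_cons Y p l : cyl Y (p :: l) = Y p.1 @^-1` p.2 `&` cyl Y l.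
Proof. by []. Qed.

Lemma cyl_cat Y l1 l2 : cyl Y (l1 ++ l2) = cyl Y l1 `&` cyl Y l2.
Proof. by elim: l1 => [|p l1 ih] /=; rewrite ?setTI// ih setIA. Qed.

Definition cyl_on (D : set I) (ms : set (set E)) l : Prop :=
  foldr (fun p Q => [/\ D p.1, ms p.2 & Q]) True l.

Lemma cyl_on_cat D ms l1 l2 : cyl_on D ms l1 -> cyl_on D ms l2 -> cyl_on D ms (l1 ++ l2).
Proof. by elim: l1 => //= p l1 ih [? ? ?] l2P; split => //; exact: ih. Qed.

End cylinders.

Section pi_system.
Context {R : realType} {d : measure_display} {Omega : measurableType d}
  (P : probability Omega R).
Implicit Types (A E : set Omega) (G H : set (set Omega)).

(** In the variable A, both sides are finite measures, [P] restricted to [E] and [P] scaled by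
    [P E]; agreement on the pi-system extends to the sigma-algebra it generates. *)
Lemma indep_pi_system G E : G `<=` measurable -> setI_closed G -> G setT ->
  measurable E -> (forall A, G A -> P (E `&` A) = (P E * P A)%E) ->
  forall A, <<s G >> A -> P (E `&` A) = (P E * P A)%E.
Proof.
move=> Gm GI GT mE h A GA.
have PE : P E \is a fin_num by exact: fin_num_measure.
have pE0 : 0 <= fine (P E) by rewrite fine_ge0.
have m2E B : mscale (NngNum pE0) P B = (P E * P B)%E.
  by rewrite -[in RHS](fineK PE).
rewrite setIC -m2E; apply: (@g_sigma_algebra_measure_unique _ _ _ G Gm (fun=> setT)
  (fun=> GT) _ (mrestr P mE) (mscale (NngNum pE0) P) GI _ _ A GA).
- by rewrite bigcup_const//; exists 0%N.
- by move=> B GB; rewrite [RHS]m2E -h// setIC.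
- by move=> _; rewrite /= /mrestr /= setTI ltey_eq PE.
Qed.

Definition setI_gen G H : set (set Omega) :=
  [set C | exists A B, [/\ G A, H B & C = A `&` B]].

(** The intersections of a member of [G] and a member of [H] form a pi-system that generates the
    join. *)
Lemma indep_join G H E : G `<=` measurable -> H `<=` measurable ->
  setI_closed G -> setI_closed H -> G setT -> H setT -> measurable E ->
  (forall A B, G A -> H B -> P (E `&` (A `&` B)) = (P E * P (A `&` B))%E) ->
  forall C, <<s G `|` H >> C -> P (E `&` C) = (P E * P C)%E.
Proof.
move=> Gm Hm GI HI GT HT mE h C GHC.
apply: (@indep_pi_system (setI_gen G H)) => //.
- by move=> _ [A [B [GA HB ->]]]; apply: measurableI; [exact: Gm|exact: Hm].
- move=> _ _ [A [B [GA HB ->]]] [A' [B' [GA' HB' ->]]].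
  exists (A `&` A'), (B `&` B'); split; [exact: GI|exact: HI|].
  by rewrite setIACA.
- by exists setT, setT; rewrite setTI.
- by move=> _ [A [B [GA HB ->]]]; exact: h.
- move: C GHC; apply: smallest_sub => [|C [GC|HC]].
  + exact: smallest_sigma_algebra.
  + by apply: sub_sigma_algebra; exists C, setT; rewrite setIT.
  + by apply: sub_sigma_algebra; exists setT, C; rewrite setTI.
Qed.

Lemma salgebra_setI G : sigma_algebra setT G -> setI_closed G.
Proof.
move=> [G0 GC GU] A B GA GB.
have GC' X : G X -> G (~` X) by move=> /GC; rewrite setTD.
rewrite -[A `&` B]setCK setCI; apply: (GC'); rewrite -bigcup2E.
by apply: GU => -[|[|n]] /=; [exact: GC'|exact: GC'|exact: G0].
Qed.

Lemma salgebra_setT G : sigma_algebra setT G -> G setT.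
Proof. by move=> [G0 GC _]; rewrite -[setT]setD0; exact: GC. Qed.

Context {I : Type} {d' : measure_display} {E' : measurableType d'}.
Implicit Types (D : set I) (Y : I -> Omega -> E').

Lemma sigma_gen_salgebra D Y : sigma_algebra setT (sigma_gen D Y).
Proof. exact: smallest_sigma_algebra. Qed.

Lemma sigma_gen_measurable D Y : (forall i, D i -> measurable_fun setT (Y i)) ->
  sigma_gen D Y `<=` measurable.
Proof.
move=> mY; apply: smallest_sub; first exact: sigma_algebra_measurable.
by move=> _ [i Di [B mB <-]]; exact: mY.
Qed.

Lemma sigma_gen_preimage D Y i B : D i -> measurable B ->
  sigma_gen D Y (Y i @^-1` B).
Proof.
move=> Di mB; apply: sub_gen_smallest; exists i => //.
by exists B => //; rewrite setTI.
Qed.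

Lemma sigma_genS D1 D2 Y : D1 `<=` D2 -> sigma_gen D1 Y `<=` sigma_gen D2 Y.
Proof.
move=> D12; apply: smallest_sub => [|A [i Di iA]]; first exact: smallest_sigma_algebra.
by apply: sub_sigma_algebra; exists i => //; exact: D12.
Qed.

Lemma cyl_sigma_gen D Y l : cyl_on D measurable l -> sigma_gen D Y (cyl Y l).
Proof.
have sa := @sigma_gen_salgebra D Y.
elim: l => [_|p l ih /= [Dp mp lP]]; first exact: (salgebra_setT sa).
by apply: (salgebra_setI sa); [exact: sigma_gen_preimage|exact: ih].
Qed.

Lemma indep_sigma_gen D Y E : (forall i, D i -> measurable_fun setT (Y i)) ->
  measurable E ->
  (forall l, cyl_on D measurable l -> P (E `&` cyl Y l) = (P E * P (cyl Y l))%E) ->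
  forall A, sigma_gen D Y A -> P (E `&` A) = (P E * P A)%E.
Proof.
move=> mY mE h A GA.
pose G := [set A | exists l, cyl_on D measurable l /\ A = cyl Y l].
apply: (@indep_pi_system G) => //.
- by move=> _ [l [lP ->]]; apply: (sigma_gen_measurable mY); exact: cyl_sigma_gen.
- move=> _ _ [l1 [l1P ->]] [l2 [l2P ->]].
  by exists (l1 ++ l2); rewrite cyl_cat; split => //; exact: cyl_on_cat.
- by exists [::].
- by move=> _ [l [lP ->]]; exact: h.
- move: A GA; apply: smallest_sub => [|_ [i Di [B mB <-]]].
    exact: smallest_sigma_algebra.
  by apply: sub_sigma_algebra; exists [:: (i, B)] => /=; rewrite setTI setIT.
Qed.

End pi_system.

Section sub_salgebra.
Context {R : realType} {d : measure_display} {Omega : measurableType d}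
  (P : probability Omega R) (Gs : set (set Omega)).
Hypothesis Gm : <<s Gs >> `<=` measurable.
Let F := <<s Gs >>.
Let OF := g_sigma_algebraType Gs.
Local Open Scope ereal_scope.

(** The identity as a measurable map onto [Omega] with the smaller sigma-algebra. Its law is the
    restriction of [P], which turns independence into a statement on product measures. *)
Let idF : Omega -> OF := id.

Let midF : measurable_fun setT idF.
Proof. by move=> _ B mB; rewrite setTI; exact: Gm. Qed.

HB.instance Definition _ := isMeasurableFun.Build _ _ _ _ idF midF.

Lemma sub_measurable_fun d' (T : measurableType d') (f : OF -> T) :
  measurable_fun setT f -> measurable_fun setT (f : Omega -> T).
Proof.
by move=> mf _ B mB; rewrite setTI; apply: Gm; have := mf measurableT B mB; rewrite setTI.
Qed.

Section indep.
Variables (D : Omega -> R) (rho : probability R R).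
Hypothesis mD : measurable_fun setT D.
Hypothesis ind : forall A B, F A -> measurable B -> P (A `&` D @^-1` B) = P A * rho B.

(** Independence says that the pair of [idF] and [D] has a product law; Tonelli then integrates [D]
    out first. *)
Lemma indep_integral (h : (OF * R)%type -> \bar R) : measurable_fun setT h ->
  (forall z, 0 <= h z) ->
  \int[P]_w h (w, D w) = \int[P]_w \int[rho]_y h (w, y).
Proof.
move=> mh h0.
have mid : measurable_fun setT (fun w : Omega => (idF w, D w)).
  exact: measurable_fun_pair.
pose X : {mfun Omega >-> (OF * R)%type} := HB.pack (fun w : Omega => (idF w, D w))
  (isMeasurableFun.Build _ _ _ _ _ mid).
transitivity (\int[distribution P X]_z h z).
  by rewrite ge0_integral_distribution.
transitivity (\int[distribution P idF \x rho]_z h z).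
  apply: eq_measure_integral => B mB _.
  apply/esym/product_measure_unique; last exact: mB.
  by move=> A1 A2 mA1 mA2; exact: (ind mA1 mA2).
rewrite fubini_tonelli1// ge0_integral_distribution//.
- exact: measurable_fun_fubini_tonelli_F.
- by move=> w; exact: integral_ge0.
Qed.

(** Freezing the known part: Tonelli applied to the indicator of A in w times that of B in c w +
    y. *)
Lemma indep_sum_prob (c : OF -> R) A B : measurable_fun setT c -> F A -> measurable B ->
  P (A `&` [set w | B (c w + D w)%R]) = \int[P]_(w in A) rho [set y | B (c w + y)%R].
Proof.
move=> mc FA mB.
have mA : measurable A by exact: Gm.
have ms : measurable_fun setT (fun z : (OF * R)%type => c z.1 + z.2)%R.
  by apply: measurable_funD => //; apply: measurableT_comp.
have mS : measurable [set z : (OF * R)%type | B (c z.1 + z.2)%R].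
  by rewrite -[X in measurable X]setTI; exact: ms.
have mAF : measurable (A : set OF) by [].
set S := [set z | _] in mS.
pose g (z : (OF * R)%type) : R := (\1_(A : set OF) z.1 * \1_S z)%R.
have mg : measurable_fun setT g.
  apply: measurable_funM => //.
  exact: (measurableT_comp (measurable_indic mAF) measurable_fst).
have mh : measurable_fun setT (EFin \o g) by exact/measurable_EFinP.
have := indep_integral mh.
have -> : \int[P]_w (EFin \o g) (w, D w) =
    P (A `&` [set w | B (c w + D w)%R]).
  have mAD : measurable (A `&` [set w | B (c w + D w)%R]).
    apply: measurableI => //.
    have : measurable_fun setT (fun w : Omega => c w + D w)%R.
      by apply: measurable_funD => //; exact: sub_measurable_fun.
    by move=> /(_ measurableT _ mB); rewrite setTI.
  rewrite -[in RHS](setIT (_ `&` _)) -integral_indic//; apply: eq_integral => w _.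
  by rewrite indicI/= /g !indicE.
move=> ->; last by move=> z; rewrite lee_fin mulr_ge0.
rewrite [RHS]integral_mkcond; apply: eq_integral => w _; rewrite patchE.
rewrite /g /= indicE; case: ifPn => wA; last first.
  by under eq_integral do rewrite mul0r; rewrite integral0.
under eq_integral do rewrite mul1r.
have mBw : measurable [set y | B (c w + y)%R].
  have : measurable_fun setT (fun y : R => c w + y)%R by exact: measurable_funD.
  by move=> /(_ measurableT _ mB); rewrite setTI.
rewrite -[in RHS](setIT [set y | B (c w + y)%R]) -integral_indic//.
Qed.

Lemma indep_ge0_integral_event (f : R -> \bar R) A : F A -> measurable_fun setT f ->
  (forall y, 0 <= f y) -> \int[P]_(w in A) f (D w) = P A * \int[rho]_y f y.
Proof.
move=> FA mf f0; have mA : measurable A by exact: Gm.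
have mAF : measurable (A : set OF) by [].
pose g (z : (OF * R)%type) : \bar R := (\1_(A : set OF) z.1)%:E * f z.2.
have mg : measurable_fun setT g.
  apply: emeasurable_funM; last exact: measurableT_comp.
  apply/measurable_EFinP.
  exact: (measurableT_comp (measurable_indic mAF) measurable_fst).
have g0 z : 0 <= g z by rewrite mule_ge0// lee_fin.
transitivity (\int[P]_w g (w, D w)).
  rewrite integral_mkcond; apply: eq_integral => w _.
  by rewrite patchE /g/= indicE; case: ifPn => _; rewrite ?mul1e ?mul0e.
rewrite indep_integral//.
transitivity (\int[P]_w ((\1_A w)%:E * \int[rho]_y f y)).
  apply: eq_integral => w _; rewrite /g/= ge0_integralZl_EFin//.
rewrite ge0_integralZr//.
- by rewrite integral_indic// setIT.
- exact/measurable_EFinP.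
- exact: integral_ge0.
Qed.

Lemma indep_integral_event (f : R -> R) A : F A -> measurable_fun setT f ->
  P.-integrable setT (EFin \o (f \o D)) ->
  \int[P]_(w in A) (f (D w))%:E = P A * \int[P]_w (f (D w))%:E.
Proof.
move=> FA mf intf; have mA : measurable A by exact: Gm.
have FT : F setT by exact: (@measurableT _ OF).
pose fE := EFin \o f.
have mfE : measurable_fun setT fE by exact/measurable_EFinP.
have key g : measurable_fun setT g -> (forall y, 0 <= g y) ->
    \int[P]_(w in A) g (D w) = P A * \int[P]_w g (D w).
  move=> mg g0; rewrite !indep_ge0_integral_event// probability_setT mul1e//.
have PA : P A \is a fin_num by exact: fin_num_measure.
have pe w : (fE \o D)^\+ w = fE^\+ (D w) by rewrite funepos_comp.
have ne w : (fE \o D)^\- w = fE^\- (D w) by rewrite funeneg_comp.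
have intf' : P.-integrable setT (fE \o D) by [].
have e1 B : \int[P]_(w in B) (fE \o D)^\+ w = \int[P]_(w in B) fE^\+ (D w).
  by apply: eq_integral => w _; rewrite pe.
have e2 B : \int[P]_(w in B) (fE \o D)^\- w = \int[P]_(w in B) fE^\- (D w).
  by apply: eq_integral => w _; rewrite ne.
have I B : \int[P]_(w in B) (f (D w))%:E =
    \int[P]_(w in B) fE^\+ (D w) - \int[P]_(w in B) fE^\- (D w).
  by rewrite -e1 -e2 -[LHS]/(integral P B (fE \o D)) integralE.
rewrite !I (key fE^\+) ?(key fE^\-)//; [|exact: measurable_funeneg|exact: measurable_funepos].
rewrite [RHS]muleBr//; apply: fin_num_adde_defl; rewrite fin_numN -e2.
exact: integrable_neg_fin_num.
Qed.

End indep.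

Lemma is_cond_exp_unique (Y Z1 Z2 : Omega -> R) :
  is_cond_exp P F Y Z1 -> is_cond_exp P F Y Z2 -> {ae P, forall w, Z1 w = Z2 w}.
Proof.
move=> [F1 i1 e1] [F2 i2 e2].
suff key (U V : Omega -> R) : (forall B, measurable B -> F (U @^-1` B)) ->
    (forall B, measurable B -> F (V @^-1` B)) ->
    P.-integrable setT (EFin \o U) -> P.-integrable setT (EFin \o V) ->
    (forall A, F A -> \int[P]_(w in A) (U w)%:E = \int[P]_(w in A) (V w)%:E) ->
    {ae P, forall w, (U w <= V w)%R}.
  have h1 := key _ _ F1 F2 i1 i2 (fun A FA => etrans (e1 A FA) (esym (e2 A FA))).
  have h2 := key _ _ F2 F1 i2 i1 (fun A FA => etrans (e2 A FA) (esym (e1 A FA))).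
  by apply: filterS2 h1 h2 => w uv vu; apply/eqP; rewrite eq_le uv vu.
move=> FU FV iU iV e.
have mU : measurable_fun setT (U : OF -> R) by move=> _ B mB; rewrite setTI; exact: FU.
have mV : measurable_fun setT (V : OF -> R) by move=> _ B mB; rewrite setTI; exact: FV.
(* This event belongs to [F], so the equal integrals over it force U - V, which is positive there,
   to vanish almost surely on it. *)
pose A := [set w | (V w < U w)%R].
have FA : F A.
  have := measurable_fun_ltr mV mU measurableT (_ : measurable [set true]).
  move=> /(_ _); rewrite setTI; exact.
have mA : measurable A by exact: Gm.
have iUA : P.-integrable A (EFin \o U) by exact: integrableS iU.
have iVA : P.-integrable A (EFin \o V) by exact: integrableS iV.
have UV0 : \int[P]_(w in A) `|(U w)%:E - (V w)%:E| = 0.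
  transitivity (\int[P]_(w in A) ((U w)%:E - (V w)%:E)).
    apply: eq_integral => w /set_mem Aw; rewrite gee0_abs// -EFinB lee_fin subr_ge0.
    exact: ltW.
  rewrite integralB_EFin// e// subee//.
  exact: integrable_fin_num.
have mUV : measurable_fun A (fun w => (U w)%:E - (V w)%:E).
  apply/measurable_EFinP/measurable_funTS/measurable_funB; exact: sub_measurable_fun.
have /(_ UV0) := (ae_eq_integral_abs P mA mUV).1.
apply: filterS => w h; rewrite leNgt; apply/negP => Aw.
by have /eqP := h Aw; rewrite -EFinB eqe subr_eq0 => /eqP UVw; move: Aw; rewrite UVw ltxx.
Qed.

Lemma cond_exp_ae (Y Z : Omega -> R) :
  is_cond_exp P F Y Z -> {ae P, forall w, cond_exp P F Y w = Z w}.
Proof.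
move=> YZ; apply: is_cond_exp_unique (YZ).
exact: (@choose_orP _ (fun=> 0%R) (is_cond_exp P F Y) (ex_intro _ Z YZ)).
Qed.

End sub_salgebra.

(** * Square-integrable functions *)

Section L2.
Context {R : realType} {d : measure_display} {T : measurableType d}.
Implicit Types (mu : {measure set T -> \bar R}) (f g h : T -> R).

(** Functions rather than classes modulo null sets: measurability for an uncompleted
    sub-sigma-algebra is a property of a version. *)
Definition L2 mu f : Prop :=
  measurable_fun setT f /\ mu.-integrable setT (fun x => (f x ^+ 2)%:E).

Definition ip mu f g : R := \int[mu]_x (f x * g x).

Variable mu : {measure set T -> \bar R}.

Lemma L2_mul f g : L2 mu f -> L2 mu g -> mu.-integrable setT (fun x => (f x * g x)%:E).
Proof.
move=> [mf if_] [mg ig]; apply: le_integrable (integrableD measurableT if_ ig) => //.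
  by apply/measurable_EFinP; exact: measurable_funM.
move=> x _; rewrite -EFinD !abse_EFin lee_fin [leRHS]ger0_norm ?addr_ge0 ?sqr_ge0//.
have := sqr_ge0 (`|f x| - `|g x|); rewrite normrM -(real_normK (num_real (f x))).
rewrite -(real_normK (num_real (g x))) !expr2.
have := normr_ge0 (f x); have := normr_ge0 (g x); nra.
Qed.

Lemma L2Z k f : L2 mu f -> L2 mu (fun x => k * f x).
Proof.
move=> [mf if_]; split; first exact: measurable_funM.
under eq_fun do rewrite exprMn EFinM; exact: integrableZl.
Qed.

Lemma L2D f g : L2 mu f -> L2 mu g -> L2 mu (fun x => f x + g x).
Proof.
move=> Lf Lg; have fg := L2_mul Lf Lg; case: Lf Lg => [mf if_] [mg ig].
split; first exact: measurable_funD.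
have h := integrableD measurableT if_ (integrableD measurableT ig
  (integrableZl measurableT 2 fg)).
apply: eq_integrable h => // x _; congr EFin; rewrite /=.
by ring.
Qed.

Lemma L2B f g : L2 mu f -> L2 mu g -> L2 mu (fun x => f x - g x).
Proof.
move=> Lf Lg; have := L2D Lf (L2Z (-1) Lg).
by under eq_fun do rewrite mulN1r.
Qed.

Lemma L2_0 : L2 mu (fun=> 0).
Proof.
split => //; under eq_fun do rewrite expr0n/=; exact: integrable0.
Qed.

Lemma L2_ae f g : L2 mu f -> measurable_fun setT g -> {ae mu, forall x, f x = g x} -> L2 mu g.
Proof.
move=> [mf if_] mg fg; split => //.
have m2 : measurable_fun setT (fun x => (g x ^+ 2)%:E).
  by apply/measurable_EFinP; exact: measurable_funX.
have m1 : measurable_fun setT (fun x => (f x ^+ 2)%:E).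
  by apply/measurable_EFinP; exact: measurable_funX.
apply/integrableP; split => //; case/integrableP: if_ => _; apply: le_lt_trans.
rewrite le_eqVlt; apply/orP; left; apply/eqP.
apply: ge0_ae_eq_integral => //; try by apply: measurableT_comp.
by apply: filterS fg => x -> _.
Qed.

Lemma ipE f g : L2 mu f -> L2 mu g -> (ip mu f g)%:E = (\int[mu]_x (f x * g x)%:E)%E.
Proof.
by move=> Lf Lg; rewrite fineK//; apply: integrable_fin_num (L2_mul Lf Lg).
Qed.

Lemma ipC f g : ip mu f g = ip mu g f.
Proof. by apply: eq_Rintegral => x _; rewrite mulrC. Qed.

Lemma eq_ip f f' g g' : f =1 f' -> g =1 g' -> ip mu f g = ip mu f' g'.
Proof. by move=> ff' gg'; apply: eq_Rintegral => x _; rewrite ff' gg'. Qed.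

Lemma ipDl f g h : L2 mu f -> L2 mu g -> L2 mu h ->
  ip mu (fun x => f x + g x) h = ip mu f h + ip mu g h.
Proof.
move=> Lf Lg Lh; rewrite -RintegralD//; [|exact: L2_mul|exact: L2_mul].
by apply: eq_Rintegral => x _; rewrite mulrDl.
Qed.

Lemma ipZl k f h : L2 mu f -> L2 mu h -> ip mu (fun x => k * f x) h = k * ip mu f h.
Proof.
move=> Lf Lh; rewrite -RintegralZl//; last exact: L2_mul.
by apply: eq_Rintegral => x _; rewrite mulrA.
Qed.

Lemma ipBl f g h : L2 mu f -> L2 mu g -> L2 mu h ->
  ip mu (fun x => f x - g x) h = ip mu f h - ip mu g h.
Proof.
move=> Lf Lg Lh; rewrite -RintegralB//; [|exact: L2_mul|exact: L2_mul].
by apply: eq_Rintegral => x _; rewrite mulrBl.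
Qed.

Lemma ipDr f g h : L2 mu f -> L2 mu g -> L2 mu h ->
  ip mu h (fun x => f x + g x) = ip mu h f + ip mu h g.
Proof. by move=> Lf Lg Lh; rewrite ipC ipDl// !(ipC h). Qed.

Lemma ipZr k f h : L2 mu f -> L2 mu h -> ip mu h (fun x => k * f x) = k * ip mu h f.
Proof. by move=> Lf Lh; rewrite ipC ipZl// (ipC h). Qed.

Lemma ipBr f g h : L2 mu f -> L2 mu g -> L2 mu h ->
  ip mu h (fun x => f x - g x) = ip mu h f - ip mu h g.
Proof. by move=> Lf Lg Lh; rewrite ipC ipBl// !(ipC h). Qed.

Lemma ip0l h : ip mu (fun=> 0) h = 0.
Proof. by rewrite /ip; under eq_Rintegral do rewrite mul0r; rewrite /Rintegral integral0. Qed.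

Lemma ip_ge0 f : 0 <= ip mu f f.
Proof. by apply: Rintegral_ge0 => x _; rewrite -expr2 sqr_ge0. Qed.

Lemma ip_eq0 f : L2 mu f -> ip mu f f = 0 -> {ae mu, forall x, f x = 0}.
Proof.
move=> Lf f0; have e : (\int[mu]_x `|(f x * f x)%:E| = 0)%E.
  under eq_integral do rewrite gee0_abs ?lee_fin -?expr2 ?sqr_ge0//.
  under eq_integral do rewrite expr2.
  by rewrite -ipE// f0.
have mff : measurable_fun setT (fun x => (f x * f x)%:E).
  by apply/measurable_EFinP/measurable_funM; case: Lf.
have := (ae_eq_integral_abs mu measurableT mff).1 e.
by apply: filterS => x /(_ I) [] /eqP; rewrite mulf_eq0 orbb => /eqP.
Qed.

Lemma cauchy_schwarz f g : L2 mu f -> L2 mu g ->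
  ip mu f g ^+ 2 <= ip mu f f * ip mu g g.
Proof.
move=> Lf Lg.
have q t : 0 <= ip mu f f - 2 * t * ip mu f g + t ^+ 2 * ip mu g g.
  have Ltg := L2Z t Lg; have Ld := L2B Lf Ltg.
  have := ip_ge0 (fun x => f x - t * g x).
  by rewrite ipBl// !ipBr// !ipZl// !ipZr// (ipC g f); lra.
have f0 := ip_ge0 f; have g0 := ip_ge0 g.
set a := ip mu f f in q f0 *; set b := ip mu f g in q *; set c := ip mu g g in q g0 *.
have [c0|c0] := eqVneq c 0.
  have [->|b0] := eqVneq b 0; first by rewrite expr0n mulr_ge0.
  (* For c = 0 the quadratic is affine in t, and this t gives it the value -1. *)
  have := q ((a + 1) / (2 * b)); rewrite c0 mulr0 addr0.
  have -> : 2 * ((a + 1) / (2 * b)) * b = a + 1 by field.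
  by lra.
have cp : 0 < c by rewrite lt_neqAle eq_sym c0.
have := q (b / c).
have -> : a - 2 * (b / c) * b + (b / c) ^+ 2 * c = (a * c - b ^+ 2) / c by field.
by rewrite ler_pdivlMr// mul0r subr_ge0.
Qed.

Definition cvgL2 (f_ : nat -> T -> R) f : Prop :=
  ip mu (fun x => f_ n x - f x) (fun x => f_ n x - f x) @[n --> \oo] --> 0.

Lemma cvgL2P (f_ : nat -> T -> R) f : (forall n, L2 mu (f_ n)) -> L2 mu f ->
  (\int[mu]_x ((f_ n x - f x) ^+ 2)%:E @[n --> \oo] --> 0)%E <-> cvgL2 f_ f.
Proof.
move=> Lf_ Lf.
rewrite /cvgL2 (_ : (fun n => _) = EFin \o (fun n =>
  ip mu (fun x => f_ n x - f x) (fun x => f_ n x - f x))); last first.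
  by apply/funext => n /=; rewrite ipE//; exact: L2B.
by split => [/fine_cvgP[]//|h]; apply: cvg_EFin => //; exact: nearW.
Qed.

Lemma cvgL2_ip (f_ : nat -> T -> R) f h : (forall n, L2 mu (f_ n)) -> L2 mu f -> L2 mu h ->
  cvgL2 f_ f -> ip mu (f_ n) h @[n --> \oo] --> ip mu f h.
Proof.
move=> Lf_ Lf Lh c; apply/subr_cvg0.
have c2 : (ip mu (f_ n) h - ip mu f h) ^+ 2 @[n --> \oo] --> 0.
  apply: (@squeeze_cvgr _ _ _ _ (cst 0) (fun n =>
    ip mu (fun x => f_ n x - f x) (fun x => f_ n x - f x) * ip mu h h)).
  - apply: nearW => n; rewrite sqr_ge0/= -ipBl//.
    by apply: cauchy_schwarz => //; exact: L2B.
  - exact: cvg_cst.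
  - by rewrite -(mul0r (ip mu h h)); apply: cvgM => //; exact: cvg_cst.
apply/norm_cvg0P; rewrite -[X in _ --> X]sqrtr0.
rewrite (_ : (fun n => _) = (fun n => Num.sqrt ((ip mu (f_ n) h - ip mu f h) ^+ 2))); last first.
  by apply/funext => n /=; rewrite sqrtr_sqr.
apply: (@continuous_cvg _ _ _ _ _ _ (@Num.sqrt R)) c2; exact: sqrt_continuous.
Qed.

(** From the parallelogram identity, by dropping the square of the sum. In this squared form it does
    the work of the triangle inequality without square roots. *)
Lemma ip_sub_le f g : L2 mu f -> L2 mu g ->
  ip mu (fun x => f x - g x) (fun x => f x - g x) <= 2 * ip mu f f + 2 * ip mu g g.
Proof.
move=> Lf Lg; have Ld := L2B Lf Lg; have Ls := L2D Lf Lg.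
have := ip_ge0 (fun x => f x + g x).
by rewrite ipBl// !ipBr// ipDl// !ipDr// (ipC g f); lra.
Qed.

Lemma cvgL2B (f_ : nat -> T -> R) f (g_ : nat -> T -> R) g : (forall n, L2 mu (f_ n)) -> L2 mu f ->
  (forall n, L2 mu (g_ n)) -> L2 mu g -> cvgL2 f_ f -> cvgL2 g_ g ->
  cvgL2 (fun n x => f_ n x - g_ n x) (fun x => f x - g x).
Proof.
move=> Lf_ Lf Lg_ Lg cf cg.
apply: (@squeeze_cvgr _ _ _ _ (cst 0) (fun n =>
    2 * ip mu (fun x => f_ n x - f x) (fun x => f_ n x - f x) +
    2 * ip mu (fun x => g_ n x - g x) (fun x => g_ n x - g x))).
- apply: nearW => n; rewrite ip_ge0/=.
  have L1 := L2B (Lf_ n) Lf; have L2' := L2B (Lg_ n) Lg.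
  rewrite (@eq_ip _ (fun x => (f_ n x - f x) - (g_ n x - g x))
    _ (fun x => (f_ n x - f x) - (g_ n x - g x))); last 2 first.
  + by move=> x; ring.
  + by move=> x; ring.
  exact: ip_sub_le.
- exact: cvg_cst.
- rewrite [X in _ --> X](_ : 0 = 2 * 0 + 2 * 0); last by rewrite mulr0 addr0.
  by apply: cvgD; apply: cvgM => //; exact: cvg_cst.
Qed.

Lemma cvgL2_cst f : cvgL2 (fun=> f) f.
Proof.
rewrite /cvgL2 (_ : (fun n => _) = cst 0); first exact: cvg_cst.
apply/funext => n /=; rewrite -[RHS](ip0l (fun=> 0)).
by apply: eq_ip => x; rewrite subrr.
Qed.

Lemma cvgL2_ip2 (f_ : nat -> T -> R) f : (forall n, L2 mu (f_ n)) -> L2 mu f ->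
  cvgL2 f_ f -> ip mu (f_ n) (f_ n) @[n --> \oo] --> ip mu f f.
Proof.
move=> Lf_ Lf c.
rewrite (_ : (fun n => _) = fun n => ip mu (fun x => f_ n x - f x) (fun x => f_ n x - f x)
   + 2 * ip mu (f_ n) f - ip mu f f); last first.
  apply/funext => n; have Ld := L2B (Lf_ n) Lf.
  by rewrite ipBl// !ipBr// (ipC f (f_ n)); ring.
rewrite [X in _ --> X](_ : _ = 0 + 2 * ip mu f f - ip mu f f); last by ring.
apply: cvgB; last exact: cvg_cst.
apply: cvgD => //; apply: cvgM; first exact: cvg_cst.
exact: cvgL2_ip.
Qed.

Lemma cvgL2_unique (f_ : nat -> T -> R) f g : (forall n, L2 mu (f_ n)) -> L2 mu f -> L2 mu g ->
  cvgL2 f_ f -> cvgL2 f_ g -> {ae mu, forall x, f x = g x}.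
Proof.
move=> Lf_ Lf Lg cf cg; have Ld := L2B Lg Lf.
have h := cvgL2B Lf_ Lf Lf_ Lg cf cg.
have c : ip mu (fun x => (f_ n x - f_ n x) - (f x - g x))
    (fun x => (f_ n x - f_ n x) - (f x - g x)) @[n --> \oo] -->
    ip mu (fun x => g x - f x) (fun x => g x - f x).
  rewrite (_ : (fun n => _) = cst (ip mu (fun x => g x - f x) (fun x => g x - f x))).
    exact: cvg_cst.
  by apply/funext => n /=; apply: eq_ip => x; ring.
have e : ip mu (fun x => g x - f x) (fun x => g x - f x) = 0.
  by apply: (cvg_unique (@Rhausdorff R) c h).
have := ip_eq0 Ld e; apply: filterS => x /eqP; rewrite subr_eq0 => /eqP ->.
by [].
Qed.

End L2.

Lemma L2_finite_integrable (R : realType) (d : measure_display) (T : measurableType d)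
    (mu : {finite_measure set T -> \bar R}) (f : T -> R) :
  L2 mu f -> mu.-integrable setT (EFin \o f).
Proof.
move=> Lf; have [mf if_] := Lf.
have i1 : mu.-integrable setT (cst 1%:E : T -> \bar R).
  exact: finite_measure_integrable_cst.
apply: le_integrable (integrableD measurableT if_ i1) => //.
  exact/measurable_EFinP.
move=> x _; rewrite -EFinD !abse_EFin lee_fin [leRHS]ger0_norm ?addr_ge0 ?sqr_ge0//.
have := sqr_ge0 (`|f x| - 1); rewrite -(real_normK (num_real (f x))) !expr2.
by have := normr_ge0 (f x); nra.
Qed.

Lemma limn_einf_le (R : realType) (u : nat -> \bar R) (e : \bar R) :
  (forall n, u n <= e)%E -> (limn_einf u <= e)%E.
Proof.
move=> ue; rewrite limn_einf_lim; apply: lime_le; first exact: is_cvg_einfs.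
apply: nearW => n; apply: le_trans (ue n); apply: ereal_inf_lbound.
by exists n => //=.
Qed.

Lemma limn_einf_ge0 (R : realType) (u : nat -> \bar R) :
  (forall n, 0 <= u n)%E -> (0 <= limn_einf u)%E.
Proof.
move=> u0; rewrite limn_einf_lim; apply: lime_ge; first exact: is_cvg_einfs.
by apply: nearW => n; apply: le_ereal_inf_tmp => _ [k _ <-].
Qed.

(** * Completeness of L^2 over a sub-sigma-algebra *)

Section L2_complete.
Context {R : realType} {d : measure_display} {Omega : measurableType d}
  (P : probability Omega R) (Gs : set (set Omega)).
Hypothesis Gm : <<s Gs >> `<=` measurable.
Let OF := g_sigma_algebraType Gs.
Variable z : nat -> Omega -> R.
Hypothesis mz : forall n, measurable_fun setT (z n : OF -> R).
Hypothesis Lz : forall n, L2 P (z n).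
Hypothesis cauchy : forall e : R, 0 < e -> exists n0, forall m n, (n0 <= m)%N -> (n0 <= n)%N ->
  ip P (fun w => z m w - z n w) (fun w => z m w - z n w) < e.

(** This is 2^-k, written as the terms of the geometric series evaluated by
    [cvg_geometric_eseries_half]. *)
Let delta (k : nat) : R := 2 / (2 ^ (k + 1))%:R.

Let delta_gt0 k : 0 < delta k. Proof. by rewrite divr_gt0// ltr0n expn_gt0. Qed.

Let N k := sval (cid (cauchy (exprn_gt0 2 (delta_gt0 k)))).
Let NP k : forall m n, (N k <= m)%N -> (N k <= n)%N ->
  ip P (fun w => z m w - z n w) (fun w => z m w - z n w) < delta k ^+ 2.
Proof. by rewrite /N; case: cid. Qed.

(** Both [M k] and [M k.+1] exceed [N k], so consecutive terms of the subsequence are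
    [delta k]-close; the summand k makes the subsequence run to infinity. *)
Let M k := (k + \sum_(i < k.+1) N i)%N.

Let M_ge k : (k <= M k)%N. Proof. exact: leq_addr. Qed.
Let M_geN k : (N k <= M k)%N.
Proof. by rewrite /M big_ord_recr/=; exact: leq_trans (leq_addl _ _) (leq_addl _ _). Qed.
Let M_geN1 k : (N k <= M k.+1)%N.
Proof.
rewrite /M !big_ord_recr/=.
exact: leq_trans (leq_trans (leq_addl _ _) (leq_addr _ _)) (leq_addl _ _).
Qed.

Let y k := z (M k).
Let D k w : R := y k.+1 w - y k w.

Let LD k : L2 P (D k). Proof. by apply: L2B; exact: Lz. Qed.

Let mD k : measurable_fun setT (D k). Proof. by case: (LD k). Qed.

(** By |D| <= (D^2/delta + delta)/2 and the bound delta^2 on the second moment of D. *)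
Let intD k : (\int[P]_w `|(D k w)%:E| <= (delta k)%:E)%E.
Proof.
have d0 := delta_gt0 k.
have LDk := LD k.
have iD : P.-integrable setT (fun w => ((delta k)^-1 * D k w ^+ 2)%:E).
  by have := integrableZl measurableT (delta k)^-1 LDk.2.
have i1 : P.-integrable setT (fun=> (delta k)%:E).
  exact: finite_measure_integrable_cst.
apply: (@le_trans _ _ (\int[P]_w ((2^-1)%:E * (((delta k)^-1 * D k w ^+ 2)%:E + (delta k)%:E)))%E).
  apply: ge0_le_integral => //.
  - by apply: measurableT_comp => //; exact/measurable_EFinP.
  - have := measurable_int _ (integrableZl measurableT 2^-1 (integrableD measurableT iD i1)).
    by [].
  - move=> w _; rewrite abse_EFin -EFinD -EFinM lee_fin -(real_normK (num_real (D k w))).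
    have := normr_ge0 (D k w); set a := `|_|; set b := delta k in d0 * => a0.
    have -> : 2^-1 * (b^-1 * a ^+ 2 + b) = a + (2 * b)^-1 * (a - b) ^+ 2 by field; lra.
    by rewrite lerDl mulr_ge0 ?sqr_ge0// invr_ge0; lra.
rewrite integralZl//; last exact: (integrableD measurableT iD i1).
rewrite integralD//.
have -> : (\int[P]_x ((delta k)^-1 * D k x ^+ 2)%:E = ((delta k)^-1 * ip P (D k) (D k))%:E)%E.
  rewrite EFinM ipE//; under [in RHS]eq_integral do rewrite -expr2.
  by rewrite -integralZl//; case: LDk.
have -> : (\int[P]__ (delta k)%:E = (delta k)%:E)%E.
  rewrite -[LHS]/(\int[P]_x cst (delta k)%:E x)%E integral_cst// -[RHS]mule1.
  by congr (_ * _)%E; exact: probability_setT.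
rewrite -EFinD -EFinM lee_fin.
have := NP (M_geN1 k) (M_geN k); rewrite -/(D k) => h.
have : (delta k)^-1 * ip P (D k) (D k) <= delta k.
  by rewrite ler_pdivrMl// -expr2 ltW.
by lra.
Qed.

Let ae_summable : {ae P, forall w, (\sum_(k <oo) `|(D k w)%:E| < +oo)%E}.
Proof.
have mabs k : measurable_fun setT (fun w => `|(D k w)%:E|%E).
  by apply: measurableT_comp => //; exact/measurable_EFinP.
have msum : measurable_fun setT (fun w => \sum_(k <oo) `|(D k w)%:E|)%E.
  by apply: ge0_emeasurable_sum.
have int : P.-integrable setT (fun w => \sum_(k <oo) `|(D k w)%:E|)%E.
  apply/integrableP; split => //.
  under eq_integral do rewrite gee0_abs ?nneseries_ge0//.
  rewrite integral_nneseries//.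
  apply: (@le_lt_trans _ _ (\sum_(k <oo) (delta k)%:E)%E).
    by apply: lee_nneseries => [k _ _|k _]; [exact: integral_ge0|exact: intD].
  have := @cvg_geometric_eseries_half R 2 0; rewrite expr0 divr1 => /cvg_lim.
  by rewrite /delta/eseries/= => -> //; rewrite ltry.
have := integrable_ae measurableT int.
apply: filterS => w /(_ I) h; rewrite ltey_eq h//.
Qed.

(** The limit superior is defined at every point and thus measurable for the sub-sigma-algebra, null
    sets included; it is the limit wherever the series of differences converges absolutely. *)
Let Z w : R := fine (limn_esup (fun k => (y k w)%:E)).

Let mZ : measurable_fun setT (Z : OF -> R).
Proof.
have h : measurable_fun setT (fun w : OF => limn_esup (fun k => (y k w)%:E)).
  by apply: measurable_fun_limn_esup => k; apply/measurable_EFinP; exact: mz.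
exact: (measurableT_comp (@fine_measurable R setT measurableT) h).
Qed.

Let ae_cvg : {ae P, forall w, y k w @[k --> \oo] --> Z w}.
Proof.
apply: filterS ae_summable => w sw.
have c : cvgn (fun k => y k w).
  have nc : cvgn [normed series (fun k => D k w)].
    apply: nondecreasing_is_cvgn.
      by apply/nondecreasing_seqP => n; rewrite /= /series/= big_nat_recr//= lerDl.
    exists (fine (\sum_(k <oo) `|(D k w)%:E|)%E) => _ [n _ <-].
    rewrite -lee_fin fineK; last first.
      by rewrite ge0_fin_numE// nneseries_ge0.
    rewrite /= /series/= -sumEFin.
    under eq_bigr do rewrite -abse_EFin.
    exact: nneseries_lim_ge.
  have := normed_cvg nc => sc.
  have -> : (fun k => y k w) = (fun k => y 0%N w + series (fun k => D k w) k).
    apply/funext => k; rewrite /series/=.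
    by rewrite /D telescope_sumr// addrC subrK.
  by apply: is_cvgD => //; exact: is_cvg_cst.
have e : (fun k => (y k w)%:E) @ \oo --> (limn (fun k => y k w))%:E.
  by apply: cvg_EFin => //; exact: nearW.
have [_ eq] := cvg_limn_einf_sup e.
by rewrite /Z eq/=.
Qed.

(** Fatou's lemma along the almost surely convergent subsequence; the shift by [k0] restricts the
    bound to late terms. *)
Let fatouZ k0 n (e : R) :
  (forall k, ip P (fun w => z n w - y (k + k0)%N w) (fun w => z n w - y (k + k0)%N w) <= e) ->
  (\int[P]_w ((z n w - Z w) ^+ 2)%:E <= e%:E)%E.
Proof.
move=> he.
have m1 k : measurable_fun setT (fun w => ((z n w - y (k + k0)%N w) ^+ 2)%:E).
  by apply/measurable_EFinP; apply: measurable_funX; case: (L2B (Lz n) (Lz (M (k + k0)%N))).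
have mZ' : measurable_fun setT Z by exact: (sub_measurable_fun Gm mZ).
have m2 : measurable_fun setT (fun w => ((z n w - Z w) ^+ 2)%:E).
  apply/measurable_EFinP; apply: measurable_funX; apply: measurable_funB => //.
  by case: (Lz n).
have m3 : measurable_fun setT (fun w => limn_einf (fun k => ((z n w - y (k + k0)%N w) ^+ 2)%:E)).
  rewrite /limn_einf /limf_einf.
  apply: measurableT_comp => //; apply: measurable_fun_limn_esup => k.
  by apply: measurableT_comp.
apply: (@le_trans _ _ (\int[P]_w limn_einf (fun k => ((z n w - y (k + k0)%N w) ^+ 2)%:E))%E).
  rewrite le_eqVlt; apply/orP; left; apply/eqP; apply: ge0_ae_eq_integral => //.
  - by move=> w _; rewrite lee_fin sqr_ge0.
  - by move=> w _; apply: limn_einf_ge0 => k; rewrite lee_fin sqr_ge0.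
  - apply: filterS ae_cvg => w cw _.
    have c : (fun k => ((z n w - y (k + k0)%N w) ^+ 2)%:E) @ \oo --> ((z n w - Z w) ^+ 2)%:E.
      apply: cvg_EFin; first exact: nearW.
      apply: (@continuous_cvg _ _ _ _ _ _ (fun u : R => u ^+ 2)).
        exact: exprn_continuous.
      apply: cvgB; first exact: cvg_cst.
      by rewrite (cvg_shiftn k0 (fun k => y k w)).
    by have [-> _] := cvg_limn_einf_sup c.
apply: le_trans.
  by apply: fatou => // k w _; rewrite lee_fin sqr_ge0.
apply: limn_einf_le => k.
under eq_integral do rewrite expr2.
by rewrite -ipE ?lee_fin//; apply: L2B; exact: Lz.
Qed.

Lemma L2_complete : exists Z0 : OF -> R,
  [/\ measurable_fun setT Z0, L2 P Z0 & cvgL2 P z Z0].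
Proof.
have mZ' : measurable_fun setT Z by exact: (sub_measurable_fun Gm mZ).
have LZ : L2 P Z.
  have LzZ : L2 P (fun w => z (N 0%N) w - Z w).
    split; first by apply: measurable_funB => //; case: (Lz (N 0%N)).
    apply/integrableP; split.
      apply/measurable_EFinP; apply: measurable_funX; apply: measurable_funB => //.
      by case: (Lz (N 0%N)).
    under eq_integral do rewrite abse_EFin ger0_norm ?sqr_ge0//.
    apply: (@le_lt_trans _ _ (delta 0 ^+ 2)%:E); last by rewrite ltry.
    apply: (fatouZ (k0 := 0%N)) => k; apply/ltW/NP => //.
    rewrite /M; apply: leq_trans (leq_addl _ _).
    by rewrite big_ord_recl leq_addr.
  have := L2B (Lz (N 0%N)) LzZ.
  by under eq_fun do rewrite subKr.
exists Z; split => //.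
apply/cvgrPdist_le => e e0; have [n0 hn0] := cauchy e0.
near=> n; rewrite sub0r normrN ger0_norm ?ip_ge0//.
have nn0 : (n0 <= n)%N by near: n; exact: nbhs_infty_ge.
rewrite -lee_fin ipE; [|exact: L2B|exact: L2B].
under eq_integral do rewrite -expr2.
apply: (fatouZ (k0 := n0)) => k; apply/ltW/hn0 => //.
by apply: leq_trans (M_ge _); exact: leq_addl.
Unshelve. all: by end_near. Qed.

End L2_complete.

(** * Step functions and the inverse of the adjoint operator *)

Section step_map.
Context {R : realType} {d : measure_display} {X : measurableType d}
  (mu : {measure set X -> \bar R}).
Implicit Types (phi : R -> X -> R) (f g : step R).

(** Both sides of the isometry are instances: [phi = G] gives [step_integral] and [phi = Kt K] gives
    [Kstar_step]. In both spaces [ip_step_map] computes the inner product as [lambda_dot C]. *)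
Definition step_map phi f (x : X) : R := \sum_(p <- f) p.1 * phi p.2 x.

Lemma step_map_cons phi p f x : step_map phi (p :: f) x = p.1 * phi p.2 x + step_map phi f x.
Proof. by rewrite /step_map big_cons. Qed.

Lemma step_map_cat phi f g x : step_map phi (f ++ g) x = step_map phi f x + step_map phi g x.
Proof. by rewrite /step_map big_cat. Qed.

Definition step_scale (k : R) f : step R := [seq (k * p.1, p.2) | p <- f].

Lemma step_map_scale phi k f x : step_map phi (step_scale k f) x = k * step_map phi f x.
Proof.
by rewrite /step_map big_map big_distrr/=; apply: eq_bigr => p _; rewrite mulrA.
Qed.

Lemma step_map_sub phi f g x : step_map phi (step_sub f g) x = step_map phi f x - step_map phi g x.
Proof.
rewrite /step_sub step_map_cat; congr (_ + _).
rewrite -mulN1r -step_map_scale; congr (step_map _ _ _).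
by apply: eq_map => p; rewrite mulN1r.
Qed.

Lemma step_on_cons u p f : step_on u (p :: f) -> 0 <= p.2 <= u /\ step_on u f.
Proof.
move=> h; split; first by apply: h; rewrite mem_head.
by move=> q qf; apply: h; rewrite in_cons qf orbT.
Qed.

Lemma step_on_consP u p f : 0 <= p.2 <= u -> step_on u f -> step_on u (p :: f).
Proof. by move=> hp hf q; rewrite in_cons => /predU1P[->|/hf]. Qed.

Lemma step_on_cat (u : R) f g : step_on u f -> step_on u g -> step_on u (f ++ g).
Proof. by move=> uf ug p; rewrite mem_cat => /orP[/uf|/ug]. Qed.

Lemma step_on_scale (u : R) k f : step_on u f -> step_on u (step_scale k f).
Proof. by move=> uf _ /mapP[p /uf ? ->]. Qed.

Lemma step_on_sub (u : R) f g : step_on u f -> step_on u g -> step_on u (step_sub f g).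
Proof.
by move=> uf ug; apply: step_on_cat => // _ /mapP[p /ug ? ->].
Qed.

Lemma step_onW (u1 u2 : R) f : u1 <= u2 -> step_on u1 f -> step_on u2 f.
Proof. by move=> u12 uf p /uf /andP[-> /le_trans]; exact. Qed.

Variables (T : R) (phi : R -> X -> R) (C : R -> R -> R).
Hypothesis Lphi : forall t, 0 <= t <= T -> L2 mu (phi t).
Hypothesis Cphi : forall t s, 0 <= t <= T -> 0 <= s <= T -> ip mu (phi t) (phi s) = C t s.

Lemma step_map_L2 f : step_on T f -> L2 mu (step_map phi f).
Proof.
elim: f => [_|p f ih /step_on_cons[pT fT]].
  by rewrite /step_map; under eq_fun do rewrite big_nil; exact: L2_0.
have -> : step_map phi (p :: f) = (fun x => p.1 * phi p.2 x + step_map phi f x).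
  by apply/funext => x; exact: step_map_cons.
by apply: L2D; [apply: L2Z; exact: Lphi|exact: ih].
Qed.

Lemma ip_step_mapl f h : step_on T f -> L2 mu h ->
  ip mu (step_map phi f) h = \sum_(p <- f) p.1 * ip mu (phi p.2) h.
Proof.
move=> + Lh; elim: f => [_|p f ih /step_on_cons[pT fT]].
  by rewrite big_nil -[RHS](ip0l mu h); apply: eq_ip => // x; rewrite /step_map big_nil.
rewrite big_cons -ih// -ipZl//; last exact: Lphi.
rewrite -ipDl//; [|by apply: L2Z; exact: Lphi|exact: step_map_L2].
by apply: eq_ip => // x; exact: step_map_cons.
Qed.

Lemma ip_step_map f g : step_on T f -> step_on T g ->
  ip mu (step_map phi f) (step_map phi g) = lambda_dot C f g.
Proof.
move=> fT gT; rewrite ip_step_mapl//; last exact: step_map_L2.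
rewrite /lambda_dot big_seq [RHS]big_seq; apply: eq_bigr => p pf.
rewrite ipC ip_step_mapl//; last by apply: Lphi; exact: fT.
rewrite big_distrr/= big_seq [RHS]big_seq; apply: eq_bigr => q qg.
by rewrite ipC Cphi ?mulrA//; [exact: fT|exact: gT].
Qed.

Lemma ip_step_sub f g : step_on T f -> step_on T g ->
  ip mu (fun x => step_map phi f x - step_map phi g x)
    (fun x => step_map phi f x - step_map phi g x) =
  lambda_dot C (step_sub f g) (step_sub f g).
Proof.
move=> fT gT; rewrite -ip_step_map; [|exact: step_on_sub|exact: step_on_sub].
by apply: eq_ip => x; rewrite step_map_sub.
Qed.

End step_map.

Lemma cvgL2_cauchy (R : realType) (d : measure_display) (X : measurableType d)
    (mu : {measure set X -> \bar R}) (f_ : nat -> X -> R) (f : X -> R) :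
  (forall n, L2 mu (f_ n)) -> L2 mu f -> cvgL2 mu f_ f ->
  forall e, 0 < e -> exists n0, forall m n, (n0 <= m)%N -> (n0 <= n)%N ->
    ip mu (fun x => f_ m x - f_ n x) (fun x => f_ m x - f_ n x) < e.
Proof.
move=> Lf_ Lf /cvgrPdist_lt cf e e0.
have e4 : 0 < e / 4 by rewrite divr_gt0.
have [n0 _ h] := cf _ e4; exists n0 => m n n0m n0n.
have := h _ n0m; have := h _ n0n.
rewrite /= !sub0r !normrN !ger0_norm ?ip_ge0// => hn hm.
have := ip_sub_le (L2B (Lf_ m) Lf) (L2B (Lf_ n) Lf).
have -> : ip mu (fun x => (f_ m x - f x) - (f_ n x - f x)) (fun x => (f_ m x - f x) - (f_ n x - f x))
  = ip mu (fun x => f_ m x - f_ n x) (fun x => f_ m x - f_ n x).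
  by apply: eq_ip => x; ring.
by lra.
Qed.

Section volterra.
Context {R : realType} (T : R) (K C : R -> R -> R)
  (dv : {measure set (measurableTypeR R) -> \bar R}).
Hypothesis dv_fin : (dv `[0%R, T[%classic < +oo)%E.
Hypothesis K_measurable : forall t, 0 <= t <= T -> measurable_fun `[0, T] (K t).
Hypothesis K_square : forall t, 0 <= t <= T ->
    (\int[dv]_(s in `[0%R, t[) ((K t s) ^+ 2)%:E < +oo)%E.
Hypothesis K_factor : forall t s, 0 <= t <= T -> 0 <= s <= T ->
    C t s = \int[dv]_(x in `[0, Num.min t s[) (K t x * K s x).
Hypothesis K_inverse : forall t, 0 <= t <= T ->
    exists f, integrand_on C t f /\ Kstar_eq K dv T f \1_`[0, t[%classic.

Let S := measurableTypeR R.

Definition Kt (t : R) (s : measurableTypeR R) : R := K t s * \1_`[0, t[%classic s.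

Lemma Kt_patch (t : R) : Kt t = K t \_ `[0, t[.
Proof.
apply/funext => s; rewrite /Kt patchE indicE; case: (_ \in _); first by rewrite mulr1.
by rewrite mulr0.
Qed.

Let mitv (i : interval R) : measurable ([set` i] : set S).
Proof. by have h := measurable_itv i; refine h. Qed.

Let mind (i : interval R) : measurable_fun setT (\1_[set` i] : S -> R).
Proof. exact: (@measurable_indic _ S R setT _ (mitv i)). Qed.

Lemma Kt_L2 t : 0 <= t <= T -> L2 dv (Kt t).
Proof.
move=> tT; have mK : measurable_fun setT (Kt t).
  rewrite Kt_patch; apply/(measurable_restrictT _ (mitv _)).
  have h : measurable_fun (`[0, T] : set S) (K t).
    by move=> mD B mB; exact: (K_measurable tT mD mB).
  apply: (measurable_funS (mitv _) _ h).
  by move=> s /=; rewrite !in_itv/= => /andP[-> /ltW/le_trans]; apply; case/andP: tT.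
split => //; apply/integrableP; split.
  by apply/measurable_EFinP; exact: measurable_funX.
under eq_integral do rewrite abse_EFin ger0_norm ?sqr_ge0//.
apply: le_lt_trans (K_square tT); rewrite [leRHS]integral_mkcond.
rewrite le_eqVlt; apply/orP; left; apply/eqP; apply: eq_integral => s _.
by rewrite Kt_patch !patchE; case: ifP => //; rewrite expr0n.
Qed.

Lemma Kt_ip t s : 0 <= t <= T -> 0 <= s <= T -> ip dv (Kt t) (Kt s) = C t s.
Proof.
move=> tT sT; rewrite K_factor// Rintegral_mkcond; apply: eq_Rintegral => x _.
rewrite !Kt_patch !patchE !mem_setE !in_itv/= lt_min.
by case: (0 <= x) => /=; case: (x < t) => //=; case: (x < s) => //=; rewrite ?mulr0 ?mul0r.
Qed.

Definition Kapprox (u : R) (g : S -> R) : Prop :=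
  L2 dv g /\ forall e, 0 < e -> exists f, step_on u f /\
    ip dv (fun x => step_map Kt f x - g x) (fun x => step_map Kt f x - g x) < e.

Section approx.
Variable u : R.
Hypothesis uT : 0 <= u <= T.

Let LK f : step_on u f -> L2 dv (step_map Kt f).
Proof.
move=> fu; apply: (step_map_L2 Kt_L2); apply: step_onW fu.
by case/andP: uT.
Qed.

Lemma Kapprox_ext g h : g =1 h -> Kapprox u g -> Kapprox u h.
Proof. by move=> /funext ->. Qed.

Lemma Kapprox_lin k g h : Kapprox u g -> Kapprox u h -> Kapprox u (fun x => k * g x + h x).
Proof.
move=> [Lg hg] [Lh hh]; split; first by apply: L2D => //; exact: L2Z.
move=> e e0.
have k0 : 0 < k ^+ 2 + 1 by rewrite ltr_wpDl// sqr_ge0.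
have e1 : 0 < e / 4 / (k ^+ 2 + 1) by rewrite !divr_gt0.
have e2 : 0 < e / 4 by rewrite divr_gt0.
have [f1 [uf1 h1]] := hg _ e1; have [f2 [uf2 h2]] := hh _ e2.
have Ld1 := L2B (LK uf1) Lg; have Ld2 := L2B Lh (LK uf2).
exists (step_scale k f1 ++ f2); split.
  by apply: step_on_cat => //; exact: step_on_scale.
have := ip_sub_le (L2Z k Ld1) Ld2.
rewrite ipZl ?ipZr//; last exact: L2Z.
have -> : ip dv (fun x => h x - step_map Kt f2 x) (fun x => h x - step_map Kt f2 x) =
    ip dv (fun x => step_map Kt f2 x - h x) (fun x => step_map Kt f2 x - h x).
  by rewrite /ip; apply: eq_Rintegral => x _; ring.
rewrite (@eq_ip _ _ _ dv _ (fun x => step_map Kt (step_scale k f1 ++ f2) x - (k * g x + h x))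
  _ (fun x => step_map Kt (step_scale k f1 ++ f2) x - (k * g x + h x))); last 2 first.
- by move=> x; rewrite step_map_cat step_map_scale; ring.
- by move=> x; rewrite step_map_cat step_map_scale; ring.
move=> hle; apply: le_lt_trans hle _.
have : k ^+ 2 * ip dv (fun x => step_map Kt f1 x - g x) (fun x => step_map Kt f1 x - g x)
    <= e / 4.
  have := ip_ge0 dv (fun x => step_map Kt f1 x - g x).
  set q := ip _ _ _ in h1 * => q0.
  have : q * (k ^+ 2 + 1) < e / 4 by rewrite -ltr_pdivlMr.
  by lra.
by rewrite expr2; lra.
Qed.

Lemma Kapprox0 : Kapprox u (fun=> 0).
Proof.
split; first exact: L2_0.
move=> e e0; exists [::]; split => //.
rewrite (@eq_ip _ _ _ dv _ (fun=> 0) _ (fun=> 0)) ?ip0l// => x.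
all: by rewrite /step_map big_nil subrr.
Qed.

Lemma Kapprox_lim g : L2 dv g ->
  (forall e, 0 < e -> exists h, Kapprox u h /\
    ip dv (fun x => h x - g x) (fun x => h x - g x) < e) -> Kapprox u g.
Proof.
move=> Lg hg; split => // e e0.
have e4 : 0 < e / 4 by rewrite divr_gt0.
have [h [[Lh hh] hgh]] := hg _ e4; have [f [uf hf]] := hh _ e4.
exists f; split => //.
have := ip_sub_le (L2B (LK uf) Lh) (L2B Lg Lh).
have -> : ip dv (fun x => g x - h x) (fun x => g x - h x) =
    ip dv (fun x => h x - g x) (fun x => h x - g x).
  by rewrite /ip; apply: eq_Rintegral => x _; ring.
have -> : ip dv (fun x => step_map Kt f x - h x - (g x - h x)) (fun x => step_map Kt f x - h x - (g x - h x))
  = ip dv (fun x => step_map Kt f x - g x) (fun x => step_map Kt f x - g x).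
  by apply: eq_ip => x; ring.
by lra.
Qed.

Lemma L2_indic (A : set S) : measurable A -> (dv A < +oo)%E -> L2 dv (\1_A : S -> R).
Proof.
move=> mA dA; split; first exact: (@measurable_indic _ S R setT _ mA).
have -> : (fun x => (\1_A x ^+ 2)%:E) = EFin \o (\1_A : S -> R).
  apply/funext => x /=; congr EFin; rewrite indicE.
  by case: (_ \in _); rewrite ?expr1n// expr0n.
apply/integrableP; split.
  by apply/measurable_EFinP; exact: (@measurable_indic _ S R setT _ mA).
under eq_integral do rewrite /= ger0_norm//.
by rewrite integral_indic// setIT.
Qed.

Let dv_sub (A : set S) : measurable A -> (dv (A `&` `[0%R, u[%classic) < +oo)%E.
Proof.
move=> mA; apply: le_lt_trans dv_fin; apply: le_measure; rewrite ?inE.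
- by apply: measurableI => //; exact: mitv.
- exact: mitv.
- move=> x [_] /=; rewrite !in_itv/= => /andP[-> /lt_le_trans]; apply.
  by case/andP: uT.
Qed.

(** The inverse kernel K^-1(r, .) is a limit of step functions with times at most r, which keeps the
    approximation within the past of u. *)
Lemma Kapprox_itv r : 0 <= r <= u -> Kapprox u (\1_`[0, r[%classic).
Proof.
move=> /andP[r0 ru]; have rT : 0 <= r <= T.
  by rewrite r0 (le_trans ru)//; case/andP: uT.
have Li : L2 dv (\1_`[0, r[%classic : S -> R).
  apply: L2_indic; first exact: mitv.
  apply: le_lt_trans dv_fin; apply: le_measure; rewrite ?inE; [exact: mitv|exact: mitv|].
  move=> x /=; rewrite !in_itv/= => /andP[-> /lt_le_trans]; apply.
  by case/andP: rT.
split => // e e0.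
have [f [[fr _]]] := K_inverse rT; rewrite /Kstar_eq.
have Lf n : L2 dv (step_map Kt (f n)).
  by apply: (step_map_L2 Kt_L2); apply: step_onW (fr n); case/andP: rT.
(* Everything vanishes off [0, T[, so the integral in [Kstar_eq] is a full squared L^2 distance. *)
have Kt0 n x : x \notin `[0, T[ -> step_map Kt (f n) x = 0.
  move=> xT; rewrite /step_map big_seq big1// => p pf.
  rewrite /Kt indicE mem_setE; case: (boolP (x \in _)); last by rewrite !mulr0.
  rewrite in_itv/= => /andP[x0 xp]; move: xT; rewrite in_itv/= x0/= -leNgt => Tx.
  have /andP[_ pr] := fr n p pf; move: rT => /andP[_].
  by move=> /(le_trans pr) /le_trans /(_ Tx); rewrite leNgt xp.
have e1 n : (\int[dv]_(s in `[0%R, T[) ((Kstar_step K (f n) s - \1_`[0, r[%classic s) ^+ 2)%:E =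
    \int[dv]_s ((step_map Kt (f n) s - \1_`[0, r[%classic s) ^+ 2)%:E)%E.
  rewrite integral_mkcond; apply: eq_integral => x _; rewrite patchE mem_setE.
  case: ifPn => //= xT; rewrite Kt0// indicE memNset ?subrr ?expr0n//.
  move=> /=; rewrite in_itv/= => /andP[x0 xr]; move: xT; rewrite in_itv/= x0/=.
  by rewrite (lt_le_trans xr)//; case/andP: rT.
under eq_fun do rewrite e1.
move=> /(cvgL2P Lf Li)/cvgrPdist_lt/(_ _ e0)[n _ /(_ n (leqnn n))].
rewrite /= sub0r normrN ger0_norm ?ip_ge0// => hn.
by exists (f n); split => //; apply: step_onW (fr n).
Qed.

Let indU := \1_`[0, u[%classic : S -> R.

(** The factor [indU] keeps all sets of finite measure and makes complements linear, as the
    complement of B contributes [indU] minus the function of B. *)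
Lemma Kapprox_indic (A : set S) : measurable A -> Kapprox u (fun x => \1_A x * indU x).
Proof.
move=> mA; have mE := measurable_realfun.RGenInftyO.measurableE R.
have mA' : (@measurable_realfun.RGenInftyO.G R).-sigma.-measurable A by rewrite -mE.
have LI (B : set S) : measurable B -> L2 dv (fun x => \1_B x * indU x).
  move=> mB; have := L2_indic (measurableI _ _ mB (mitv `[0, u[)) (dv_sub mB).
  by rewrite indicI.
apply: (@dynkin_induction _ S (@measurable_realfun.RGenInftyO.G R)
  [set A | Kapprox u (fun x => \1_A x * indU x)] mE _ _ _ _ _ A); [| | | | | exact: mA'].
- move=> _ _ [x ->] [y ->]; exists (Num.min x y).
  by apply/seteqP; split => z /=; rewrite !in_itv/= lt_min => /andP.
- apply: Kapprox_ext (Kapprox_itv (r := u) _); last by case/andP: uT => ->/=.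
  by move=> x; rewrite indicT mul1r.
- move=> _ [p ->].
  have [p0|p0] := leP p 0.
    apply: Kapprox_ext Kapprox0 => x; rewrite /indU !indicE !mem_setE !in_itv/=.
    case: (ltP x p) => xp; last by rewrite mul0r.
    by rewrite leNgt (lt_le_trans xp p0)/= mulr0.
  apply: (Kapprox_ext _ (Kapprox_itv (r := Num.min p u) _)); last first.
    by rewrite ge_min lexx orbT andbT le_min ltW//=; case/andP: uT.
  move=> x; rewrite /indU !indicE !mem_setE !in_itv/= lt_min.
  by case: (0 <= x) => /=; case: (x < p) => //=; case: (x < u); rewrite ?mulr0 ?mul0r ?mul1r.
- move=> B mB SB; apply: Kapprox_ext (Kapprox_lin (-1) SB
    (Kapprox_itv (r := u) _)); last by case/andP: uT => ->/=.
  by move=> x; rewrite /indU indicC [\1_B x]indicE; case: (x \in B) => /=; ring.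
- move=> F mF tF SF.
  have mU : measurable (\bigcup_k F k) by exact: bigcupT_measurable.
  apply: Kapprox_lim; first exact: LI.
  move=> e e0.
  pose h n x := (\sum_(0 <= i < n) \1_(F i) x : R) * indU x.
  have hE n x : h n x = \1_(\bigcup_(i in `I_n) F i) x * indU x.
    by rewrite /h sum_indic_trivIset.
  have Kh n : Kapprox u (h n).
    elim: n => [|n ih].
      by apply: Kapprox_ext Kapprox0 => x; rewrite /h big_geq// mul0r.
    apply: Kapprox_ext (Kapprox_lin 1 ih (SF n)) => x.
    by rewrite /h big_nat_recr//= mul1r mulrDl.
  have mn n : measurable (\bigcup_(i in `I_n) F i) by exact: bigcup_measurable.
  have c : (\int[dv]_x ((h n x - \1_(\bigcup_k F k) x * indU x) ^+ 2)%:E @[n --> \oo] --> 0)%E.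
    have LU := LI _ mU.
    have mhn n : measurable_fun setT (h n) by case: (Kh n) => -[].
    have := @dominated_convergence _ S R dv setT measurableT
      (fun n x => ((h n x - \1_(\bigcup_k F k) x * indU x) ^+ 2)%:E) (cst 0%E)
      (fun x => ((\1_(\bigcup_k F k) x * indU x) ^+ 2)%:E).
    case.
    + move=> n; apply/measurable_EFinP/measurable_funX/measurable_funB => //.
      by case: LU.
    + exact: measurable_cst.
    + apply: aeW => x _; apply: cvg_EFin; first exact: nearW.
      rewrite [X in _ --> X](_ : 0 = (\1_(\bigcup_k F k) x * indU x -
        \1_(\bigcup_k F k) x * indU x) ^+ 2 :> R); last by rewrite subrr expr0n.
      apply: (@continuous_cvg _ _ _ _ _ _ (fun u : R => u ^+ 2)).
        exact: exprn_continuous.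
      apply: cvgB; last exact: cvg_cst.
      by apply: cvgM; [exact: cvg_sum_indic_trivIset|exact: cvg_cst].
    + by case: LU.
    + apply: aeW => x n _; rewrite abse_EFin lee_fin ger0_norm ?sqr_ge0// hE -mulrBl !exprMn.
      rewrite ler_wpM2r ?sqr_ge0// !indicE.
      have [xn|xn] := boolP (x \in \bigcup_(i in `I_n) F i); last by rewrite sub0r sqrrN.
      rewrite (_ : x \in \bigcup_k F k) ?subrr ?expr0n//=.
        by rewrite expr1n.
      by move/set_mem : xn => [i _ Fi]; apply/mem_set; exists i.
    + by rewrite integral0.
  have Lh n : L2 dv (h n) by case: (Kh n).
  have := (cvgL2P Lh (LI _ mU)).1 c.
  move=> /cvgrPdist_lt/(_ _ e0)[n _ /(_ n (leqnn n))].
  rewrite /= sub0r normrN ger0_norm ?ip_ge0// => hn.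
  by exists (h n); split.
Qed.

Import HBNNSimple.

(** Simple functions below g vanish where g does, so their level sets may be cut by [indU];
    domination by g^2 gives convergence in L^2. *)
Lemma Kapprox_ge0 (g : S -> R) : L2 dv g -> (forall x, 0 <= g x) ->
  (forall x, x \notin `[0, u[ -> g x = 0) -> Kapprox u g.
Proof.
move=> Lg g0 gu; apply: Kapprox_lim => // e e0.
have [mg ig] := Lg.
have mgE : measurable_fun setT (EFin \o g) by exact/measurable_EFinP.
pose f_ := nnsfun_approx measurableT mgE.
have fg x : (f_ n x)%:E @[n --> \oo] --> (g x)%:E.
  by apply: cvg_nnsfun_approx => // y _; rewrite lee_fin.
have fgR x : f_ n x @[n --> \oo] --> g x by have /fine_cvgP[] := fg x.
have nd x : {homo (fun n => f_ n x) : m n / (m <= n)%N >-> m <= n}.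
  by move=> m n mn; exact/lefP/nd_nnsfun_approx.
have f_le n x : f_ n x <= g x.
  rewrite -(cvg_lim _ (fgR x))//; apply: nondecreasing_cvgn_le.
    by move=> a b ab; exact: nd.
  by apply: cvgP; exact: fgR.
have f0 n x : 0 <= f_ n x by [].
have Kf n : Kapprox u (f_ n).
  have mfn r : measurable (f_ n @^-1` [set r]).
    by rewrite -[X in measurable X]setTI; exact: measurable_funP.
  pose s : seq R := finmap.enum_fset (fset_set (range (f_ n))).
  have ks (l : seq R) : Kapprox u (fun x => \sum_(r <- l) r * (\1_(f_ n @^-1` [set r]) x * indU x)).
    elim: l => [|r l ih].
      by apply: Kapprox_ext Kapprox0 => x; rewrite big_nil.
    apply: Kapprox_ext (Kapprox_lin r (Kapprox_indic (mfn r)) ih) => x.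
    by rewrite big_cons.
  refine (Kapprox_ext _ (ks s)) => x.
  have -> : f_ n x = f_ n x * indU x.
    rewrite /indU indicE mem_setE; case: (boolP (x \in _)) => xu; first by rewrite mulr1.
    by rewrite mulr0; apply/eqP; rewrite eq_le f0 andbT -(gu _ xu) f_le.
  rewrite [in RHS]fimfunE fsbig_finite//= big_distrl/=.
  by apply: eq_bigr => r _; rewrite mulrA.
have Lf n : L2 dv (f_ n) by case: (Kf n).
have c : (\int[dv]_x ((f_ n x - g x) ^+ 2)%:E @[n --> \oo] --> 0)%E.
  have := @dominated_convergence _ S R dv setT measurableT
    (fun n x => ((f_ n x - g x) ^+ 2)%:E) (cst 0%E) (fun x => (g x ^+ 2)%:E).
  case => //.
  + move=> n; apply/measurable_EFinP/measurable_funX/measurable_funB => //.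
  + apply: aeW => x _; apply: cvg_EFin; first exact: nearW.
    rewrite [X in _ --> X](_ : 0 = (g x - g x) ^+ 2 :> R); last by rewrite subrr expr0n.
    apply: (@continuous_cvg _ _ _ _ _ _ (fun u : R => u ^+ 2)).
      exact: exprn_continuous.
    by apply: cvgB; [exact: fgR|exact: cvg_cst].
  + apply: aeW => x n _; rewrite abse_EFin lee_fin ger0_norm ?sqr_ge0// -sqrrN opprB.
    have := f_le n x; have := f0 n x => h1 h2.
    by rewrite lerXn2r ?nnegrE ?subr_ge0// lerBlDr lerDl.
  + by rewrite integral0.
have := (cvgL2P Lf Lg).1 c.
move=> /cvgrPdist_lt/(_ _ e0)[n _ /(_ n (leqnn n))].
rewrite /= sub0r normrN ger0_norm ?ip_ge0// => hn.
by exists (f_ n); split.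
Qed.

Lemma Kapprox_all (g : S -> R) : L2 dv g ->
  (forall x, x \notin `[0, u[ -> g x = 0) -> Kapprox u g.
Proof.
move=> Lg gu.
have [mg ig] := Lg.
have part (s : R) (h : S -> R) : measurable_fun setT h -> (forall x, 0 <= h x <= `|g x|) -> L2 dv h.
  move=> mh hg; split => //; apply: le_integrable ig => //.
    by apply/measurable_EFinP; exact: measurable_funX.
  move=> x _; rewrite !abse_EFin lee_fin !ger0_norm ?sqr_ge0// -(real_normK (num_real (g x))).
  by have /andP[h0 h1] := hg x; rewrite lerXn2r// nnegrE.
pose gp x := Num.max (g x) 0; pose gn x := Num.max (- g x) 0.
have Lp : L2 dv gp.
  apply: (part 1); first exact: measurable_maxr.
  by move=> x; rewrite le_max lexx orbT/= ge_max ler_norm normr_ge0.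
have Ln : L2 dv gn.
  apply: (part 1); first by apply: measurable_maxr => //; exact: measurableT_comp.
  by move=> x; rewrite le_max lexx orbT/= ge_max normr_ge0 andbT -normrN ler_norm.
have Kp : Kapprox u gp.
  apply: Kapprox_ge0 => // x; first by rewrite le_max lexx orbT.
  by move=> /gu; rewrite /gp => ->; rewrite maxxx.
have Kn : Kapprox u gn.
  apply: Kapprox_ge0 => // x; first by rewrite le_max lexx orbT.
  by move=> /gu; rewrite /gn => ->; rewrite oppr0 maxxx.
apply: Kapprox_ext (Kapprox_lin (-1) Kn Kp) => x.
by rewrite /gp /gn; case: (leP 0 (g x)) => g0; case: (leP 0 (- g x)) => g0'; lra.
Qed.

(** Totality provides a sequence with image tending to g, so [choose_or] does not return its
    default. The sequence is Cauchy for [lambda_dot C] because its images converge in L^2(dv) and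
    K^* is isometric. *)
Lemma Kstar_inv_spec (g : R -> R) : L2 dv (fun x : S => g x * indU x) ->
  let f := Kstar_inv C K dv u g in
  integrand_on C u f /\ cvgL2 dv (fun n => step_map Kt (f n)) (fun x : S => g x * indU x).
Proof.
move=> Lg f.
have Kg : Kapprox u (fun x : S => g x * indU x).
  apply: Kapprox_all => // x xu; rewrite /indU indicE memNset ?mulr0//.
  by move=> /= /[!inE]; apply/negP.
have [_ hg] := Kg.
have n0 n : 0 < n.+1%:R^-1 :> R by rewrite invr_gt0.
pose f0 n := sval (cid (hg _ (n0 n))).
have uf0 n : step_on u (f0 n) by rewrite /f0; case: cid => ? [].
have qf0 n : ip dv (fun x => step_map Kt (f0 n) x - g x * indU x)
    (fun x => step_map Kt (f0 n) x - g x * indU x) < n.+1%:R^-1.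
  by rewrite /f0; case: cid => ? [].
have cvgP' (h : nat -> step R) : (forall n, step_on u (h n)) ->
    Kstar_eq K dv u h g <-> cvgL2 dv (fun n => step_map Kt (h n)) (fun x : S => g x * indU x).
  move=> uh; rewrite -cvgL2P//; last by move=> n; exact: LK.
  rewrite /Kstar_eq.
  have Kt0 n (x : S) : x \notin `[0, u[ -> step_map Kt (h n) x = 0.
    move=> xu; rewrite /step_map big_seq big1// => p pf.
    rewrite /Kt indicE mem_setE; case: (boolP (x \in _)); last by rewrite !mulr0.
    rewrite in_itv/= => /andP[x0 xp]; move: xu; rewrite in_itv/= x0/= -leNgt => ux.
    have /andP[_ pr] := uh n p pf.
    by move: (le_trans pr ux); rewrite leNgt xp.
  rewrite (_ : (fun n => _) = (fun n => \int[dv]_x ((step_map Kt (h n) x - g x * indU x) ^+ 2)%:E)%E)//.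
  apply/funext => n; rewrite integral_mkcond; apply: eq_integral => x _; rewrite patchE mem_setE.
  case: ifPn => //= xu; last first.
    rewrite Kt0// /indU indicE memNset ?mulr0 ?subrr ?expr0n//.
    by move=> /=; exact/negP.
  by rewrite /indU indicE mem_set// mulr1.
have cf0 : cvgL2 dv (fun n => step_map Kt (f0 n)) (fun x : S => g x * indU x).
  apply: (@squeeze_cvgr _ _ _ _ (cst 0) (fun n => n.+1%:R^-1)).
  - by apply: nearW => n; rewrite ip_ge0/= ltW.
  - exact: cvg_cst.
  - exact: cvg_harmonic.
have ex : exists f, integrand_on C u f /\ Kstar_eq K dv u f g.
  exists f0; split; last exact/cvgP'.
  split => // e e0.
  have [n1 h1] := cvgL2_cauchy (fun n => LK (uf0 n)) Lg cf0 e0.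
  exists n1 => m n mn nn; have := h1 m n mn nn.
  have uT' : u <= T by case/andP: uT.
  by rewrite (ip_step_sub Kt_L2 Kt_ip)//; apply: step_onW uT' _.
have [[uf cf] Kf] := choose_orP (fun=> [::]) ex.
by split => //; apply/cvgP'.
Qed.

End approx.
End volterra.

(** * The closed linear span of a Gaussian process *)

Section trunc_exp.
Context {R : realType}.

(** Unlike e^x, its truncation at M is Lipschitz, so that its expectation is continuous along
    convergence in L^2. *)
Lemma trunc_expR_lip (M x y : R) : 0 <= M ->
  `|Num.min (expR x) M - Num.min (expR y) M| <= M * `|x - y|.
Proof.
move=> M0; wlog xy : x y / x <= y.
  move=> h; have [xy|/ltW yx] := leP x y; first exact: h.
  by rewrite distrC [`|x - y|]distrC; exact: h.
have exy : expR x <= expR y by rewrite ler_expR.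
rewrite distrC [`|x - y|]distrC !ger0_norm ?subr_ge0//; last first.
  by rewrite le_min !ge_min exy lexx orbT.
(* Here e^x = e^y e^(x-y) >= m (1 + x - y); the cases m = e^y and m = M are used. *)
have key (m : R) : 0 <= m -> m <= expR y -> m - expR x <= m * (y - x).
  move=> m0 my; have h := expR_ge1Dx (x - y).
  have e : expR x = expR y * expR (x - y) by rewrite -expRD addrC subrK.
  have : m * expR (x - y) <= expR x by rewrite e ler_wpM2r// expR_ge0.
  have : m * (1 + (x - y)) <= m * expR (x - y) by rewrite ler_wpM2l.
  by lra.
case: (leP (expR x) M) => xM; case: (leP (expR y) M) => yM.
- apply: le_trans (key _ (expR_ge0 y) (lexx _)) _.
  by rewrite ler_wpM2r// subr_ge0.
- exact: key M0 (ltW yM).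
- by move: (lt_le_trans xM exy); rewrite ltNge yM.
- by rewrite subrr mulr_ge0// subr_ge0.
Qed.

(** Where e^x exceeds M it is at most e^(2x)/M, so the mgf at 2 controls the mean truncation
    error. *)
Lemma trunc_expR_ge (M x : R) : 0 < M -> expR x - expR (2 * x) / M <= Num.min (expR x) M.
Proof.
move=> M0; have e : expR (2 * x) = expR x * expR x by rewrite mulr_natl mulr2n expRD.
have e0 := expR_gt0 x.
case: (leP (expR x) M) => xM.
  by rewrite lerBlDr lerDl divr_ge0// ?expR_ge0// ltW.
rewrite e; have : expR x <= expR x * expR x / M.
  by rewrite ler_pdivlMr// ler_pM2l// ltW.
by lra.
Qed.

End trunc_exp.

Section gaussian_closure.
Context {R : realType} {d : measure_display} {Omega : measurableType d}
  (P : probability Omega R) (T : R) (G : R -> {RV P >-> R}) (C : R -> R -> R).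
Hypothesis G_gauss : gaussian_process P T G.
Hypothesis G_L2 : forall t, 0 <= t <= T -> L2 P (G t).
Hypothesis G_ip : forall t s, 0 <= t <= T -> 0 <= s <= T -> ip P (G t) (G s) = C t s.
Hypothesis G_mean : forall t, 0 <= t <= T -> (\int[P]_w (G t w)%:E = 0)%E.

Implicit Types (W V : Omega -> R).

(** The Gaussian Hilbert space (first chaos) of G over [0, T]. *)
Definition gclosure (W : Omega -> R) : Prop :=
  L2 P W /\ exists f : nat -> step R, (forall n, step_on T (f n)) /\
    cvgL2 P (fun n => step_map G (f n)) W.

Let SI (f : step R) : Omega -> R := step_map G f.

Let SI_L2 f : step_on T f -> L2 P (SI f).
Proof. exact: (step_map_L2 G_L2). Qed.

Lemma gclosure_step f : step_on T f -> gclosure (SI f).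
Proof.
move=> fT; split; first exact: SI_L2.
by exists (fun=> f); split => //; exact: cvgL2_cst.
Qed.

Lemma gclosure_lin k W V : gclosure W -> gclosure V -> gclosure (fun w => k * W w + V w).
Proof.
move=> [LW [f [fT fW]]] [LV [g [gT gV]]]; split; first by apply: L2D => //; exact: L2Z.
exists (fun n => step_scale k (f n) ++ g n); split.
  by move=> n; apply: step_on_cat => //; exact: step_on_scale.
have Lf n := SI_L2 (fT n); have Lg n := SI_L2 (gT n).
have cN : cvgL2 P (fun n w => - k * SI (f n) w) (fun w => - k * W w).
  rewrite /cvgL2 (_ : (fun n => _) = (fun n =>
    k ^+ 2 * ip P (fun w => SI (f n) w - W w) (fun w => SI (f n) w - W w))).
    by rewrite -(mulr0 (k ^+ 2)); apply: cvgM => //; exact: cvg_cst.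
  apply/funext => n; have Ld := L2B (Lf n) LW.
  rewrite expr2 -mulrA -ipZr// -ipZl//; last exact: L2Z.
  by rewrite /ip; apply: eq_Rintegral => w _; ring.
have LkN n := L2Z (- k) (Lf n); have LkW := L2Z (- k) LW.
have := cvgL2B Lg LV LkN LkW gV cN.
rewrite /cvgL2; apply: cvg_trans; apply: near_eq_cvg; apply: nearW => n.
by apply: eq_ip => w; rewrite step_map_cat step_map_scale /SI; ring.
Qed.

Lemma step_mean0 f : step_on T f -> (\int[P]_w (SI f w)%:E = 0)%E.
Proof.
elim: f => [_|p f ih /step_on_cons[pT fT]].
  by rewrite /SI/step_map; under eq_integral do rewrite big_nil; rewrite integral0.
under eq_integral do rewrite /SI step_map_cons EFinD EFinM.
have ip_ := L2_finite_integrable (G_L2 pT); have if_ := L2_finite_integrable (SI_L2 fT).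
rewrite integralD//; last exact: (integrableZl measurableT _ ip_).
by rewrite integralZl// G_mean// mule0 add0e ih.
Qed.

Lemma step_mgf f a : step_on T f ->
  (\int[P]_w (expR (a * SI f w))%:E = (expR (a ^+ 2 * ip P (SI f) (SI f) / 2))%:E)%E.
Proof.
move=> fT; have [m [s2 [s20 law]]] := G_gauss fT.
have [mS iS] := SI_L2 fT.
have e : fine (\int[P]_w (SI f w ^+ 2)%:E)%E = ip P (SI f) (SI f).
  by rewrite /ip /Rintegral; congr fine; apply: eq_integral => w _; rewrite expr2.
rewrite -e; apply: (@centered_law_mgf _ _ _ P (SI f) mS m s2) => //.
- by move=> B mB; rewrite Phi_probE; exact: law.
- exact: step_mean0.
Qed.

Let int_expR W a q : measurable_fun setT W ->
  (\int[P]_w (expR (a * W w))%:E = q%:E)%E -> P.-integrable setT (fun w => (expR (a * W w))%:E).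
Proof. exact: mgf_integrable. Qed.

Let tr (M x : R) : R := Num.min (expR x) M.

Let tr_meas M W : measurable_fun setT W -> measurable_fun setT (fun w : Omega => tr M (W w)).
Proof.
move=> mW; apply: measurable_minr => //.
exact: measurableT_comp.
Qed.

Let tr_int M W : 0 <= M -> measurable_fun setT W ->
  P.-integrable setT (fun w => (tr M (W w))%:E).
Proof.
move=> M0 mW; have i1 : P.-integrable setT (fun w : Omega => M%:E).
  exact: finite_measure_integrable_cst.
apply: le_integrable i1 => //; first by apply/measurable_EFinP; exact: tr_meas.
move=> w _; rewrite !abse_EFin lee_fin !ger0_norm//.
  by rewrite /tr ge_min lexx orbT.
by rewrite /tr le_min expR_ge0.
Qed.

(** The Lipschitz bound leaves an L^1 distance, which Cauchy-Schwarz against the constant 1 bounds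
    by the L^2 distance. *)
Let tr_cvg M W (f : nat -> step R) : 0 <= M -> L2 P W -> (forall n, step_on T (f n)) ->
  cvgL2 P (fun n => SI (f n)) W ->
  (\int[P]_w tr M (SI (f n) w)) @[n --> \oo] --> (\int[P]_w tr M (W w)).
Proof.
move=> M0 LW fT fW; have Lf n := SI_L2 (fT n).
have mW : measurable_fun setT W by case: LW.
have mf n : measurable_fun setT (SI (f n)) by case: (Lf n).
have L1 : L2 P (cst 1).
  split => //; have := finite_measure_integrable_cst P 1 measurableT.
  by apply: eq_integrable => // w _ /=; rewrite expr1n.
have ip11 : ip P (cst 1) (cst 1) = 1.
  rewrite /ip /Rintegral; under eq_integral do rewrite mulr1.
  by rewrite (prob_integral_cst P 1).
have le1 n : `|(\int[P]_w tr M (W w)) - (\int[P]_w tr M (SI (f n) w))| <=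
    M * Num.sqrt (ip P (fun w => SI (f n) w - W w) (fun w => SI (f n) w - W w)).
  have Ld := L2B (Lf n) LW.
  have La : L2 P (fun w => `|SI (f n) w - W w|).
    case: Ld => md id_; split; first exact: measurableT_comp.
    rewrite (_ : (fun w => _) = fun w => ((SI (f n) w - W w) ^+ 2)%:E)//.
    by apply/funext => w; rewrite real_normK// num_real.
  rewrite -RintegralB//; [|exact: tr_int|exact: tr_int].
  apply: le_trans (le_normr_Rintegral _ _) _ => //.
    have := integrableB measurableT (tr_int M0 mW) (tr_int M0 (mf n)).
    by apply: eq_integrable.
  apply: (@le_trans _ _ (M * ip P (fun w => `|SI (f n) w - W w|) (cst 1))).
    rewrite -ipZl//; apply: le_Rintegral => //.
    - have := integrable_norm (integrableB measurableT (tr_int M0 mW) (tr_int M0 (mf n))).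
      by [].
    - by have := L2_mul (L2Z M La) L1.
    - by move=> w _; rewrite mulr1 [`|SI _ _ - _|]distrC; exact: trunc_expR_lip.
  apply: ler_wpM2l => //; rewrite -[leLHS]ger0_norm; last first.
    by apply: Rintegral_ge0 => w _; rewrite mulr1.
  rewrite -sqrtr_sqr; apply: ler_wsqrtr.
  apply: le_trans (cauchy_schwarz La L1) _; rewrite ip11 mulr1.
  rewrite /ip le_eqVlt; apply/orP; left; apply/eqP; apply: eq_Rintegral => w _.
  by rewrite -!expr2 real_normK// num_real.
have c : M * Num.sqrt (ip P (fun w => SI (f n) w - W w) (fun w => SI (f n) w - W w)) @[n --> \oo] --> 0.
  rewrite -(mulr0 M); apply: cvgM; first exact: cvg_cst.
  rewrite -[X in _ --> X]sqrtr0.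
  apply: (@continuous_cvg _ _ _ _ _ _ (@Num.sqrt R)); [exact: sqrt_continuous|exact: fW].
apply/cvgrPdist_le => e e0.
have /cvgrPdist_le/(_ _ e0) := c.
apply: filterS => n; rewrite sub0r normrN; apply: le_trans.
by apply: le_trans (le1 n) _; exact: ler_norm.
Qed.

(** Along the step functions, the mean of min(e^W, M) is caught between e^(s2/2) - e^(2 s2)/M and
    e^(s2/2); monotone convergence in M then removes the truncation. *)
Lemma gclosure_mgf1 W : gclosure W ->
  (\int[P]_w (expR (W w))%:E = (expR (ip P W W / 2))%:E)%E.
Proof.
move=> [LW [f [fT fW]]]; have Lf n := SI_L2 (fT n).
have mW : measurable_fun setT W by case: LW.
set s2 := ip P W W.
have cs : ip P (SI (f n)) (SI (f n)) @[n --> \oo] --> s2 by exact: cvgL2_ip2.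
have ce (k : R) : expR (k * ip P (SI (f n)) (SI (f n))) @[n --> \oo] --> expR (k * s2).
  apply: continuous_cvg; first exact: continuous_expR.
  by apply: cvgM => //; exact: cvg_cst.
have mgf n a : (\int[P]_w (expR (a * SI (f n) w))%:E =
    (expR (a ^+ 2 * ip P (SI (f n)) (SI (f n)) / 2))%:E)%E by exact: step_mgf.
have mf n : measurable_fun setT (SI (f n)) by case: (Lf n).
have int n a := int_expR (mf n) (mgf n a).
have Rmgf n a : \int[P]_w (expR (a * SI (f n) w)) = expR (a ^+ 2 * ip P (SI (f n)) (SI (f n)) / 2).
  by rewrite /Rintegral mgf.
have up (M : R) : 0 <= M -> \int[P]_w tr M (W w) <= expR (s2 / 2).
  move=> M0; have c := tr_cvg M0 LW fT fW.
  have c2 := ce 2^-1.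
  rewrite -(cvg_lim _ c)// [s2 / 2]mulrC -(cvg_lim _ c2)//.
  apply: ler_lim; [by apply: cvgP c|by apply: cvgP c2|apply: nearW => n].
  have := Rmgf n 1; rewrite expr1n mul1r [_ / 2]mulrC => <-.
  apply: le_Rintegral => //; first exact: tr_int.
    exact: int.
  by move=> w _; rewrite mul1r /tr ge_min lexx.
have lo (M : R) : 0 < M -> expR (s2 / 2) - expR (2 * s2) / M <= \int[P]_w tr M (W w).
  move=> M0; have c := tr_cvg (ltW M0) LW fT fW.
  have c2 : expR (2^-1 * ip P (SI (f n)) (SI (f n))) - expR (2 * ip P (SI (f n)) (SI (f n))) / M
      @[n --> \oo] --> expR (2^-1 * s2) - expR (2 * s2) / M.
    by apply: cvgB => //; apply: cvgM => //; exact: cvg_cst.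
  rewrite -(cvg_lim _ c)// [s2 / 2]mulrC -(cvg_lim _ c2)//.
  apply: ler_lim; [by apply: cvgP c2|by apply: cvgP c|apply: nearW => n].
  have e1 := Rmgf n 1; have e2 := Rmgf n 2.
  have -> : 2^-1 * ip P (SI (f n)) (SI (f n)) = 1 ^+ 2 * ip P (SI (f n)) (SI (f n)) / 2 by field.
  have -> : 2 * ip P (SI (f n)) (SI (f n)) = 2 ^+ 2 * ip P (SI (f n)) (SI (f n)) / 2 by field.
  rewrite -e1 -e2 -RintegralZr//; last exact: int.
  have i2 : P.-integrable setT (EFin \o (fun w => expR (2 * SI (f n) w) / M)).
    by have := integrableZr measurableT M^-1 (int n 2).
  rewrite -RintegralB//; last exact: int.
  apply: le_Rintegral => //.
  - by have := integrableB measurableT (int n 1) i2.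
  - exact: tr_int (ltW M0) _.
  - by move=> w _; rewrite mul1r; exact: trunc_expR_ge.
have m0 n : 0 < n.+1%:R :> R by rewrite ltr0n.
have ctr : \int[P]_w tr n.+1%:R (W w) @[n --> \oo] --> expR (s2 / 2).
  apply: (@squeeze_cvgr _ _ _ _ (fun n => expR (s2 / 2) - expR (2 * s2) / n.+1%:R) (cst (expR (s2 / 2)))).
  - by apply: nearW => n; rewrite lo//= up// ltW.
  - rewrite -[X in _ --> X]subr0 -[X in _ --> _ - X](mulr0 (expR (2 * s2))).
    apply: cvgB; first exact: cvg_cst.
    by apply: cvgM; [exact: cvg_cst|exact: cvg_harmonic].
  - exact: cvg_cst.
transitivity (limn (fun n => \int[P]_w (tr n.+1%:R (W w))%:E))%E; last first.
  apply/cvg_lim => //; rewrite (_ : (fun n => _) = EFin \o (fun n => \int[P]_w tr n.+1%:R (W w))).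
    by apply: cvg_EFin => //; exact: nearW.
  apply/funext => n /=; rewrite /Rintegral fineK//.
  by apply: integrable_fin_num => //; exact: tr_int (ltW (m0 n)) mW.
rewrite -monotone_convergence//.
- apply: eq_integral => w _; apply/esym/cvg_lim => //.
  apply: cvg_EFin; first exact: nearW.
  apply: (@cvg_trans _ (cst (expR (W w)) @ \oo)); last exact: cvg_cst.
  apply: near_eq_cvg; near=> n; rewrite /= /tr; apply/esym/min_idPl.
  have : expR (W w) <= n%:R by near: n; exact: nbhs_infty_ger.
  by move/le_trans; apply; rewrite ler_nat.
- by move=> n; apply/measurable_EFinP; exact: tr_meas.
- by move=> n w _; rewrite lee_fin /tr le_min expR_ge0 ltW.
- move=> w _ m n mn; rewrite lee_fin /tr le_min ge_min lexx/= ge_min.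
  by rewrite ler_nat ltnS mn orbT.
Unshelve. all: by end_near. Qed.

End gaussian_closure.

(** * Orthogonality and independence in the Gaussian closure *)

Section gaussian_indep.
Context {R : realType} {d : measure_display} {Omega : measurableType d}
  (P : probability Omega R) (T : R) (G : R -> {RV P >-> R}) (C : R -> R -> R).
Hypothesis G_gauss : gaussian_process P T G.
Hypothesis G_L2 : forall t, 0 <= t <= T -> L2 P (G t).
Hypothesis G_ip : forall t s, 0 <= t <= T -> 0 <= s <= T -> ip P (G t) (G s) = C t s.
Hypothesis G_mean : forall t, 0 <= t <= T -> (\int[P]_w (G t w)%:E = 0)%E.
Implicit Types (W V U : Omega -> R).

Let gcl := gclosure T G.

Let mgf1 W : gcl W -> (\int[P]_w (expR (W w))%:E = (expR (ip P W W / 2))%:E)%E.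
Proof. exact: gclosure_mgf1. Qed.

Lemma gclosure0 : gcl (fun=> 0).
Proof.
have h : step_on T [::] by [].
have := gclosure_step G_L2 h.
rewrite (_ : step_map _ _ = fun=> 0); first by apply.
by apply/funext => w; rewrite /step_map big_nil.
Qed.

Lemma gclosureZ a W : gcl W -> gcl (fun w => a * W w).
Proof.
move=> gW; have := gclosure_lin G_L2 a gW gclosure0.
by rewrite (_ : (fun w => _ + 0) = fun w => a * W w)//; apply/funext => w; rewrite addr0.
Qed.

Lemma gclosureD W V : gcl W -> gcl V -> gcl (fun w => W w + V w).
Proof.
move=> gW gV; have := gclosure_lin G_L2 1 gW gV.
by rewrite (_ : (fun w => _ + _) = fun w => W w + V w)//; apply/funext => w; rewrite mul1r.
Qed.

Lemma gclosure_process t : 0 <= t <= T -> gcl (G t).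
Proof.
move=> tT; have h : step_on T [:: (1, t)] by apply: step_on_consP.
have := gclosure_step G_L2 h.
rewrite (_ : step_map _ _ = G t); first by apply.
by apply/funext => w; rewrite step_map_cons /step_map big_nil mul1r addr0.
Qed.

Lemma gclosure_mgf W a : gcl W ->
  (\int[P]_w (expR (a * W w))%:E = (expR (a ^+ 2 * ip P W W / 2))%:E)%E.
Proof.
move=> gW; have [LW _] := gW; rewrite (mgf1 (gclosureZ a gW)) ipZl//; last exact: L2Z.
by rewrite ipZr// mulrA -expr2.
Qed.

Lemma gclosure_mean W : gcl W -> (\int[P]_w (W w)%:E = 0)%E.
Proof.
move=> gW; have [[mW _] _] := gW.
apply: (@mean_of_mgf _ _ _ P W mW 0 (ip P W W)) => a.
by rewrite mulr0 add0r gclosure_mgf.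
Qed.

Lemma gclosure_law W : gcl W -> forall B, measurable B ->
  P (W @^-1` B) = Phi_prob 0 (ip P W W) B.
Proof.
move=> gW; have [[mW _] _] := gW; apply: law_of_mgf => //; first exact: ip_ge0.
by move=> a; exact: gclosure_mgf.
Qed.

Section indep.
Variables (u : R) (U : Omega -> R).
Hypotheses (u0T : 0 <= u <= T) (gU : gcl U).
Hypothesis U_orth : forall r, 0 <= r <= u -> ip P U (G r) = 0.

Let SI (f : step R) : Omega -> R := step_map G f.

Let uT f : step_on u f -> step_on T f.
Proof. by apply: step_onW; case/andP: u0T. Qed.

Let gSI f : step_on u f -> gcl (SI f).
Proof. by move=> uf; apply: gclosure_step => //; exact: uT. Qed.

Let mU : measurable_fun setT U. Proof. by case: gU => -[]. Qed.
Let mSI f : step_on u f -> measurable_fun setT (SI f).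
Proof. by move=> /gSI[[]]. Qed.

Let U_SI f : step_on u f -> ip P U (SI f) = 0.
Proof.
move=> uf; have LU : L2 P U by case: gU.
rewrite ipC (ip_step_mapl G_L2 (uT uf) LU) big_seq big1// => p /uf pu.
by rewrite ipC U_orth// mulr0.
Qed.

Let mexpR a W : measurable_fun setT W -> measurable_fun setT (fun w => expR (a * W w)).
Proof. by move=> mW; apply: measurableT_comp => //; exact: measurable_funM. Qed.

Let int_expR W a : gcl W -> P.-integrable setT (fun w => (expR (a * W w))%:E).
Proof.
by move=> gW; have [[mW _] _] := gW; exact: mgf_integrable mW (gclosure_mgf a gW).
Qed.

Let int_expR1 W : gcl W -> P.-integrable setT (fun w => (expR (W w))%:E).
Proof.
move=> gW; have := int_expR 1 gW; apply: eq_integrable => // w _.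
by rewrite mul1r.
Qed.

Let int_ind W (A : set Omega) : gcl W -> measurable A ->
  P.-integrable setT (fun w => (\1_A w * expR (W w))%:E).
Proof.
move=> gW mA; have [[mW _] _] := gW; apply: le_integrable (int_expR1 gW) => //.
  apply/measurable_EFinP/measurable_funM => //.
  exact: measurableT_comp.
move=> w _; rewrite !abse_EFin lee_fin normrM ler_piMl// indicE.
by case: (_ \in _); rewrite ?normr1 ?normr0.
Qed.

Let preim (V : {RV P >-> R}) (B : set R) : measurable B -> measurable (V @^-1` B).
Proof. by move=> mB; rewrite -[X in measurable X]setTI; exact: measurable_funP. Qed.

Let preimU (B : set R) : measurable B -> measurable (U @^-1` B).
Proof. by move=> mB; rewrite -[X in measurable X]setTI; exact: mU. Qed.

Let cyl_meas l : cyl_on `[0, u] measurable l -> measurable (cyl (G : R -> Omega -> R) l).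
Proof.
elim: l => [|p l ih [_ mp lP]]; first by rewrite cyl_nil.
by rewrite cyl_cons; apply: measurableI; [exact: preim|exact: ih].
Qed.

(* One coordinate of the joint law is identified at a time: exponentials in the
   remaining coordinates keep all the integrands nonnegative, so that the
   one-dimensional uniqueness theorem for weighted mgfs applies. *)
Let indep_cyl (B : set R) : measurable B -> forall l, cyl_on `[0, u] measurable l ->
  forall f, step_on u f ->
  (\int[P]_w (\1_(U @^-1` B `&` cyl (G : R -> Omega -> R) l) w * expR (SI f w))%:E =
   P (U @^-1` B) * \int[P]_w (\1_(cyl (G : R -> Omega -> R) l) w * expR (SI f w))%:E)%E.
Proof.
move=> mB; have mUB := preimU mB.
have PB : P (U @^-1` B) \is a fin_num by exact: fin_num_measure.
elim => [_ f uf|[r D] l ih [ru mD lP] f uf].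
  rewrite cyl_nil setIT; have gf := gSI uf.
  pose c := expR (ip P (SI f) (SI f) / 2).
  have -> : (\int[P]_w (\1_(setT : set Omega) w * expR (SI f w))%:E = c%:E)%E.
    by rewrite -mgf1//; apply: eq_integral => w _; rewrite indicT mul1r.
  transitivity (\int[P]_w (\1_B (U w) * c)%:E)%E; last first.
    under eq_integral do rewrite EFinM muleC.
    rewrite integralZl//; last by have := integrable_indic P mUB.
    have -> : (\int[P]_w (\1_B (U w))%:E = \int[P]_w (\1_(U @^-1` B) w)%:E)%E by [].
    by rewrite integral_indic// setIT muleC.
  (* The exponent lies in the Gaussian closure and orthogonality removes the cross term of its
     variance, so the mgf factors. *)
  have e a : (\int[P]_w (expR (a * U w) * expR (SI f w))%:E =
      (expR (a ^+ 2 * ip P U U / 2) * c)%:E)%E.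
    under eq_integral do rewrite -expRD.
    have gUa := gclosureZ a gU; have [LU _] := gU; have [Lf _] := gf.
    have [LUa _] := gUa.
    rewrite mgf1; last exact: gclosureD.
    rewrite -expRD; congr (expR _)%:E.
    have Ls := L2D LUa Lf.
    rewrite ipDl// !ipDr// !ipZl// !ipZr// (ipC P (SI f) U) U_SI//.
    by field.
  transitivity (\int[P]_w (\1_B (U w) * expR (SI f w))%:E)%E; first by [].
  apply: mgf_weight_unique => //.
  - by apply: measurableT_comp => //; exact: mSI.
  - move=> a; have := int_expR1 (gclosureD (gclosureZ a gU) gf).
    by apply: eq_integrable => // w _; rewrite expRD.
  - move=> a; have := integrableZr measurableT c (int_expR a gU).
    by [].
  - move=> a; rewrite e; under eq_integral do rewrite EFinM.
    rewrite integralZr; [|by []|exact: int_expR].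
    by rewrite gclosure_mgf.
rewrite /= in ru mD; rewrite cyl_cons/=.
have mc := cyl_meas lP.
set L := cyl _ l in ih mc *.
have ur : 0 <= r <= u by [].
have mGr : measurable_fun setT (G r) by exact: measurable_funP.
have gf := gSI uf.
have mSf := mSI uf.
have gr : gcl (G r).
  by apply: gclosure_process; move: ur u0T => /andP[-> /le_trans h] /andP[_ /h].
have e a : (\int[P]_w (expR (a * G r w) * (\1_(U @^-1` B `&` L) w * expR (SI f w)))%:E =
    \int[P]_w (expR (a * G r w) * (fine (P (U @^-1` B)) * (\1_L w * expR (SI f w))))%:E)%E.
  (* The induction hypothesis is used with a G_r added to the exponent: the new coordinate enters
     through its exponentials before uniqueness replaces them by an indicator. *)
  have uaf : step_on u ((a, r) :: f) by exact: step_on_consP.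
  have := ih lP ((a, r) :: f) uaf.
  have eE A w : \1_A w * expR (SI ((a, r) :: f) w) = expR (a * G r w) * (\1_A w * expR (SI f w)) :> R.
    by rewrite /SI step_map_cons expRD; ring.
  under eq_integral do rewrite eE.
  move=> ->; rewrite -[X in (X * _)%E](fineK PB) -integralZl//; last first.
    by apply: int_ind => //; exact: gSI.
  by apply: eq_integral => w _; rewrite eE -EFinM; congr EFin; ring.
have intA a (A : set Omega) : measurable A ->
    P.-integrable setT (fun w => (expR (a * G r w) * (\1_A w * expR (SI f w)))%:E).
  move=> mA; have := int_ind (gclosureD (gclosureZ a gr) gf) mA.
  by apply: eq_integrable => // w _; rewrite expRD; congr EFin; ring.
have mY A : measurable A -> measurable_fun setT (fun w => \1_A w * expR (SI f w) : R).
  by move=> mA; apply: measurable_funM => //; exact: measurableT_comp.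
have := @mgf_weight_unique _ _ _ _ _ P P (G r) (fun w => \1_(U @^-1` B `&` L) w * expR (SI f w))
  (G r) (fun w => fine (P (U @^-1` B)) * (\1_L w * expR (SI f w))) mGr
  (mY _ (measurableI _ _ mUB mc)) mGr
  (measurable_funM (measurable_cst _) (mY _ mc))
  (fun a => intA a _ (measurableI _ _ mUB mc)) _ e D mD.
have -> : (\int[P]_x (\1_D (G r x) * (\1_(U @^-1` B `&` L) x * expR (SI f x)))%:E =
    \int[P]_w (\1_(U @^-1` B `&` (G r @^-1` D `&` L)) w * expR (SI f w))%:E)%E.
  apply: eq_integral => w _; rewrite !indicI/= mulrA; congr (_ * _)%:E.
  by rewrite mulrCA.
have -> : (\int[P]_x (\1_D (G r x) * (fine (P (U @^-1` B)) * (\1_L x * expR (SI f x))))%:E =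
    P (U @^-1` B) * \int[P]_w (\1_(G r @^-1` D `&` L) w * expR (SI f w))%:E)%E.
  rewrite -[X in (X * _)%E](fineK PB) -integralZl//; last first.
    by apply: int_ind => //; apply: measurableI => //; exact: preim.
  apply: eq_integral => w _; rewrite indicI/= -EFinM; congr EFin.
  by rewrite [\1_D (G r w)]/(\1_(G r @^-1` D) w); ring.
apply => a.
have := integrableZl measurableT (fine (P (U @^-1` B))) (intA a _ mc).
by apply: eq_integrable => // w _; rewrite -EFinM; congr EFin; ring.
Qed.

Lemma gclosure_indep (B : set R) (A : set Omega) : measurable B ->
  natural_filtration G u A -> P (U @^-1` B `&` A) = (P (U @^-1` B) * P A)%E.
Proof.
move=> mB; apply: (indep_sigma_gen (Y := G : R -> Omega -> R)).
- by move=> r _; exact: measurable_funP.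
- exact: preimU.
- move=> l lP; have mc := cyl_meas lP.
  have := indep_cyl mB lP (f := [::]) _.
  have e (D : set Omega) : measurable D ->
      (\int[P]_w (\1_D w * expR (SI [::] w))%:E = P D)%E.
    move=> mD; transitivity (\int[P]_w (\1_D w)%:E)%E.
      by apply: eq_integral => w _; rewrite /SI/step_map big_nil expR0 mulr1.
    by rewrite integral_indic// setIT.
  rewrite !e//; first by apply.
  by apply: measurableI => //; exact: preimU.
Qed.

End indep.

(** * Versions of the Wiener integral *)

Section wiener.
Variables (u : R) (f : nat -> step R).
Hypotheses (u0T : 0 <= u <= T) (fu : integrand_on C u f).

Let fT n : step_on T (f n).
Proof. by case: fu => h _; apply: step_onW (h n); case/andP: u0T. Qed.

Let Lf n : L2 P (step_map G (f n)).
Proof. exact: (step_map_L2 G_L2). Qed.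

(** Step sums built from [G'] are measurable for the given sigma-algebra and almost surely those of
    [G]; completeness of L^2 over that sigma-algebra yields the limit. The cases in view are the
    ambient sigma-algebra, F^G_u, and F^X_u with [G'] recovered from the path of X. *)
Lemma wiener_version (Gs : set (set Omega)) (G' : R -> g_sigma_algebraType Gs -> R) :
  <<s Gs >> `<=` measurable ->
  (forall r, 0 <= r <= u -> measurable_fun setT (G' r)) ->
  (forall r, 0 <= r <= u -> {ae P, forall w, G r w = G' r w}) ->
  exists Z : g_sigma_algebraType Gs -> R, [/\ measurable_fun setT Z, L2 P Z &
    cvgL2 P (fun n => step_map G (f n)) Z].
Proof.
move=> Gm mG' GG'.
pose z n : Omega -> R := step_map G' (f n).
have mz n : measurable_fun setT (z n : g_sigma_algebraType Gs -> R).
  have [h _] := fu; have := h n; rewrite /z; elim: (f n) => [_|p g ih /step_on_cons[pu gu]].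
    rewrite (_ : step_map _ _ = cst 0); first exact: measurable_cst.
    by apply/funext => w; rewrite /step_map big_nil.
  rewrite (_ : step_map _ _ = fun w => p.1 * G' p.2 w + step_map G' g w).
    by apply: measurable_funD; [apply: measurable_funM => //; exact: mG'|exact: ih].
  by apply/funext => w; rewrite step_map_cons.
have zE n : {ae P, forall w, step_map G (f n) w = z n w}.
  have [h _] := fu; have := h n; rewrite /z; elim: (f n) => [_|p g ih /step_on_cons[pu gu]].
    by apply: aeW => w; rewrite /step_map !big_nil.
  have := ih gu; have := GG' _ pu; apply: filterS2 => w e1 e2.
  by rewrite !step_map_cons e1 e2.
have mz' n : measurable_fun setT (z n) := sub_measurable_fun Gm (mz n).
have Lz n : L2 P (z n) by exact: L2_ae (Lf n) (mz' n) (zE n).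
have ipz m n : ip P (fun w => z m w - z n w) (fun w => z m w - z n w) =
    lambda_dot C (step_sub (f m) (f n)) (step_sub (f m) (f n)).
  rewrite -(ip_step_sub G_L2 G_ip (@fT m) (@fT n)) /ip /Rintegral; congr fine.
  have [m1 _] := L2B (Lz m) (Lz n); have [m2 _] := L2B (Lf m) (Lf n).
  apply: ae_eq_integral => //.
  - by apply/measurable_EFinP; exact: measurable_funM.
  - by apply/measurable_EFinP; exact: measurable_funM.
  - by have := zE m; have := zE n; apply: filterS2 => w e1 e2 _; rewrite e1 e2.
have cz e : 0 < e -> exists n0, forall m n, (n0 <= m)%N -> (n0 <= n)%N ->
    ip P (fun w => z m w - z n w) (fun w => z m w - z n w) < e.
  move=> e0; have [_ h] := fu; have [n0 hn0] := h _ e0; exists n0 => m n mm nn.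
  by rewrite ipz; exact: hn0.
have [Z [mZ LZ cZ]] := L2_complete Gm mz Lz cz.
exists Z; split => //.
move: cZ; rewrite /cvgL2; apply: cvg_trans; apply: near_eq_cvg; apply: nearW => n.
rewrite /ip /Rintegral; congr fine.
have [m1 _] := L2B (Lz n) LZ; have [m2 _] := L2B (Lf n) LZ.
apply: ae_eq_integral => //.
- by apply/measurable_EFinP; exact: measurable_funM.
- by apply/measurable_EFinP; exact: measurable_funM.
- by apply: filterS (zE n) => w e _; rewrite e.
Qed.

Let I := wiener_integral P G f.

Lemma wiener_spec : L2 P I /\ cvgL2 P (fun n => step_map G (f n)) I.
Proof.
have Gm : <<s @measurable _ Omega >> `<=` measurable.
  by apply: smallest_sub => //; exact: sigma_algebra_measurable.
have mG r : 0 <= r <= u -> measurable_fun setT (G r : g_sigma_algebraType measurable -> R).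
  move=> _ _ B mB; rewrite setTI; apply: sub_sigma_algebra.
  by rewrite -[X in measurable X]setTI; exact: measurable_funP.
have [Z [mZ LZ cZ]] := wiener_version Gm mG (fun r _ => aeW _ (fun w => erefl)).
have ex : exists Z, is_wiener_integral P G f Z.
  exists Z; split; first by case: LZ.
  exact/(cvgL2P Lf LZ).
have [mI cI] := choose_orP (fun=> 0) ex.
have LI : L2 P I.
  (* [is_wiener_integral] asks for measurability only. Square-integrability follows because
     distances that tend to 0 in the extended reals are eventually finite. *)
  have [n] : exists n, (\int[P]_w ((step_map G (f n) w - I w) ^+ 2)%:E < +oo)%E.
    have /fine_cvgP[h _] := cI.
    case: h => n _ /(_ n (leqnn n)) h; exists n.
    by rewrite -ge0_fin_numE//; apply: integral_ge0 => w _; rewrite lee_fin sqr_ge0.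
  move=> fin; have [mfn _] := Lf n.
  have Ld : L2 P (fun w => step_map G (f n) w - I w).
    split; first exact: measurable_funB.
    apply/integrableP; split.
      by apply/measurable_EFinP/measurable_funX; exact: measurable_funB.
    by under eq_integral do rewrite abse_EFin ger0_norm ?sqr_ge0//.
  have := L2B (Lf n) Ld.
  by under eq_fun do rewrite subKr.
by split => //; apply/(cvgL2P Lf LI).
Qed.

Lemma wiener_ae Z : L2 P Z -> cvgL2 P (fun n => step_map G (f n)) Z ->
  {ae P, forall w, I w = Z w}.
Proof.
by move=> LZ cZ; have [LI cI] := wiener_spec; exact: cvgL2_unique Lf LI LZ cI cZ.
Qed.

End wiener.
End gaussian_indep.

(** * Second moments under independence *)

Section indep_L2.
Context {R : realType} {d : measure_display} {Omega : measurableType d}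
  (P : probability Omega R).
Implicit Types (f g c D : Omega -> R).

Definition indep_rv (F : set (set Omega)) D : Prop :=
  forall A B, F A -> measurable B -> P (A `&` D @^-1` B) = (P A * P (D @^-1` B))%E.

Lemma L2_cst k : L2 P (fun=> k).
Proof.
split => //; exact: finite_measure_integrable_cst.
Qed.

Lemma ip_cst k l : ip P (fun=> k) (fun=> l) = k * l.
Proof. by rewrite /ip /Rintegral prob_integral_cst. Qed.

Lemma ip1r f : ip P f (fun=> 1) = \int[P]_w f w.
Proof. by apply: eq_Rintegral => w _; rewrite mulr1. Qed.

Lemma ip_cstr f k : L2 P f -> ip P f (fun=> k) = k * \int[P]_w f w.
Proof.
move=> Lf; rewrite -ip1r -(ipZr k (L2_cst 1) Lf).
by apply: eq_Rintegral => w _; rewrite mulr1.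
Qed.

Lemma ip_sqrD f g : L2 P f -> L2 P g ->
  ip P (fun w => f w + g w) (fun w => f w + g w) = ip P f f + 2 * ip P f g + ip P g g.
Proof.
move=> Lf Lg; have Ls := L2D Lf Lg.
by rewrite ipDl// !ipDr// (ipC P g f); ring.
Qed.

Variables (Gs : set (set Omega)).
Hypothesis Gm : <<s Gs >> `<=` measurable.

(** The mixed moment is read off the expansion of the mean of (c + D)^2, whose integrand is
    nonnegative, so that Tonelli suffices. *)
Lemma indep_ip (c : g_sigma_algebraType Gs -> R) D :
  measurable_fun setT c -> L2 P c -> L2 P D -> indep_rv <<s Gs >> D ->
  ip P c D = (\int[P]_w c w) * (\int[P]_w D w).
Proof.
move=> mc Lc LD ind; have [mD _] := LD.
pose X : {RV P >-> R} := HB.pack D (isMeasurableFun.Build _ _ _ _ _ mD).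
have ind' A B : <<s Gs >> A -> measurable B -> P (A `&` D @^-1` B) = (P A * distribution P X B)%E.
  by move=> FA mB; rewrite ind.
have L1 k := L2_cst k.
set m := \int[P]_w D w; set q := ip P D D.
(* Integrating D out amounts to replacing it by its mean m and adding its variance q - m^2. *)
have inner a : (\int[distribution P X]_y ((a + y) ^+ 2)%:E = ((a + m) ^+ 2 + (q - m ^+ 2))%:E)%E.
  have ms : measurable_fun setT (fun y : R => ((a + y) ^+ 2)%:E).
    by apply/measurable_EFinP/measurable_funX/measurable_funD.
  rewrite (ge0_integral_distribution X ms); last by move=> y; rewrite lee_fin sqr_ge0.
  rewrite /comp; under eq_integral do rewrite expr2.
  have La := L2D (L1 a) LD.
  rewrite -(ipE La La) ip_sqrD// ip_cst; congr EFin.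
  by rewrite (ipC _ (fun=> a)) ip_cstr// -/m -/q; ring.
have mh : measurable_fun setT (fun z : (g_sigma_algebraType Gs * R)%type => ((c z.1 + z.2) ^+ 2)%:E).
  by apply/measurable_EFinP/measurable_funX/measurable_funD => //; exact: measurableT_comp.
have := indep_integral Gm mD ind' mh.
move=> /(_ (fun z => _)) => e.
have {}e : (\int[P]_w ((c w + D w) ^+ 2)%:E =
    \int[P]_w ((c w + m) ^+ 2 + (q - m ^+ 2))%:E)%E.
  rewrite e; last by move=> z; rewrite lee_fin sqr_ge0.
  by apply: eq_integral => w _; exact: (inner (c w)).
have Lm := L2D Lc (L1 m).
have LcD := L2D Lc LD.
have e2 : ip P (fun w => c w + D w) (fun w => c w + D w) =
    ip P (fun w => c w + m) (fun w => c w + m) + (q - m ^+ 2).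
  apply: EFin_inj; rewrite (ipE LcD LcD).
  under eq_integral do rewrite -expr2.
  rewrite e; under eq_integral do rewrite EFinD.
  rewrite integralD//; last 2 first.
  - by have [] := Lm.
  - exact: finite_measure_integrable_cst.
  rewrite prob_integral_cst [in RHS]EFinD; congr (_ + _)%E.
  by apply/esym; under eq_integral do rewrite expr2; rewrite -(ipE Lm Lm).
move: e2; rewrite !ip_sqrD// ip_cst.
rewrite ip_cstr// -/q; lra.
Qed.

End indep_L2.

Section raw_integral.
Context {R : realType} {d : measure_display} {T : measurableType d}.
Local Open Scope ereal_scope.

Import HBNNSimple.

(* A set function that is not literally a measure can still be integrated
   against: only its values on measurable sets matter. *)
Lemma raw_integral_ext (mu nu : set T -> \bar R) D (f : T -> \bar R) :
  (forall A, measurable A -> mu A = nu A) -> \int[mu]_(x in D) f x = \int[nu]_(x in D) f x.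
Proof.
move=> mn.
have h (g : {nnsfun T >-> R}) : sintegral mu g = sintegral nu g.
  by apply: eq_fsbigr => x _; rewrite mn//; exact: measurable_sfunP.
by rewrite /integral; congr (ereal_sup _ - ereal_sup _); apply: eq_imagel => g _; exact: h.
Qed.
End raw_integral.

Section split.
Context {R : realType} {d : measure_display} {Omega : measurableType d}
  (P : probability Omega R).
Local Open Scope ereal_scope.

Lemma prob_split (V : Omega -> nat) E : measurable_fun setT V -> measurable E ->
  P E = \sum_(0 <= n <oo) P (E `&` [set w | V w = n]).
Proof.
move=> mV mE.
have mn n : measurable [set w | V w = n].
  by have := mV measurableT [set n] (I : measurable [set n]); rewrite setTI.
have mEn n : measurable (E `&` [set w | V w = n]) by exact: measurableI.
have e : \bigcup_n (E `&` [set w | V w = n]) = E.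
  by apply/seteqP; split => [w [n _ []]//|w Ew]; exists (V w).
rewrite -measure_semi_bigcup ?e//.
by move=> i j _ _ [w [[_ /= <-] [_ /=]]].
Qed.
End split.

(** * Poisson weights *)

Section poisson_series.
Context {R : realType} (r : R).
Hypothesis r0 : (0 <= r)%R.
Local Open Scope ereal_scope.
Local Notation w n := (poisson_weight r n).

Lemma poisson_weight_ge0 n : (0 <= w n)%R.
Proof. by rewrite /poisson_weight divr_ge0// mulr_ge0// ?expR_ge0// exprn_ge0. Qed.

(** The recursion evaluates the factorial moments by a shift of the index, with series of
    nonnegative terms throughout. *)
Lemma poisson_weightS n : (n.+1%:R * w n.+1 = r * w n)%R.
Proof.
have /divff h : (n.+1%:R != 0 :> R)%R by rewrite pnatr_eq0.
rewrite /poisson_weight factS natrM invfM exprS.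
set a := (n.+1%:R)%R in h *; set b := (n`!%:R^-1)%R.
transitivity ((a / a) * (r * (expR (- r) * r ^+ n * b)))%R; first by ring.
by rewrite h mul1r.
Qed.

Lemma sum_poisson_weight : \sum_(0 <= n <oo) (w n)%:E = 1.
Proof.
rewrite [RHS](_ : _ = (expR (- r))%:E * (expR r)%:E); last first.
  by rewrite -EFinM expRN mulVf ?gt_eqF ?expR_gt0.
rewrite (_ : (fun n => _) = fun n => (expR (- r))%:E * \sum_(0 <= k < n) (exp_coeff r k)%:E); last first.
  apply/funext => n; rewrite ge0_sume_distrr; last first.
    by move=> i _; rewrite lee_fin exp_coeff_ge0.
  by apply: eq_bigr => i _; rewrite -EFinM /poisson_weight exp_coeffE -mulrA (mulrC (r ^+ _)%R).
apply/cvg_lim => //; apply: cvgeZl => //.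
have -> : (fun n => \sum_(0 <= k < n) (exp_coeff r k)%:E) = EFin \o series (exp_coeff r).
  by apply/funext => n; rewrite /= /series /= sumEFin.
apply: cvg_EFin; first by apply: nearW.
exact: is_cvg_series_exp_coeff.
Qed.

Lemma sum_poisson_weight1 : \sum_(0 <= n <oo) (w n * n%:R)%:E = r%:E.
Proof.
rewrite nneseries_recl//; last first.
  by move=> n _; rewrite lee_fin mulr_ge0// poisson_weight_ge0.
rewrite mulr0 add0e -nneseries_addn//=; last first.
  by move=> n ; rewrite lee_fin mulr_ge0// poisson_weight_ge0.
under eq_eseriesr do rewrite addn1 mulrC poisson_weightS EFinM.
rewrite nneseriesZl ?sum_poisson_weight ?mule1//.
by move=> n _; rewrite lee_fin poisson_weight_ge0.
Qed.

Lemma sum_poisson_weight2 : \sum_(0 <= n <oo) (w n * (n%:R * (n%:R - 1)))%:E = (r ^+ 2)%:E.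
Proof.
have h n : (0 <= w n * (n%:R * (n%:R - 1)))%R.
  case: n => [|n]; first by rewrite mul0r mulr0.
  by rewrite mulr_ge0// ?poisson_weight_ge0// mulr_ge0// subr_ge0 ler1n.
rewrite nneseries_recl//; last by move=> n _; rewrite lee_fin h.
rewrite mul0r mulr0 add0e -nneseries_addn//=.
have e n : (w n.+1 * (n.+1%:R * (n.+1%:R - 1)) = r * (w n * n%:R))%R.
  transitivity ((n.+1%:R * w n.+1) * (n.+1%:R - 1))%R; first by ring.
  by rewrite poisson_weightS -natr1 addrK mulrA.
under eq_eseriesr do rewrite addn1 e EFinM.
by rewrite nneseriesZl ?sum_poisson_weight1//; move=> n _; rewrite lee_fin mulr_ge0// poisson_weight_ge0.
Qed.
End poisson_series.

(** * Compound Poisson processes *)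

Section law.
Context {R : realType} {d : measure_display} {Omega : measurableType d}
  (P : probability Omega R).

Definition law (D : Omega -> R) (mD : measurable_fun setT D) : probability R R :=
  distribution P (HB.pack_for {RV P >-> R} D (isMeasurableFun.Build _ _ _ _ D mD)).

Lemma lawE D (mD : measurable_fun setT D) B : law mD B = P (D @^-1` B).
Proof. by []. Qed.

Lemma ge0_integral_law D (mD : measurable_fun setT D) (f : R -> \bar R) :
  measurable_fun setT f -> (forall y, (0 <= f y)%E) ->
  (\int[law mD]_y f y = \int[P]_w f (D w))%E.
Proof. by move=> mf f0; rewrite ge0_integral_distribution. Qed.

Lemma ae_eq_prob A B : measurable A -> measurable B ->
  {ae P, forall w, A w <-> B w} -> P A = P B.
Proof.
move=> mA mB h; rewrite -(setIT A) -(setIT B) -!integral_indic//.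
apply: ae_eq_integral => //; [exact/measurable_EFinP|exact/measurable_EFinP|].
apply: filterS h => w [h1 h2] _; rewrite !indicE (_ : (w \in A) = (w \in B))//.
by apply/idP/idP => /set_mem ?; apply/mem_set; [exact: h1|exact: h2].
Qed.

End law.

Section generators.
Context {Omega : Type} {I : Type} {d' : measure_display} {E : measurableType d'}.

(* [sigma_gen D Y] is [<<s gen D Y >>]; the generators are named so that functions
   can be declared measurable on [g_sigma_algebraType (gen D Y)]. *)
Definition gen (D : set I) (Y : I -> Omega -> E) : set (set Omega) :=
  \bigcup_(i in D) preimage_set_system setT (Y i) measurable.

End generators.

Lemma sigma_gen_fun (d : measure_display) (Omega : measurableType d) (I : Type)
    (d' : measure_display) (E : measurableType d') (D : set I) (Y : I -> Omega -> E) i :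
  D i -> measurable_fun setT (Y i : g_sigma_algebraType (gen D Y) -> E).
Proof. by move=> Di _ B mB; rewrite setTI; exact: sigma_gen_preimage. Qed.

Section translate.
Context {R : realType}.
Implicit Types (B : set R).

(** Turns the direct image in [translate] into a preimage, for which measurability is at hand. *)
Lemma translate_set (F : set R -> \bar R) y B : translate F y B = F [set x | B (y + x)].
Proof.
rewrite /translate; congr F; apply/seteqP; split => [_ [x Bx <-]|x /= Bx].
  by rewrite /= addrC subrK.
by exists (y + x) => //; rewrite addrC addKr.
Qed.

Lemma measurable_translate_set y B : measurable B -> measurable [set x | B (y + x)].
Proof.
move=> mB; have : measurable_fun setT (fun x : R => y + x) by exact: measurable_funD.
by move=> /(_ measurableT _ mB); rewrite setTI.
Qed.

(** The function is the section integral of the indicator of the pairs (y, x) with y + x in B, to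
    which Tonelli measurability applies. *)
Lemma measurable_translate (F : probability R R) B : measurable B ->
  measurable_fun setT (fun y : R => F [set x : R | B (y + x)]).
Proof.
move=> mB.
have ms : measurable_fun setT (fun z : R * R => z.1 + z.2) by exact: measurable_funD.
have mS : measurable [set z : R * R | B (z.1 + z.2)].
  by have := ms measurableT _ mB; rewrite setTI.
pose h (z : R * R) : \bar R := (\1_[set z : R * R | B (z.1 + z.2)] z)%:E.
have mh : measurable_fun setT h by exact/measurable_EFinP.
have := @measurable_fun_fubini_tonelli_F _ _ _ _ _ F h mh.
move=> /(_ (fun z => _)) k; rewrite (_ : (fun y => _) = fubini_F F h).
  by apply: k => z; rewrite lee_fin.
apply/funext => y; rewrite /fubini_F /h.
have -> : (fun x : R => (\1_[set z : R * R | B (z.1 + z.2)] (y, x))%:E) =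
    (fun x : R => (\1_[set x | B (y + x)] x)%:E :> \bar R).
  by apply/funext => x; rewrite !indicE.
by rewrite integral_indic// ?setIT//; exact: measurable_translate_set.
Qed.

End translate.

Section compound.
Context {R : realType} {d : measure_display} {Omega : measurableType d}
  (P : probability Omega R) (F : probability R R) (xi : nat -> {RV P >-> R}).
Hypothesis xi_law : forall k B, measurable B -> P (xi k @^-1` B) = F B.
Hypothesis xi_iid : forall n (B : nat -> set R), (forall k, measurable (B k)) ->
    P (\bigcap_(k in `I_n) xi k @^-1` B k) =
    (\prod_(k < n) fine (P (xi k @^-1` B k)))%:E.

Let xiF (k : nat) : Omega -> R := xi k.

Let xiF_meas k : measurable_fun setT (xiF k).
Proof. exact: (measurable_funPT (xi k)). Qed.

(** The offset n stands for the random number of jumps before u, frozen on the event that [N u]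
    equals n. *)
Definition jump_sum (n m : nat) (w : Omega) : R := \sum_(n <= k < n + m) xi k w.

Lemma measurable_jump_sum n m : measurable_fun setT (jump_sum n m).
Proof. exact: measurable_sum. Qed.

Lemma measurable_jump_sum_past n m :
  measurable_fun setT (jump_sum n m : g_sigma_algebraType (gen `I_(n + m) xiF) -> R).
Proof.
rewrite (_ : jump_sum n m = fun w => \sum_(n <= k < n + m)
    (if (k < n + m)%N then xi k w else 0)); last first.
  by apply/funext => w; apply: eq_big_nat => k /andP[_ ->].
apply: measurable_sum => i; case: (ltnP i (n + m)%N) => h; last exact: measurable_cst.
exact: (@sigma_gen_fun _ _ _ _ _ _ xiF).
Qed.

(** Gathers the constraints that a cylinder puts on the k-th jump, as [xi_iid] speaks of one Borel
    set per index. *)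
Let C (l : seq (nat * set R)) (k : nat) : set R :=
  foldr (fun p A => if p.1 == k then p.2 `&` A else A) setT l.

Let C_meas m l k : cyl_on `I_m measurable l -> measurable (C l k).
Proof.
elim: l => [|p l ih]; first by move=> _; exact: measurableT.
by move=> /= [_ mp /ih ?]; case: ifP => // _; exact: measurableI.
Qed.

Let cylC m l : cyl_on `I_m measurable l ->
  cyl xiF l = \bigcap_(k in `I_m) xi k @^-1` C l k.
Proof.
elim: l => [_|p l ih [pm mp lP]].
  by apply/seteqP; split => // w _ k _.
rewrite cyl_cons ih//; apply/seteqP; split => [w [pw h] k km|w h].
  by have := h k km; rewrite /preimage/=; case: ifPn => [/eqP <-//|//].
split; first by have := h _ pm; rewrite /preimage/= eqxx => -[].
by move=> k km; have := h k km; rewrite /preimage/=; case: ifPn => // _ [].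
Qed.

Lemma jumps_indep m A B : sigma_gen `I_m xiF A -> measurable B ->
  P (A `&` xi m @^-1` B) = (P A * F B)%E.
Proof.
move=> mA mB.
have mE : measurable (xi m @^-1` B) by exact: measurable_funPTI.
rewrite setIC muleC -(xi_law m mB).
apply: (@indep_sigma_gen _ _ _ P _ _ _ `I_m xiF _ _ mE) mA => //.
move=> l lP; rewrite (cylC lP).
pose C' k := if k == m then B else C l k.
have mC k : measurable (C l k) by exact: C_meas lP.
have mC' k : measurable (C' k) by rewrite /C'; case: ifP.
rewrite (xi_iid m mC); have := xi_iid m.+1 mC'; rewrite big_ord_recr/= EFinM muleC.
rewrite {2}/C' eqxx fineK ?fin_num_measure//.
have -> : \prod_(i < m) fine (P (xi i @^-1` C' i)) = \prod_(i < m) fine (P (xi i @^-1` C l i)).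
  by apply: eq_bigr => i _; rewrite /C' ltn_eqF.
move=> <-; congr (P _); apply/seteqP; split => [w [Bw h] k|w h].
  rewrite /= ltnS leq_eqVlt /preimage/= /C'; case: eqVneq => [->//|_ /= km]; exact: h.
split; first by have := h m (ltnSn m); rewrite /C' /preimage/= eqxx.
by move=> k km; have := h k (ltnW km); rewrite /preimage /C' /= ltn_eqF.
Qed.

(** [conv_pow] integrates a translate of F against the previous power, which corresponds to
    splitting off the last jump, independent of A and of the earlier ones; the three cases follow
    its definition. *)
Lemma jump_sum_indep n m A B : sigma_gen `I_n xiF A -> measurable B ->
  P (A `&` jump_sum n m @^-1` B) = (P A * conv_pow F m B)%E.
Proof.
have mgen j : <<s gen `I_j xiF >> `<=` measurable.
  by apply: sigma_gen_measurable => i _; exact: xiF_meas.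
elim: m A B => [|[|m] ih] A B nA mB.
- rewrite (_ : jump_sum n 0 = cst 0); last first.
    by apply/funext => w; rewrite /jump_sum addn0 big_geq.
  rewrite preimage_cst/= diracE; case: ifPn => _; first by rewrite setIT mule1.
  by rewrite setI0 measure0 mule0.
- rewrite (_ : jump_sum n 1 = xi n); last first.
    by apply/funext => w; rewrite /jump_sum addn1 big_nat1.
  exact: jumps_indep.
have mS := measurable_jump_sum n m.+1.
have e : jump_sum n m.+2 = fun w => jump_sum n m.+1 w + xi (n + m.+1)%N w.
  by apply/funext => w; rewrite /jump_sum addnS big_nat_recr//= leq_addr.
have nA' : sigma_gen `I_(n + m.+1) xiF A.
  by apply: (@sigma_genS _ _ _ _ _ `I_n) nA => i /= /leq_trans; apply; rewrite leq_addr.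
have mSF := @measurable_jump_sum_past n m.+1.
have mxi : measurable_fun setT (xi (n + m.+1)%N) by exact: measurable_funPT.
rewrite e; have := indep_sum_prob (mgen (n + m.+1)%N) mxi
  (fun A B => @jumps_indep (n + m.+1)%N A B) mSF nA' mB.
move=> ->.
have lawS B' : measurable B' -> P (jump_sum n m.+1 @^-1` B') = conv_pow F m.+1 B'.
  move=> mB'; rewrite -[jump_sum n m.+1 @^-1` B']setTI ih// ?probability_setT ?mul1e//.
  exact: (salgebra_setT (@sigma_gen_salgebra _ _ _ _ _ _ _)).
have ind A' B' : <<s gen `I_n xiF >> A' -> measurable B' ->
    P (A' `&` jump_sum n m.+1 @^-1` B') = (P A' * law P mS B')%E.
  by move=> hA' hB'; rewrite ih// lawE lawS.
rewrite (indep_ge0_integral_event (mgen n) mS ind nA (measurable_translate F mB))//.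
congr (_ * _)%E; rewrite -[RHS]/(\int[conv_pow F m.+1]_y translate F y B)%E.
rewrite (_ : (fun y => translate F y B) = (fun y => F [set x | B (y + x)])); last first.
  by apply/funext => y; rewrite translate_set.
by apply: raw_integral_ext => D mD; rewrite lawE lawS.
Qed.

End compound.

Section increments.
Context {R : realType} {d : measure_display} {Omega : measurableType d}
  (P : probability Omega R) (F : probability R R) (xi : nat -> {RV P >-> R})
  (T lambda : R) (N : R -> {RV P >-> nat}) (J : R -> Omega -> R).
Hypothesis lambda_ge0 : 0 <= lambda.
Hypothesis xi_law : forall k B, measurable B -> P (xi k @^-1` B) = F B.
Hypothesis xi_iid : forall n (B : nat -> set R), (forall k, measurable (B k)) ->
    P (\bigcap_(k in `I_n) xi k @^-1` B k) =
    (\prod_(k < n) fine (P (xi k @^-1` B k)))%:E.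
Hypothesis N_poisson : poisson_process T lambda N.
Hypothesis J_sum : forall t w, 0 <= t <= T -> J t w = \sum_(k < N t w) xi k w.
Hypothesis xi_N : independent P (sigma_gen setT (fun k => xi k : Omega -> R))
  (natural_filtration (fun r => N r : Omega -> nat) T).

Let xiF (k : nat) : Omega -> R := xi k.
Let NF (r : R) : Omega -> nat := N r.

Let xiF_meas k : measurable_fun setT (xiF k).
Proof. exact: (measurable_funPT (xi k)). Qed.

Let NF_meas r : measurable_fun setT (NF r).
Proof. exact: (measurable_funPT (N r)). Qed.

Lemma compound_jump_sum t w : 0 <= t <= T -> J t w = jump_sum xi 0 (N t w) w.
Proof. by move=> tT; rewrite J_sum// /jump_sum add0n big_mkord. Qed.

Lemma measurable_compound t : 0 <= t <= T -> measurable_fun setT (J t).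
Proof.
move=> tT _ B mB; rewrite setTI.
rewrite (_ : _ @^-1` _ = \bigcup_n (N t @^-1` [set n] `&` jump_sum xi 0 n @^-1` B)).
  apply: bigcupT_measurable => n; apply: measurableI.
    by have := NF_meas t measurableT (I : measurable [set n]); rewrite setTI.
  by have := measurable_jump_sum xi 0 n measurableT mB; rewrite setTI.
apply/seteqP; split => [w/=|w [n _ [/= <-]]]; rewrite compound_jump_sum//.
by exists (N t w).
Qed.

Definition count_monotone w := forall r s, 0 <= r -> r <= s -> s <= T -> (N r w <= N s w)%N.

Section past.
Variable u : R.
Hypothesis uT : 0 <= u <= T.

Let gens n := gen `[0, u] NF `|` gen `I_n xiF.

Let gens_meas n : <<s gens n >> `<=` measurable.
Proof.
apply: smallest_sub; first exact: sigma_algebra_measurable.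
move=> A [h|h].
  apply: (@sigma_gen_measurable _ _ _ _ _ `[0, u] NF) => //; exact: sub_gen_smallest.
apply: (@sigma_gen_measurable _ _ _ _ _ `I_n xiF) => //; exact: sub_gen_smallest.
Qed.

(* Up to time [u], the process [J] only uses the first [N u] jumps. *)
Lemma compound_past A : natural_filtration J u A -> forall n,
  exists An, <<s gens n >> An /\
    forall w, count_monotone w -> N u w = n -> (A w <-> An w).
Proof.
have sa n : sigma_algebra setT <<s gens n >> by exact: smallest_sigma_algebra.
move: A; apply: smallest_sub => [|A [r /= ru [B mB <-]] n].
  split => [n|A KA n|A KA n].
  - by exists set0; split => //; have [] := sa n.
  - have [An [sAn h]] := KA n; exists (setT `\` An); split; first by have [_ + _] := sa n; exact.
    by move=> w gw /(h w gw) [h1 h2]; split => -[_ k]; split => // a; apply: k; [exact: h2|exact: h1].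
  - have /choice[f fP] := fun i => KA i n.
    exists (\bigcup_i f i); split; first by have [_ _] := sa n; apply => i; exact: (fP i).1.
    by move=> w gw nw; split => -[i _ h]; exists i => //; exact/((fP i).2 w gw nw).
have r0T : 0 <= r <= T.
  by move: ru uT; rewrite in_itv/= => /andP[-> ru] /andP[_]; exact: le_trans.
(* On [N u w = n] monotonicity gives [N r w <= n], so [J r] is this sum over a range that no longer
   depends on w. *)
pose c (w : g_sigma_algebraType (gens n)) : R :=
  \sum_(k < n) xi k w * \1_[set w | (k < N r w)%N] w.
have mc : measurable_fun setT c.
  apply: measurable_sum => k; apply: measurable_funM.
    move=> _ D mD; rewrite setTI; apply: sub_sigma_algebra; right.
    by exists k; [exact: ltn_ord|exists D => //; rewrite setTI].
  apply: measurable_indic; apply: sub_sigma_algebra; left.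
  by exists r => //; exists [set j | (k < j)%N] => //; rewrite setTI.
exists (c @^-1` B); split; first by have := mc measurableT B mB; rewrite setTI.
move=> w gw Nu.
have ru' : r <= u by move: ru; rewrite in_itv/= => /andP[].
have Nr : (N r w <= n)%N.
  by rewrite -Nu; apply: gw => //; [move/andP : r0T => []|move/andP : uT => []].
suff e : J r w = c w by rewrite /preimage/= e; split => [[]|].
rewrite J_sum// (big_ord_widen n (fun k => xi k w) Nr) big_mkcond/=.
apply: eq_bigr => k _; rewrite indicE.
by case: ifPn => h; [rewrite mem_set// mulr1|rewrite memNset ?mulr0//; exact/negP].
Qed.

Variable t : R.
Hypothesis ut : u <= t.
Hypothesis tT : t <= T.

Let E n m B : set Omega :=
  [set w | (N t w - N u w)%N = m] `&` jump_sum xi n m @^-1` B.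

Let mNtu : measurable_fun setT (fun w => (N t w - N u w)%N).
Proof. exact: (measurable_fun_subn (NF_meas t) (NF_meas u)). Qed.

Let mNtum m : measurable [set w | (N t w - N u w)%N = m].
Proof. by have := mNtu measurableT (I : measurable [set m]); rewrite setTI. Qed.

Let mjs n m B : measurable B -> measurable (jump_sum xi n m @^-1` B).
Proof. by move=> mB; have := measurable_jump_sum xi n m measurableT mB; rewrite setTI. Qed.

Let u0 : 0 <= u. Proof. by move/andP : uT => []. Qed.

Let jump_indep n m A B : sigma_gen `I_n xiF A -> measurable B ->
  P (A `&` jump_sum xi n m @^-1` B) = (P A * conv_pow F m B)%E.
Proof. by move=> ? ?; exact: (jump_sum_indep xi_law xi_iid). Qed.

Let jump_law n m B : measurable B -> P (jump_sum xi n m @^-1` B) = conv_pow F m B.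
Proof.
move=> mB; rewrite -[jump_sum xi n m @^-1` B]setTI jump_indep// ?probability_setT ?mul1e//.
exact: (salgebra_setT (@sigma_gen_salgebra _ _ _ _ _ _ _)).
Qed.

Let jump_gen n m B : measurable B ->
  sigma_gen setT (fun k => xi k : Omega -> R) (jump_sum xi n m @^-1` B).
Proof.
move=> mB.
have : measurable_fun setT (jump_sum xi n m : g_sigma_algebraType (gen setT xiF) -> R).
  by apply: measurable_sum => k; exact: (@sigma_gen_fun _ _ _ _ _ _ xiF).
by move=> /(_ measurableT B mB); rewrite setTI.
Qed.

(** It suffices to take C as the intersection of a counting event before u and an event of the first
    n jumps. Independence of jumps and counts separates the two kinds; within each kind, the past
    splits off from the later jumps or the later count. *)
Let past_indep n m B C : measurable B -> <<s gens n >> C ->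
  P (E n m B `&` C) =
  (P C * ((poisson_weight (lambda * (t - u)) m)%:E * conv_pow F m B))%E.
Proof.
move=> mB GC.
have mE : measurable (E n m B) by apply: measurableI => //; exact: mjs.
have key A A' : natural_filtration NF u A -> sigma_gen `I_n xiF A' ->
    P (E n m B `&` (A `&` A')) =
    (P A * P A' * ((poisson_weight (lambda * (t - u)) m)%:E * conv_pow F m B))%E.
  move=> sA sA'.
  have e : E n m B `&` (A `&` A') =
      (A' `&` jump_sum xi n m @^-1` B) `&` (A `&` [set w | (N t w - N u w)%N = m]).
    by apply/seteqP; split => w [[? ?] [? ?]].
  rewrite e xi_N; last 2 first.
  - apply: (salgebra_setI (@sigma_gen_salgebra _ _ _ _ _ _ _)); last exact: jump_gen.
    exact: (@sigma_genS _ _ _ _ _ `I_n).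
  - apply: (salgebra_setI (@sigma_gen_salgebra _ _ _ _ _ _ _)).
      apply: (@sigma_genS _ _ _ _ _ `[0, u] _ NF) sA.
      by move=> r /=; rewrite !in_itv/= => /andP[-> ru]; move/andP : uT => [_]; exact: le_trans.
    have st s : 0 <= s <= T -> measurable_fun setT (NF s : g_sigma_algebraType (gen `[0, T] NF) -> nat).
      by move=> sT; apply: sigma_gen_fun; rewrite /= in_itv.
    have h : measurable_fun setT
        ((fun w => (NF t w - NF u w)%N) : g_sigma_algebraType (gen `[0, T] NF) -> nat).
      apply: measurable_fun_subn; apply: st => //.
      by rewrite tT (le_trans u0 ut).
    by have := h measurableT [set m] I; rewrite setTI.
  rewrite jump_indep//.
  have pin := pp_independent N_poisson u0 ut tT.
  have -> : P (A `&` [set w | (N t w - N u w)%N = m]) =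
      (P A * (poisson_weight (lambda * (t - u)) m)%:E)%E.
    rewrite pin//; last by exists [set m] => //; rewrite setTI.
    by rewrite (pp_law N_poisson).
  by rewrite muleACA (muleC (P A')) (muleC (conv_pow _ _ _)).
have PE : P (E n m B) = ((poisson_weight (lambda * (t - u)) m)%:E * conv_pow F m B)%E.
  have := @key setT setT; rewrite !setIT probability_setT !mul1e; apply.
    exact: (salgebra_setT (@sigma_gen_salgebra _ _ _ _ _ _ _)).
  exact: (salgebra_setT (@sigma_gen_salgebra _ _ _ _ _ _ _)).
rewrite -PE muleC.
have GC' : <<s natural_filtration NF u `|` sigma_gen `I_n xiF >> C.
  move: C GC; apply: smallest_sub; first exact: smallest_sigma_algebra.
  by move=> C [h|h]; apply: sub_sigma_algebra; [left|right]; exact: sub_gen_smallest.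
apply: (@indep_join _ _ _ P (natural_filtration NF u) (sigma_gen `I_n xiF)) GC' => //.
- exact: (@sigma_gen_measurable _ _ _ _ _ _ NF).
- exact: (@sigma_gen_measurable _ _ _ _ _ _ xiF).
- exact: (salgebra_setI (@sigma_gen_salgebra _ _ _ _ _ _ _)).
- exact: (salgebra_setI (@sigma_gen_salgebra _ _ _ _ _ _ _)).
- exact: (salgebra_setT (@sigma_gen_salgebra _ _ _ _ _ _ _)).
- exact: (salgebra_setT (@sigma_gen_salgebra _ _ _ _ _ _ _)).
move=> A A' sA sA'; rewrite key// -PE muleC; congr (_ * _)%E.
rewrite setIC xi_N//; first by rewrite muleC.
  exact: (@sigma_genS _ _ _ _ _ `I_n).
apply: (@sigma_genS _ _ _ _ _ `[0, u] _ NF) sA.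
by move=> r /=; rewrite !in_itv/= => /andP[-> ru]; move/andP : uT => [_]; exact: le_trans.
Qed.

Local Open Scope ereal_scope.

(** On the cell where [N u] is n and the later count is m, the increment is [jump_sum xi n m], and
    the factor that [past_indep] attaches to the past does not depend on n; hence it survives the
    summation over n. *)
Lemma increment_indep A B : natural_filtration J u A -> measurable B ->
  P (A `&` (fun w => J t w - J u w)%R @^-1` B) =
  P A * \sum_(0 <= m <oo) (poisson_weight (lambda * (t - u)) m)%:E * conv_pow F m B.
Proof.
move=> sA mB.
have r0 : (0 <= lambda * (t - u))%R by rewrite mulr_ge0// subr_ge0.
have T0 : (0 <= t <= T)%R by rewrite tT (le_trans u0 ut).
have mA : measurable A.
  apply: sigma_gen_measurable sA => r /=; rewrite in_itv/= => /andP[r1 r2].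
  by apply: measurable_compound; rewrite r1 (le_trans r2)//; move/andP : uT => [].
have mJB : measurable ((fun w => J t w - J u w)%R @^-1` B).
  have : measurable_fun setT (fun w => J t w - J u w)%R.
    by apply: measurable_funB; exact: measurable_compound.
  by move=> /(_ measurableT B mB); rewrite setTI.
set q := \sum_(0 <= m <oo) _.
have c01 m : 0 <= conv_pow F m B <= 1.
  by rewrite -(jump_law 0 m mB) measure_ge0 probability_le1//; exact: mjs.
have wc0 m : 0 <= (poisson_weight (lambda * (t - u)) m)%:E * conv_pow F m B.
  by rewrite mule_ge0 ?lee_fin ?poisson_weight_ge0//; have /andP[] := c01 m.
have qfin : q \is a fin_num.
  rewrite ge0_fin_numE; last exact: nneseries_ge0.
  apply: (@le_lt_trans _ _ 1); last exact: ltry.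
  rewrite -(sum_poisson_weight r0); apply: lee_nneseries => // m _.
  by rewrite -[leRHS]mule1 lee_wpmul2l ?lee_fin ?poisson_weight_ge0//; have /andP[] := c01 m.
have mNu n : measurable [set w | N u w = n].
  by have := NF_meas u measurableT (I : measurable [set n]); rewrite setTI.
rewrite (prob_split P (NF_meas u)); last exact: measurableI.
rewrite [in RHS](prob_split P (NF_meas u) mA) muleC -(fineK qfin) -nneseriesZl//.
apply: eq_eseriesr => n _; rewrite (fineK qfin) muleC.
have [An [sAn hAn]] := compound_past sA n.
have mAn : measurable An by exact: gens_meas sAn.
pose C := An `&` [set w | N u w = n].
have sC : <<s gens n >> C.
  apply: (salgebra_setI (smallest_sigma_algebra _ _)) => //.
  apply: sub_sigma_algebra; left; exists u; first by rewrite /= in_itv/= u0 lexx.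
  by exists [set n] => //; rewrite setTI.
have -> : P (A `&` [set w | NF u w = n]) = P C.
  apply: ae_eq_prob; [exact: measurableI|exact: measurableI|].
  apply: filterS (pp_nondecreasing N_poisson) => w gw.
  by split => -[h1 h2]; split => //; exact/(hAn w gw h2).
have PC : P C \is a fin_num by rewrite fin_num_measure//; exact: measurableI.
rewrite -(fineK PC) /q -nneseriesZl//.
rewrite (prob_split P mNtu); last by apply: measurableI => //; exact: measurableI.
apply: eq_eseriesr => m _; rewrite (fineK PC) -(past_indep m mB sC).
apply: ae_eq_prob.
- by apply: measurableI => //; apply: measurableI => //; exact: measurableI.
- apply: measurableI; last exact: measurableI.
  by apply: measurableI => //; exact: mjs.
apply: filterS (pp_nondecreasing N_poisson) => w gw.
(* Subtraction of naturals is truncated: monotonicity is what gives [N t w = n + m]. *)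
have Ntu : N u w = n -> (N t w - N u w)%N = m ->
    (J t w - J u w = jump_sum xi n m w)%R.
  move=> Nu Nm; rewrite !compound_jump_sum//.
  have -> : N t w = (n + m)%N by rewrite -Nm -Nu subnKC//; apply: gw.
  rewrite Nu /jump_sum !add0n (big_cat_nat _ (leq_addr m n))//=.
  by rewrite addrAC subrr add0r.
split.
  move=> [[[hA /= hB] /= hn] /= hm]; split; split => //=.
    by rewrite -Ntu.
  exact/(hAn w gw hn).
move=> [[/= hm hB] [hA /= hn]]; split => //; split => //; split.
  exact/(hAn w gw hn).
by rewrite /preimage/= Ntu.
Qed.

End past.
End increments.

(** * Moments of compound Poisson variables *)

Section jump_moments.
Context {R : realType} {d : measure_display} {Omega : measurableType d}
  (P : probability Omega R) (F : probability R R) (xi : nat -> {RV P >-> R}).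
Variables mu1 mu2 : R.
Hypothesis xi_law : forall k B, measurable B -> P (xi k @^-1` B) = F B.
Hypothesis xi_iid : forall n (B : nat -> set R), (forall k, measurable (B k)) ->
    P (\bigcap_(k in `I_n) xi k @^-1` B k) =
    (\prod_(k < n) fine (P (xi k @^-1` B k)))%:E.
Hypothesis xi_L2 : forall k, L2 P (xi k).
Hypothesis xi_mean : forall k, \int[P]_w xi k w = mu1.
Hypothesis xi_sq : forall k, ip P (xi k) (xi k) = mu2.

Lemma jump_sumS m : jump_sum xi 0 m.+1 = fun w => jump_sum xi 0 m w + xi m w.
Proof. by apply/funext => w; rewrite /jump_sum !add0n big_nat_recr. Qed.

Lemma jump_sum0 : jump_sum xi 0 0 = fun=> 0.
Proof. by apply/funext => w; rewrite /jump_sum big_geq. Qed.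

Lemma jump_sum_L2 m : L2 P (jump_sum xi 0 m).
Proof. by elim: m => [|m ih]; rewrite ?jump_sum0 ?jump_sumS; [exact: L2_0|exact: L2D]. Qed.

Lemma jump_sum_mean m : \int[P]_w jump_sum xi 0 m w = m%:R * mu1.
Proof.
elim: m => [|m ih]; first by rewrite jump_sum0 -ip1r ip0l mul0r.
have L1 := L2_cst P 1.
have Lm := jump_sum_L2 m.
rewrite jump_sumS -ip1r ipDl// !ip1r ih xi_mean -[in RHS]natr1; ring.
Qed.

Lemma jump_sum_sq m : ip P (jump_sum xi 0 m) (jump_sum xi 0 m) =
  m%:R * mu2 + m%:R * (m%:R - 1) * mu1 ^+ 2.
Proof.
elim: m => [|m ih]; first by rewrite jump_sum0 ip0l !mul0r addr0.
have gm : <<s gen `I_m (fun k => xi k : Omega -> R) >> `<=` measurable.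
  by apply: sigma_gen_measurable => i _; exact: measurable_funPT.
have Lm := jump_sum_L2 m.
rewrite jump_sumS ip_sqrD// ih xi_sq.
have -> : ip P (jump_sum xi 0 m) (xi m) = m%:R * mu1 * mu1.
  rewrite -jump_sum_mean -(xi_mean m).
  have mS := @measurable_jump_sum_past _ _ _ P xi 0 m; rewrite add0n in mS.
  apply: (indep_ip gm mS) => //.
  move=> A B sA mB; rewrite xi_law//.
  exact: (jumps_indep xi_law xi_iid).
rewrite -natr1; ring.
Qed.

Variables (r : R) (j : Omega -> R).
Hypothesis r0 : 0 <= r.
Hypothesis mj : measurable_fun setT j.
Hypothesis j_law : forall B, measurable B ->
  P (j @^-1` B) = (\sum_(0 <= m <oo) (poisson_weight r m)%:E * conv_pow F m B)%E.

Let wn m : {nonneg R} := NngNum (poisson_weight_ge0 r0 m).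

Let jump_law m B : measurable B -> P (jump_sum xi 0 m @^-1` B) = conv_pow F m B.
Proof.
move=> mB; rewrite -[jump_sum xi 0 m @^-1` B]setTI.
rewrite (jump_sum_indep xi_law xi_iid)// ?probability_setT ?mul1e//.
exact: (salgebra_setT (@sigma_gen_salgebra _ _ _ _ _ _ _)).
Qed.

(** The law of [j] is realised as a series of genuine measures, the weighted laws of the jump sums,
    so that integrals can be taken term by term. *)
Lemma compound_ge0_integral (f : R -> \bar R) : measurable_fun setT f ->
  (forall y, (0 <= f y)%E) ->
  (\int[P]_w f (j w) = \sum_(0 <= m <oo) (poisson_weight r m)%:E *
     \int[P]_w f (jump_sum xi 0 m w))%E.
Proof.
move=> mf f0; rewrite -(ge0_integral_law P mj)//.
pose mm m := mscale (wn m) (law P (measurable_jump_sum xi 0 m)).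
transitivity (\int[mseries mm 0]_y f y)%E.
  apply: eq_measure_integral => B mB _; rewrite [LHS]j_law//.
  by apply: eq_eseriesr => m _; rewrite -jump_law.
rewrite ge0_integral_measure_series//; apply: eq_eseriesr => m _.
by rewrite ge0_integral_mscale// ge0_integral_law.
Qed.

(* Only series of nonnegative terms are summed: the mean is read off the second
   moment of [j + c] with [c] of the sign of [mu1]. *)
Let shifted c : 0 <= c * mu1 -> L2 P (fun w => j w + c) /\
  ip P (fun w => j w + c) (fun w => j w + c) =
    r * mu2 + r ^+ 2 * mu1 ^+ 2 + 2 * r * (c * mu1) + c ^+ 2.
Proof.
move=> c0.
have mu20 : 0 <= mu2 by rewrite -(xi_sq 0); exact: ip_ge0.
have mjc : measurable_fun setT (fun w => j w + c) by exact: measurable_funD.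
have mf : measurable_fun setT (fun y : R => ((y + c) ^+ 2)%:E).
  by apply/measurable_EFinP/measurable_funX/measurable_funD.
have e : (\int[P]_w ((j w + c) ^+ 2)%:E =
    (r * mu2 + r ^+ 2 * mu1 ^+ 2 + 2 * r * (c * mu1) + c ^+ 2)%:E)%E.
  rewrite (compound_ge0_integral mf); last by move=> y; rewrite lee_fin sqr_ge0.
  have h m : ((poisson_weight r m)%:E * \int[P]_w ((jump_sum xi 0 m w + c) ^+ 2)%:E =
      (mu2 + 2 * (c * mu1))%:E * (poisson_weight r m * m%:R)%:E +
      (mu1 ^+ 2)%:E * (poisson_weight r m * (m%:R * (m%:R - 1)))%:E +
      (c ^+ 2)%:E * (poisson_weight r m)%:E)%E.
    have Lm := jump_sum_L2 m; have Lc := L2_cst P c.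
    under eq_integral do rewrite expr2.
    have Ls := L2D Lm Lc.
    rewrite -(ipE Ls Ls) ip_sqrD// ip_cst ip_cstr// jump_sum_sq jump_sum_mean.
    by rewrite -!EFinM -!EFinD; congr EFin; ring.
  under eq_eseriesr do rewrite h.
  have p0 m : 0 <= poisson_weight r m * m%:R by rewrite mulr_ge0// poisson_weight_ge0.
  have q0 m : 0 <= poisson_weight r m * (m%:R * (m%:R - 1)).
    case: m => [|m]; first by rewrite mul0r mulr0.
    by rewrite mulr_ge0// ?poisson_weight_ge0// mulr_ge0// subr_ge0 ler1n.
  have a0 : 0 <= mu2 + 2 * (c * mu1) by rewrite addr_ge0// mulr_ge0.
  rewrite !nneseriesD; try by move=> *; rewrite ?adde_ge0// mule_ge0// lee_fin ?poisson_weight_ge0// sqr_ge0.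
  rewrite !nneseriesZl; try by move=> *; rewrite lee_fin ?poisson_weight_ge0.
  rewrite sum_poisson_weight// sum_poisson_weight1// sum_poisson_weight2//.
  by rewrite -!EFinM -!EFinD; congr EFin; ring.
have Lj : L2 P (fun w => j w + c).
  split => //; apply/integrableP; split; first exact/measurable_EFinP/measurable_funX.
  under eq_integral do rewrite gee0_abs ?lee_fin ?sqr_ge0//.
  by rewrite e ltry.
split => //; apply: EFin_inj; rewrite (ipE Lj Lj) -e.
by apply: eq_integral => w _; rewrite expr2.
Qed.

Lemma compound_L2 : L2 P j.
Proof.
have [|h _] := @shifted 0; first by rewrite mul0r.
by rewrite (_ : (fun w => j w + 0) = j) in h; last by apply/funext => w; rewrite addr0.
Qed.

Lemma compound_sq : ip P j j = r * mu2 + (r * mu1) ^+ 2.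
Proof.
have [|_] := @shifted 0; first by rewrite mul0r.
rewrite mul0r mulr0 addr0 expr0n/= addr0 exprMn => <-.
by apply: eq_ip => w; rewrite addr0.
Qed.

Lemma compound_mean : \int[P]_w j w = r * mu1.
Proof.
have Lj := compound_L2.
pose c := if 0 <= mu1 then 1 else -1 : R.
have c0 : 0 <= c * mu1.
  by rewrite /c; case: (lerP 0 mu1) => h; rewrite ?mul1r// mulN1r oppr_ge0 ltW.
have cn : c != 0 by rewrite /c; case: ifP; rewrite ?oppr_eq0 oner_eq0.
have [_] := shifted c0; rewrite ip_sqrD//; last exact: L2_cst.
rewrite ip_cst ip_cstr// compound_sq => h.
by apply: (mulfI cn); lra.
Qed.

End jump_moments.

(** * Recovering the jumps from the observed path *)

Section path.
Context {R : realType}.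
Implicit Types (x g : R -> R) (jf : nat -> R).

Lemma unif_continuous_itv (a b : R) g : {within `[a, b], continuous g} ->
  forall e, 0 < e -> exists2 del, 0 < del &
    forall y z, a <= y <= b -> a <= z <= b -> `|y - z| < del -> `|g y - g z| <= e.
Proof.
move=> /subspace_continuousP cg e e0.
have e2 : 0 < e / 2 by rewrite divr_gt0.
pose Q (del y : R) : Prop := a <= y <= b ->
  forall z, a <= z <= b -> `|y - z| < del -> `|g y - g z| <= e.
have /compact_near_coveringP/(_ R (0^'+) Q _) H := @segment_compact R a b.
have [y yab|del /= del0 h] := H _.
- have := cg y yab => /cvgrPdist_le /(_ _ e2).
  rewrite near_withinE => /nbhs_ballP[eta /= eta0 h].
  near=> z del.
  move=> zab u uab zu.
  have yz : `|y - z| < eta / 2.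
    by near: z; apply/nbhs_ballP; exists (eta / 2) => //=; rewrite divr_gt0.
  have dd : del < eta / 2 by near: del; apply: nbhs_right_lt; rewrite divr_gt0.
  have k1 : `|g y - g z| <= e / 2.
    apply: h; last by rewrite /= in_itv.
    by rewrite /ball/= (lt_trans yz)// ltr_pdivrMr// ltr_pMr// ltr1n.
  have k2 : `|g y - g u| <= e / 2.
    apply: h; last by rewrite /= in_itv.
    rewrite /ball/= -(subrKA z) (le_lt_trans (ler_normD _ _))//.
    by rewrite (splitr eta) ltrD// (lt_trans zu).
  rewrite -(subrKA (g y)) (le_trans (ler_normD _ _))// (splitr e) lerD//.
  by rewrite distrC.
- exists (del / 2); first by rewrite divr_gt0.
  move=> y z yab zab yz.
  apply: (h (del / 2)) => //=; rewrite ?divr_gt0//.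
  by rewrite sub0r normrN gtr0_norm ?divr_gt0// ltr_pdivrMr// ltr_pMr// ltr1n.
Unshelve. all: by end_near. Qed.

Lemma finite_gap (s : seq R) : exists2 del : R, 0 < del &
  forall y, y \in s -> y != 0 -> del <= `|y|.
Proof.
elim: s => [|y s [del del0 h]]; first by exists 1.
have [->|y0] := eqVneq y 0.
  by exists del => // z; rewrite inE => /orP[/eqP->|/h//]; rewrite eqxx.
exists (Num.min del `|y|); first by rewrite lt_min del0 normr_gt0.
move=> z; rewrite inE => /orP[/eqP->|/h k] z0; first by rewrite ge_min lexx orbT.
by rewrite ge_min k.
Qed.

Definition big_part (th y : R) : R := y * \1_[set z : R | th < `|z|] y.

Definition big_variation (X : R -> R) (r th : R) (n : nat) : R :=
  \sum_(0 <= k < n.+1) big_part th (X (r * (k.+1%:R / n.+1%:R)) - X (r * (k%:R / n.+1%:R))).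

Lemma big_partE th (y : R) : big_part th y = if th < `|y| then y else 0.
Proof.
rewrite /big_part indicE; case: ifPn => h; first by rewrite mem_set// mulr1.
by rewrite memNset ?mulr0//; exact/negP.
Qed.

(* An increment of [g + jf] is large exactly when [jf] jumps, and the number of
   grid intervals with a jump is at most [c n - c 0]. *)
Lemma big_part_sum (n : nat) (c : nat -> nat) jf (gk : nat -> R) (th e : R) :
  (forall k, (k < n)%N -> (c k <= c k.+1)%N) ->
  (forall k, (k < n)%N -> `|gk k.+1 - gk k| <= e) -> e <= th ->
  (forall k, (k < n)%N -> jf (c k.+1) != jf (c k) -> th + e < `|jf (c k.+1) - jf (c k)|) ->
  `|\sum_(0 <= k < n) big_part th (gk k.+1 + jf (c k.+1) - (gk k + jf (c k)))
    - (jf (c n) - jf (c 0%N))| <= e * ((c n)%:R - (c 0%N)%:R).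
Proof.
move=> cmono ge eth gap.
rewrite -(telescope_sumr (fun k => jf (c k)) (leq0n n)).
rewrite -(telescope_sumr (fun k => (c k)%:R : R) (leq0n n)).
rewrite -sumrB mulr_sumr (le_trans (ler_norm_sum _ _ _))//.
rewrite !big_nat ler_sum// => k /andP[_ kn].
rewrite opprD addrACA big_partE.
have e0 : 0 <= e by apply: le_trans (ge _ kn).
have hc : 0 <= (c k.+1)%:R - (c k)%:R :> R by rewrite subr_ge0 ler_nat cmono.
have [jj|jj] := eqVneq (jf (c k.+1)) (jf (c k)).
  rewrite jj subrr addr0 ltNge (le_trans (ge _ kn) eth)/= subr0 normr0.
  exact: mulr_ge0.
have hg := gap _ kn jj.
have hth : th < `|gk k.+1 - gk k + (jf (c k.+1) - jf (c k))|.
  have := ler_normB (gk k.+1 - gk k + (jf (c k.+1) - jf (c k))) (gk k.+1 - gk k).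
  rewrite (addrC _ (jf _ - _)) addrK.
  have := ge _ kn; lra.
rewrite hth addrK (le_trans (ge _ kn))// ler_peMr// lerBrDr (addrC 1) natr1 ler_nat.
by rewrite ltn_neqAle cmono// andbT; apply: contraNneq jj => ->.
Qed.

(** In the inner limit the grid is refined at a fixed threshold; in the outer one the threshold
    falls below the smallest change of the jump part. Limits superior make this measurable on all
    paths, and they are limits on the good ones. *)
Definition jump_part (X : R -> R) (r : R) : R :=
  fine (limn_esup (fun m => (fine (limn_esup (fun n => (big_variation X r m.+1%:R^-1 n)%:E)))%:E)).

Lemma limn_esup_EFin (f : nat -> R) (l : R) : f n @[n --> \oo] --> l ->
  fine (limn_esup (fun n => (f n)%:E)) = l.
Proof.
move=> fl; have h : (f n)%:E @[n --> \oo] --> l%:E.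
  by apply: cvg_EFin => //; exact: nearW.
rewrite is_cvg_limn_esupE; last by apply/cvg_ex; exists l%:E.
by rewrite (cvg_lim _ h).
Qed.

Lemma jump_partE (T r : R) x g (c : R -> nat) jf : 0 <= r <= T ->
  {within `[0, T], continuous g} ->
  (forall y z, 0 <= y -> y <= z -> z <= T -> (c y <= c z)%N) ->
  (forall y, 0 <= y <= T -> x y = g y + jf (c y)) ->
  jump_part x r = jf (c r) - jf (c 0).
Proof.
move=> /andP[r0 rT] cg cmono xE.
(* All differences of values are listed, not only single jumps, because one grid interval may
   contain several jumps. *)
have [del del0 gap] := finite_gap
  [seq jf a - jf b | a <- iota 0 (c T).+1, b <- iota 0 (c T).+1].
have T0 : 0 <= T by apply: le_trans rT.
have {}gap y z : 0 <= y <= T -> 0 <= z <= T -> jf (c y) != jf (c z) ->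
    del <= `|jf (c y) - jf (c z)|.
  move=> /andP[y0 yT] /andP[z0 zT] h; apply: gap; last by rewrite subr_eq0.
  by apply/allpairsP; exists (c y, c z); split => //; rewrite mem_iota/= add0n ltnS cmono.
set J := jf (c r) - jf (c 0).
have inner m : m.+1%:R^-1 < del / 2 ->
    fine (limn_esup (fun n => (big_variation x r m.+1%:R^-1 n)%:E)) = J.
  move=> mdel; apply: limn_esup_EFin.
  set th := m.+1%:R^-1 in mdel *.
  have th0 : 0 < th by rewrite invr_gt0 ltr0n.
  apply/cvgrPdist_le => eta eta0.
  (* The oscillation e of g per grid interval is at most th, so that th + e < del, and at most c r -
     c 0 such oscillations add up to no more than eta; the 1 avoids a division by 0. *)
  pose e := Num.min th (eta / ((c r)%:R - (c 0)%:R + 1)).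
  have c0r : 0 <= (c r)%:R - (c 0)%:R :> R by rewrite subr_ge0 ler_nat cmono.
  have cp : 0 < (c r)%:R - (c 0)%:R + 1 :> R by rewrite ltr_wpDl.
  have e0 : 0 < e by rewrite lt_min th0 divr_gt0.
  have [d d0 hd] := unif_continuous_itv cg e0.
  have : \forall n \near \oo, (r / d < n%:R)%R by exact: nbhs_infty_gtr.
  apply: filterS => n hn.
  have nd : r / n.+1%:R < d.
    rewrite ltr_pdivrMr ?ltr0n// mulrC -ltr_pdivrMr// (lt_trans hn)//.
    by rewrite ltr_nat.
  pose t k := r * (k%:R / n.+1%:R).
  have tT k : (k <= n.+1)%N -> 0 <= t k <= T.
    move=> kn; rewrite /t mulr_ge0 ?divr_ge0//=.
    by rewrite (le_trans _ rT)// ler_piMr// ler_pdivrMr ?ltr0n// mul1r ler_nat.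
  have tS k : t k <= t k.+1 by rewrite /t ler_wpM2l// ler_pM2r ?invr_gt0 ?ltr0n// ler_nat.
  have tn : t n.+1 = r by rewrite /t divff ?mulr1// pnatr_eq0.
  have t0 : t 0%N = 0 by rewrite /t mul0r mulr0.
  have := @big_part_sum n.+1 (fun k => c (t k)) jf (fun k => g (t k)) th e.
  rewrite tn t0 -/J => h.
  rewrite distrC; apply: (@le_trans _ _ (e * ((c r)%:R - (c 0)%:R))).
    apply: le_trans (h _ _ _ _).
    - rewrite le_eqVlt; apply/orP; left; apply/eqP; congr (`|_ - _|).
      by apply: eq_big_nat => k /andP[_ kn]; rewrite -(xE _ (tT _ kn)) -(xE _ (tT _ (ltnW kn))).
    - move=> k kn; apply: cmono => //; first by have /andP[] := tT k (ltnW kn).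
      by have /andP[] := tT _ kn.
    - move=> k kn; apply: hd; [exact: tT|exact/tT/ltnW|].
      rewrite /t -mulrBr -mulrBl -natr1 addrAC subrr add0r mul1r.
      by rewrite ger0_norm// divr_ge0.
    - by rewrite ge_min lexx.
    - move=> k kn jj.
      have := gap _ _ (tT _ kn) (tT k (ltnW kn)) jj; apply: lt_le_trans.
      have : e <= th by rewrite ge_min lexx.
      lra.
  apply: (@le_trans _ _ (eta / ((c r)%:R - (c 0)%:R + 1) * ((c r)%:R - (c 0)%:R))).
    by rewrite ler_wpM2r// ge_min lexx orbT.
  by rewrite mulrAC ler_pdivrMr// ler_wpM2l// ?lerDl// ltW.
apply: limn_esup_EFin.
apply: (@cvg_trans _ (cst J @ \oo)); last exact: cvg_cst.
apply: near_eq_cvg.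
have : \forall m \near \oo, ((del / 2)^-1 < m%:R)%R by exact: nbhs_infty_gtr.
apply: filterS => m hm; rewrite inner//=.
have d2 : 0 < del / 2 by rewrite divr_gt0.
rewrite -(invrK (del / 2)) ltf_pV2 ?posrE ?invr_gt0 ?ltr0n//.
by rewrite (lt_trans hm)// ltr_nat.
Qed.

End path.

Section jump_part_measurable.
Context {R : realType} {d : measure_display} {Omega : measurableType d}.

Lemma measurable_big_part (th : R) : measurable_fun setT (big_part th).
Proof.
apply: measurable_funM; first exact: measurable_id.
apply: measurable_indic.
have := @normr_measurable R setT measurableT `]th, +oo[%classic (measurable_itv _).
rewrite setTI; congr (measurable _); apply/seteqP.
by split => y; rewrite /preimage/= in_itv/= andbT.
Qed.

(** The grid stays inside [0, r], so only observations up to u enter. *)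
Lemma measurable_jump_part (X : R -> Omega -> R) (r u : R) : 0 <= r <= u ->
  (forall s, 0 <= s <= u -> measurable_fun setT (X s)) ->
  measurable_fun setT (fun w => jump_part (X^~ w) r).
Proof.
move=> /andP[r0 ru] mX.
have tT n k : (k <= n.+1)%N -> 0 <= r * (k%:R / n.+1%:R) <= u.
  move=> kn; rewrite mulr_ge0 ?divr_ge0//= (le_trans _ ru)//.
  by rewrite ler_piMr// ler_pdivrMr ?ltr0n// mul1r ler_nat.
have mfine (f : nat -> Omega -> R) : (forall n, measurable_fun setT (f n)) ->
    measurable_fun setT (fun w => fine (limn_esup (fun n => (f n w)%:E))).
  move=> mf; apply: (measurableT_comp (@fine_measurable R setT measurableT)).
  by apply: measurable_fun_limn_esup => k; exact/measurable_EFinP.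
apply: (mfine) => m; apply: (mfine) => n.
rewrite (_ : (fun w => _) = fun w => \sum_(k < n.+1)
    big_part m.+1%:R^-1 (X (r * (k.+1%:R / n.+1%:R)) w - X (r * (k%:R / n.+1%:R)) w)); last first.
  by apply/funext => w; rewrite /big_variation big_mkord.
apply: measurable_sum => k.
apply: (measurableT_comp (measurable_big_part _)).
apply: measurable_funB; apply: mX; apply: tT => //.
exact/ltnW/ltn_ord.
Qed.

End jump_part_measurable.

Lemma L2_indic_mul (R : realType) (d : measure_display) (X : measurableType d)
    (mu : {measure set X -> \bar R}) (A : set X) (f : X -> R) :
  measurable A -> L2 mu f -> L2 mu (fun x => f x * \1_A x).
Proof.
move=> mA [mf intf].
have m : measurable_fun setT (fun x => f x * \1_A x).
  by apply: measurable_funM => //; exact: measurable_indic.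
split => //; apply: le_integrable intf => //.
  by apply/measurable_EFinP; exact: measurable_funX.
move=> x _; rewrite !abse_EFin lee_fin !ger0_norm ?sqr_ge0// exprMn indicE.
by case: (_ \in _); rewrite ?expr1n ?mulr1// expr0n/= mulr0 sqr_ge0.
Qed.

(** * The residual of the Gaussian prediction *)

Section prediction.
Context {R : realType} {d : measure_display} {Omega : measurableType d}
  (P : probability Omega R) (T : R) (G : R -> {RV P >-> R}) (K C : R -> R -> R)
  (dv : {measure set (measurableTypeR R) -> \bar R}).
Hypothesis G_L2 : forall t, 0 <= t <= T -> L2 P (G t).
Hypothesis G_ip : forall t s, 0 <= t <= T -> 0 <= s <= T -> ip P (G t) (G s) = C t s.
Hypothesis dv_fin : (dv `[0%R, T[%classic < +oo)%E.
Hypothesis K_measurable : forall t, 0 <= t <= T -> measurable_fun `[0, T] (K t).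
Hypothesis K_square : forall t, 0 <= t <= T ->
  (\int[dv]_(s in `[0%R, t[) ((K t s) ^+ 2)%:E < +oo)%E.
Hypothesis K_factor : forall t s, 0 <= t <= T -> 0 <= s <= T ->
  C t s = \int[dv]_(x in `[0, Num.min t s[) (K t x * K s x).
Hypothesis K_inverse : forall t, 0 <= t <= T ->
  exists f, integrand_on C t f /\ Kstar_eq K dv T f \1_`[0, t[%classic.

Let S := measurableTypeR R.

Let LK t : 0 <= t <= T -> L2 dv (Kt K t).
Proof. exact: Kt_L2. Qed.

Let Kip t s : 0 <= t <= T -> 0 <= s <= T -> ip dv (Kt K t) (Kt K s) = C t s.
Proof. exact: Kt_ip. Qed.

(* [W] is the Wiener integral of the element of the closure of the step
   functions that [K^*] sends to [k]. *)
Definition represents (W : Omega -> R) (k : S -> R) : Prop :=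
  [/\ L2 P W, L2 dv k & exists f : nat -> step R, [/\ forall n, step_on T (f n),
    cvgL2 P (fun n => step_map G (f n)) W & cvgL2 dv (fun n => step_map (Kt K) (f n)) k]].

Lemma represents_process t : 0 <= t <= T -> represents (G t) (Kt K t).
Proof.
move=> tT; split; [exact: G_L2|exact: LK|].
exists (fun=> [:: (1, t)]); split.
- by move=> _; exact: step_on_consP.
- rewrite (_ : (fun=> _) = fun=> (G t : Omega -> R)); first exact: cvgL2_cst.
  by apply/funext => n; apply/funext => w; rewrite /step_map big_seq1 mul1r.
- rewrite (_ : (fun=> _) = fun=> Kt K t); first exact: cvgL2_cst.
  by apply/funext => n; apply/funext => w; rewrite /step_map big_seq1 mul1r.
Qed.

Lemma representsB W k V l : represents W k -> represents V l ->
  represents (fun w => W w - V w) (fun x => k x - l x).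
Proof.
move=> [LW Lk [f [fT fW fk]]] [LV Ll [g [gT gV gl]]]; split; [exact: L2B|exact: L2B|].
have LGf h : step_on T h -> L2 P (step_map G h) by move=> hT; exact: (step_map_L2 G_L2).
have LKf h : step_on T h -> L2 dv (step_map (Kt K) h) by move=> hT; exact: (step_map_L2 LK).
exists (fun n => step_sub (f n) (g n)); split.
- by move=> n; exact: step_on_sub.
- rewrite (_ : (fun n => _) = fun n w => step_map G (f n) w - step_map G (g n) w).
    by apply: (cvgL2B _ LW _ LV fW gV) => // n; exact: LGf.
  by apply/funext => n; apply/funext => w; rewrite step_map_sub.
- rewrite (_ : (fun n => _) = fun n w => step_map (Kt K) (f n) w - step_map (Kt K) (g n) w).
    by apply: (cvgL2B _ Lk _ Ll fk gl) => // n; exact: LKf.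
  by apply/funext => n; apply/funext => w; rewrite step_map_sub.
Qed.

(** Along the common sequence both squared norms equal [lambda_dot C (f n) (f n)], hence so do the
    limits. *)
Let represents_norm W k : represents W k -> ip P W W = ip dv k k.
Proof.
move=> [LW Lk [f [fT fW fk]]].
have LGf n : L2 P (step_map G (f n)) by exact: (step_map_L2 G_L2).
have LKf n : L2 dv (step_map (Kt K) (f n)) by exact: (step_map_L2 LK).
have h1 := cvgL2_ip2 LGf LW fW; have h2 := cvgL2_ip2 LKf Lk fk.
move: h2; rewrite (_ : (fun n => _) = fun n => ip P (step_map G (f n)) (step_map G (f n))).
  exact: (cvg_unique (@Rhausdorff R) h1).
by apply/funext => n; rewrite (ip_step_map G_L2 G_ip)// (ip_step_map LK Kip).
Qed.

(** Polarization from the norms of W, V and W - V. *)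
Lemma represents_ip W k V l : represents W k -> represents V l -> ip P W V = ip dv k l.
Proof.
move=> rW rV; have [LW Lk _] := rW; have [LV Ll _] := rV.
have := represents_norm (representsB rW rV).
have LB := L2B LW LV; have LkB := L2B Lk Ll.
rewrite !ipBl// !ipBr// (represents_norm rW) (represents_norm rV) (ipC P V W) (ipC dv l k).
lra.
Qed.

Lemma represents_gclosure W k : represents W k -> gclosure T G W.
Proof. by move=> [LW _ [f [fT fW _]]]; split => //; exists f. Qed.

Variable u : R.
Hypothesis u0T : 0 <= u <= T.

Let mU : measurable (`[0, u[%classic : set S).
Proof. exact: measurable_itv. Qed.

Let f t := Psi C K dv t u.
Let k t (x : S) := (K u x - K t x) * \1_`[0, u[ x.

Lemma Psi_spec t : u <= t -> t <= T ->
  integrand_on C u (f t) /\ cvgL2 dv (fun n => step_map (Kt K) (f t n)) (k t).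
Proof.
move=> ut tT.
have t0T : 0 <= t <= T by rewrite tT andbT (le_trans _ ut)//; case/andP: u0T.
apply: (Kstar_inv_spec dv_fin K_measurable K_square K_factor K_inverse u0T).
have := L2_indic_mul mU (L2B (LK u0T) (LK t0T)).
rewrite (_ : (fun x => _) = fun x => (K u x - K t x) * \1_`[0, u[ x)//.
apply/funext => x; rewrite /Kt !indicE !mem_setE !in_itv/=.
case: (0 <= x) => /=; last by rewrite !mulr0.
case: (ltP x u) => xu; last by rewrite !mulr0.
by rewrite (lt_le_trans xu ut)/= !mulr1.
Qed.

(** [Z] stands for any version of the Wiener integrals, so that one measurable for the past can be
    inserted. *)
Definition residual (Z : R -> Omega -> R) t (w : Omega) : R := G t w - (G u w - Z t w).

Let h t (x : S) : R := Kt K t x * \1_`[u, +oo[ x.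

(** On [0, u[ the kernel is K_t - K_u + (K_u - K_t) = 0, and from u on both [Kt K u] and the kernel
    of [Z t] vanish. *)
Lemma residual_represents Z t : u <= t -> t <= T -> L2 P (Z t) ->
  cvgL2 P (fun n => step_map G (f t n)) (Z t) -> represents (residual Z t) (h t).
Proof.
move=> ut tT LZ cZ.
have t0T : 0 <= t <= T by rewrite tT andbT (le_trans _ ut)//; case/andP: u0T.
have [[fu _] fk] := Psi_spec ut tT.
have rZ : represents (Z t) (k t).
  split => //; last first.
    by exists (f t); split => // n; apply: step_onW (fu n); case/andP: u0T.
  have := L2_indic_mul mU (L2B (LK u0T) (LK t0T)).
  rewrite (_ : (fun x => _) = k t)//.
  apply/funext => x; rewrite /k /Kt !indicE !mem_setE !in_itv/=.
  case: (0 <= x) => /=; last by rewrite !mulr0.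
  case: (ltP x u) => xu; last by rewrite !mulr0.
  by rewrite (lt_le_trans xu ut)/= !mulr1.
have := representsB (represents_process t0T) (representsB (represents_process u0T) rZ).
rewrite (_ : (fun x => Kt K t x - _) = h t)//.
apply/funext => x; rewrite /h /k /Kt !indicE !mem_setE !in_itv/= andbT.
case: (ltP x u) => xu /=; last by rewrite !andbF !mulr0 subrr subr0 mulr1.
rewrite (lt_le_trans xu ut) !andbT mulr0; case: (0 <= x); rewrite ?mulr1 ?mulr0; ring.
Qed.

Lemma residual_orth Z t r : u <= t -> t <= T -> L2 P (Z t) ->
  cvgL2 P (fun n => step_map G (f t n)) (Z t) -> 0 <= r <= u ->
  ip P (residual Z t) (G r) = 0.
Proof.
move=> ut tT LZ cZ /andP[r0 ru].
have r0T : 0 <= r <= T by rewrite r0 (le_trans ru)//; case/andP: u0T.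
rewrite (represents_ip (residual_represents ut tT LZ cZ) (represents_process r0T)).
rewrite -[RHS](ip0l dv (fun=> 0)); apply: eq_Rintegral => x _.
rewrite mul0r /h /Kt !indicE !mem_setE !in_itv/= andbT.
case: (leP u x) => ux /=; last by rewrite mulr0 mul0r.
by rewrite (ltNge x r) (le_trans ru ux) andbF !mulr0.
Qed.

Lemma residual_ip Z t s : u <= t -> t <= T -> u <= s -> s <= T -> L2 P (Z t) -> L2 P (Z s) ->
  cvgL2 P (fun n => step_map G (f t n)) (Z t) -> cvgL2 P (fun n => step_map G (f s n)) (Z s) ->
  ip P (residual Z t) (residual Z s) = C t s - \int[dv]_(x in `[0, u[) (K t x * K s x).
Proof.
move=> ut tT us sT LZt LZs cZt cZs.
have t0T : 0 <= t <= T by rewrite tT andbT (le_trans _ ut)//; case/andP: u0T.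
have s0T : 0 <= s <= T by rewrite sT andbT (le_trans _ us)//; case/andP: u0T.
rewrite (represents_ip (residual_represents ut tT LZt cZt) (residual_represents us sT LZs cZs)).
rewrite -Kip// Rintegral_mkcond.
have e : (fun x => K t x * K s x) \_ `[0, u[ = fun x : S => Kt K t x * (Kt K s x * \1_`[0, u[ x).
  apply/funext => x; rewrite patchE /Kt !indicE mem_setE !mem_setE !in_itv/=.
  case: (0 <= x) => /=; last by rewrite !mulr0.
  case: (ltP x u) => xu; last by rewrite !mulr0.
  by rewrite (lt_le_trans xu ut) (lt_le_trans xu us)/= !mulr1.
rewrite e -/(ip dv (Kt K t) (fun x => Kt K s x * \1_`[0, u[ x)).
rewrite -(ipBr (LK s0T) (L2_indic_mul mU (LK s0T)) (LK t0T)).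
apply: eq_Rintegral => x _; rewrite /h /Kt !indicE !mem_setE !in_itv/= andbT.
case: (ltP x u) => xu /=; last by rewrite !andbF !mulr0 subr0 !mulr1.
by rewrite !andbT !mulr0; case: (0 <= x); rewrite ?mulr0 ?mulr1 ?mul0r ?subrr ?mulr0.
Qed.

End prediction.

(** * Conditional means, covariances and laws *)

Section pairs.
Context {R : realType} {d : measure_display} {Omega : measurableType d}
  (P : probability Omega R).
Implicit Types (A : set Omega) (a b : Omega -> R).

Let pre a : set (set Omega) := preimage_set_system setT a measurable.

Let preP a A : pre a A -> exists2 B, measurable B & A = a @^-1` B.
Proof. by move=> [B mB <-]; exists B => //; rewrite setTI. Qed.

Let pre_meas a : measurable_fun setT a -> pre a `<=` measurable.
Proof. by move=> ma A [B mB <-]; exact: ma. Qed.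

Let preI a : setI_closed (pre a).
Proof.
move=> A A' /preP[B mB ->] /preP[B' mB' ->].
by exists (B `&` B'); [exact: measurableI|rewrite setTI preimage_setI].
Qed.

Let preT a : pre a setT.
Proof. by exists setT => //; rewrite setTI. Qed.

Lemma indep_pair A a b : measurable A -> measurable_fun setT a -> measurable_fun setT b ->
  (forall B1 B2, measurable B1 -> measurable B2 ->
    P (A `&` (a @^-1` B1 `&` b @^-1` B2)) = (P A * P (a @^-1` B1 `&` b @^-1` B2))%E) ->
  forall (phi : R -> R -> R), measurable_fun setT (fun z : R * R => phi z.1 z.2) ->
  forall B, measurable B ->
    P (A `&` (fun w => phi (a w) (b w)) @^-1` B) =
    (P A * P ((fun w => phi (a w) (b w)) @^-1` B))%E.
Proof.
move=> mA ma mb h phi mphi B mB.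
apply: (@indep_join _ _ _ P (pre a) (pre b)) => //; try exact: preI; try exact: pre_meas.
  by move=> _ _ /preP[B1 mB1 ->] /preP[B2 mB2 ->]; exact: h.
pose O' := g_sigma_algebraType (pre a `|` pre b).
have ma' : measurable_fun setT (a : O' -> R).
  by move=> _ D mD; apply: sub_sigma_algebra; left; exists D.
have mb' : measurable_fun setT (b : O' -> R).
  by move=> _ D mD; apply: sub_sigma_algebra; right; exists D.
have : measurable_fun setT (fun w : O' => phi (a w) (b w)).
  exact: (measurableT_comp mphi (measurable_fun_pair ma' mb')).
by move=> /(_ measurableT B mB); rewrite setTI.
Qed.

(** Independence of the two sources splits a probability into a Gaussian and a jump factor; within
    each factor the innovation splits off from its own past. *)
Lemma indep_sum_rv (Gs1 Gs2 H1 H2 : set (set Omega)) U j :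
  <<s Gs1 >> `<=` measurable -> <<s Gs2 >> `<=` measurable ->
  independent P <<s Gs1 >> <<s Gs2 >> ->
  <<s H1 >> `<=` <<s Gs1 >> -> <<s H2 >> `<=` <<s Gs2 >> ->
  (forall B, measurable B -> <<s Gs1 >> (U @^-1` B)) ->
  (forall B, measurable B -> <<s Gs2 >> (j @^-1` B)) ->
  indep_rv P <<s H1 >> U -> indep_rv P <<s H2 >> j ->
  indep_rv P <<s H1 `|` H2 >> (fun w => U w + j w).
Proof.
move=> m1 m2 ind h1 h2 sU sj iU ij.
have s1 := smallest_sigma_algebra setT Gs1; have s2 := smallest_sigma_algebra setT Gs2.
have mU : measurable_fun setT U by move=> _ B mB; rewrite setTI; apply: m1; exact: sU.
have mj : measurable_fun setT j by move=> _ B mB; rewrite setTI; apply: m2; exact: sj.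
move=> C B sC mB.
have mD : measurable ((fun w => U w + j w) @^-1` B).
  by have := measurable_funD mU mj measurableT mB; rewrite setTI.
have sC' : <<s <<s H1 >> `|` <<s H2 >> >> C.
  move: C sC; apply: smallest_sub; first exact: smallest_sigma_algebra.
  by move=> D [hD|hD]; apply: sub_sigma_algebra; [left|right]; apply: sub_sigma_algebra.
rewrite setIC muleC.
have sh1 := smallest_sigma_algebra setT H1; have sh2 := smallest_sigma_algebra setT H2.
apply: (@indep_join _ _ _ P <<s H1 >> <<s H2 >>) sC' => //.
- exact: subset_trans h1 m1.
- exact: subset_trans h2 m2.
- exact: salgebra_setI.
- exact: salgebra_setI.
- exact: salgebra_setT.
- exact: salgebra_setT.
move=> A1 A2 hA1 hA2; rewrite setIC muleC.
have sA1 := h1 _ hA1; have sA2 := h2 _ hA2.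
apply: (@indep_pair _ U j _ mU mj _ +%R) => //.
- by apply: measurableI; [exact: m1|exact: m2].
- move=> B1 B2 mB1 mB2; rewrite setIACA.
  have hU := sU _ mB1; have hj := sj _ mB2.
  rewrite ind; [|exact: (salgebra_setI s1)|exact: (salgebra_setI s2)].
  by rewrite iU// ij// (ind _ _ sA1 sA2) (ind _ _ hU hj) muleACA.
- exact: measurable_funD.
Qed.

Lemma indep_rv_sub (F F' : set (set Omega)) a : F `<=` F' -> indep_rv P F' a -> indep_rv P F a.
Proof. by move=> FF' h A B FA mB; apply: h => //; exact: FF'. Qed.

(** Two stages: b splits off from [F'], which contains the event and a; then a splits off from [F].
    This handles successive increments. *)
Lemma indep_rv_combine (F F' : set (set Omega)) a b : F `<=` F' -> setI_closed F' ->
  F' `<=` measurable -> F' setT ->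
  (forall B, measurable B -> F' (a @^-1` B)) -> measurable_fun setT b ->
  indep_rv P F a -> indep_rv P F' b ->
  forall (phi : R -> R -> R), measurable_fun setT (fun z : R * R => phi z.1 z.2) ->
  indep_rv P F (fun w => phi (a w) (b w)).
Proof.
move=> FF' F'I F'm F'T Fa mb ia ib phi mphi A B FA mB.
have ma : measurable_fun setT a by move=> _ D mD; rewrite setTI; apply: F'm; exact: Fa.
apply: (indep_pair _ ma mb) => //; first by apply: F'm; exact: FF'.
move=> B1 B2 mB1 mB2; rewrite setIA.
rewrite ib//; last by apply: F'I; [exact: FF'|exact: Fa].
by rewrite ia// ib ?muleA//; exact: Fa.
Qed.

End pairs.

Section rays.
Context {R : realType}.
Local Open Scope ereal_scope.

(** A countable determining class: it merges the null sets of the separate rays into one that serves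
    every Borel set. *)
Lemma probability_unique_ratr (mu nu : probability R R) :
  (forall q : rat, mu `]-oo, ratr q[%classic = nu `]-oo, ratr q[%classic) ->
  forall B, measurable B -> mu B = nu B.
Proof.
move=> h B mB.
pose Q : set (set R) := [set A | exists q : rat, A = `]-oo, ratr q[%classic].
have QB : <<s Q >> B.
  have : (@measurable_realfun.RGenInftyO.G R).-sigma.-measurable B.
    by rewrite -(measurable_realfun.RGenInftyO.measurableE R).
  move: B {mB}; apply: smallest_sub; first exact: smallest_sigma_algebra.
  move=> _ [x ->].
  rewrite (_ : `]-oo, x[%classic = \bigcup_(q in [set q : rat | (ratr q <= x)%R]) `]-oo, ratr q[%classic).
    have sa := smallest_sigma_algebra setT Q.
    have : (Q.-sigma).-measurable (\bigcup_(q in [set q : rat | (ratr q <= x)%R])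
        `]-oo, ratr q[%classic : set (g_sigma_algebraType Q)).
      rewrite bigcup_mkcond; apply: bigcupT_measurable_rat => q; case: ifPn => _.
        by apply: sub_sigma_algebra; exists q.
      exact: measurable0.
    by [].
  apply/seteqP; split => [y|y [q /= qx]].
    rewrite /= in_itv/= => yx; have [q] := rat_in_itvoo yx.
    rewrite in_itv/= => /andP[yq qx]; exists q; first exact: ltW.
    by rewrite /= in_itv.
  by rewrite !in_itv/= => /lt_le_trans; exact.
apply: (@g_sigma_algebra_measure_unique _ R R Q _ (fun n => `]-oo, (ratr n%:R : R)[%classic)) QB => //.
- by move=> _ [q ->]; exact: measurable_itv.
- by move=> n; exists n%:R.
- apply/seteqP; split => // y _; exists (Num.Def.truncn `|y|).+1 => //=.
  rewrite in_itv/= ratr_nat.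
  by rewrite (le_lt_trans (ler_norm y))// truncnS_gt.
- move=> _ _ [p ->] [q ->]; exists (Num.min p q).
  apply/seteqP; split => z /=; rewrite !in_itv/=.
    by move=> [zp zq]; rewrite /Num.min; case: ifP.
  rewrite /Num.min; case: (ltP p q) => pq zz; split => //.
    by rewrite (lt_trans zz)// ltr_rat.
  by rewrite (lt_le_trans zz)// ler_rat.
- by move=> _ [q ->]; exact: h.
- by move=> n; rewrite ltey_eq fin_num_measure//; exact: measurable_itv.
Qed.

End rays.

Section conditional.
Context {R : realType} {d : measure_display} {Omega : measurableType d}
  (P : probability Omega R) (Gs : set (set Omega)).
Hypothesis Gm : <<s Gs >> `<=` measurable.
Let F := <<s Gs >>.
Let OF := g_sigma_algebraType Gs.
Implicit Types (Y D e : Omega -> R) (c : OF -> R).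

Lemma indep_int_event D A : L2 P D -> indep_rv P F D -> F A ->
  (\int[P]_(w in A) (D w)%:E = P A * (\int[P]_w D w)%:E)%E.
Proof.
move=> LD ind FA; have [mD _] := LD.
have iD := L2_finite_integrable LD.
rewrite (indep_integral_event (rho := law P mD) Gm mD ind FA (f := id) (@measurable_id _ _ setT) iD).
by rewrite fineK//; exact: integrable_fin_num.
Qed.

Lemma indep_ip_indic D A : L2 P D -> indep_rv P F D -> F A -> forall m,
  ip P (fun w => (D w - m) * \1_A w) (fun w => (D w - m) * \1_A w) =
  fine (P A) * ip P (fun w => D w - m) (fun w => D w - m).
Proof.
move=> LD ind FA m; have [mD _] := LD.
have mA : measurable A by exact: Gm.
have Lm := L2B LD (L2_cst P m).
have LA := L2_indic_mul mA Lm.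
have mf : measurable_fun setT (fun y : R => ((y - m) ^+ 2)%:E).
  by apply/measurable_EFinP/measurable_funX/measurable_funB.
have f0 (y : R) : (0 <= ((y - m) ^+ 2)%:E)%E by rewrite lee_fin sqr_ge0.
have := indep_ge0_integral_event (rho := law P mD) Gm mD ind FA mf f0.
rewrite ge0_integral_law// => h.
apply: EFin_inj; rewrite (ipE LA LA) EFinM (ipE Lm Lm) fineK ?fin_num_measure//.
under [in RHS]eq_integral do rewrite -expr2.
rewrite -h [in RHS]integral_mkcond; apply: eq_integral => w _.
rewrite patchE indicE; case: ifPn => _; first by rewrite mulr1 expr2.
by rewrite mulr0 mul0r.
Qed.

Lemma is_cond_exp_decomposition Y c D : measurable_fun setT Y -> measurable_fun setT c ->
  P.-integrable setT (EFin \o c) -> L2 P D -> indep_rv P F D ->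
  {ae P, forall w, Y w = c w + D w} ->
  is_cond_exp P F Y (fun w => c w + \int[P]_w D w).
Proof.
move=> mY mc ic LD ind YcD; set m := \int[P]_w D w.
have [mD _] := LD; have iD := L2_finite_integrable LD.
have mcO : measurable_fun setT (c : Omega -> R) := sub_measurable_fun Gm mc.
split.
- move=> B mB; have : measurable_fun setT (fun w : OF => c w + m) by exact: measurable_funD.
  by move=> /(_ measurableT B mB); rewrite setTI.
- have := integrableD measurableT ic (finite_measure_integrable_cst P m measurableT).
  by apply: eq_integrable.
- move=> A FA; have mA : measurable A by exact: Gm.
  have icA : P.-integrable A (EFin \o c) by exact: integrableS ic.
  have iDA : P.-integrable A (EFin \o D) by exact: integrableS iD.
  transitivity (\int[P]_(w in A) (c w + D w)%:E)%E; last first.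
    apply: ae_eq_integral => //.
    + apply/measurable_EFinP/measurable_funTS; exact: measurable_funD.
    + exact/measurable_EFinP/measurable_funTS.
    + by apply: filterS YcD => w -> _.
  have -> : (\int[P]_(w in A) (c w + D w)%:E =
      \int[P]_(w in A) (c w)%:E + \int[P]_(w in A) (D w)%:E)%E.
    by rewrite -integralD//; apply: eq_integral => w _; rewrite EFinD.
  have -> : (\int[P]_(w in A) (c w + m)%:E =
      \int[P]_(w in A) (c w)%:E + \int[P]_(w in A) m%:E)%E.
    have icst : P.-integrable A (EFin \o cst m) by exact: finite_measure_integrable_cst.
    by rewrite -integralD//; apply: eq_integral => w _; rewrite EFinD.
  rewrite (indep_int_event LD ind FA) -[X in (_ + X = _)%E]/(\int[P]_(w in A) cst m%:E w)%E integral_cst//.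
  by rewrite muleC.
Qed.

(** The mean of the centered product over an event is obtained by polarization from the second
    moments of [D1], [D2] and their sum over that event, each of which factors by independence. *)
Lemma cond_cov_decomposition Y1 Y2 c1 c2 D1 D2 :
  measurable_fun setT Y1 -> measurable_fun setT Y2 ->
  measurable_fun setT c1 -> measurable_fun setT c2 ->
  P.-integrable setT (EFin \o c1) -> P.-integrable setT (EFin \o c2) ->
  L2 P D1 -> L2 P D2 -> indep_rv P F D1 -> indep_rv P F D2 ->
  indep_rv P F (fun w => D1 w + D2 w) ->
  {ae P, forall w, Y1 w = c1 w + D1 w} -> {ae P, forall w, Y2 w = c2 w + D2 w} ->
  {ae P, forall w, cond_cov P F Y1 Y2 w =
    ip P D1 D2 - (\int[P]_w D1 w) * (\int[P]_w D2 w)}.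
Proof.
move=> mY1 mY2 mc1 mc2 ic1 ic2 LD1 LD2 i1 i2 i12 h1 h2.
set m1 := \int[P]_w D1 w; set m2 := \int[P]_w D2 w.
have is1 := is_cond_exp_decomposition mY1 mc1 ic1 LD1 i1 h1.
have is2 := is_cond_exp_decomposition mY2 mc2 ic2 LD2 i2 h2.
have ce1 := cond_exp_ae Gm is1; have ce2 := cond_exp_ae Gm is2.
have L1 := L2B LD1 (L2_cst P m1); have L2' := L2B LD2 (L2_cst P m2).
have LD12 := L2D LD1 LD2.
have ipm : ip P (fun w => D1 w - m1) (fun w => D2 w - m2) = ip P D1 D2 - m1 * m2.
  rewrite ipBl//; last exact: L2_cst.
  rewrite !ipBr//; try exact: L2_cst.
  rewrite ip_cst (ipC P (fun=> m1) D2) !ip_cstr// -/m1 -/m2; ring.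
rewrite -ipm; set v := ip P _ _.
have prod : {ae P, forall w, (Y1 w - cond_exp P F Y1 w) * (Y2 w - cond_exp P F Y2 w) =
    (D1 w - m1) * (D2 w - m2)}.
  apply: filterS (filterI (filterI h1 h2) (filterI ce1 ce2)) => w [[-> ->] [-> ->]].
  by rewrite -/m1 -/m2; ring.
have F0 : F set0 by have [] := smallest_sigma_algebra setT Gs.
have FT : F setT by exact: salgebra_setT (smallest_sigma_algebra setT Gs).
apply: (cond_exp_ae Gm); split.
- move=> B mB; have : measurable_fun setT (cst v : OF -> R) by exact: measurable_cst.
  by move=> /(_ measurableT B mB); rewrite setTI.
- exact: finite_measure_integrable_cst.
move=> A FA; have mA : measurable A by exact: Gm.
have LA1 := L2_indic_mul mA L1; have LA2 := L2_indic_mul mA L2'.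
rewrite -[LHS]/(\int[P]_(w in A) cst v%:E w)%E integral_cst//.
have e : ip P (fun w => (D1 w - m1) * \1_A w) (fun w => (D2 w - m2) * \1_A w) = fine (P A) * v.
  have := indep_ip_indic LD12 i12 FA (m1 + m2).
  have -> : ip P (fun w => (D1 w + D2 w - (m1 + m2)) * \1_A w)
      (fun w => (D1 w + D2 w - (m1 + m2)) * \1_A w) =
      ip P (fun w => (D1 w - m1) * \1_A w + (D2 w - m2) * \1_A w)
      (fun w => (D1 w - m1) * \1_A w + (D2 w - m2) * \1_A w).
    by apply: eq_ip => w; ring.
  have -> : ip P (fun w => D1 w + D2 w - (m1 + m2)) (fun w => D1 w + D2 w - (m1 + m2)) =
      ip P (fun w => (D1 w - m1) + (D2 w - m2)) (fun w => (D1 w - m1) + (D2 w - m2)).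
    by apply: eq_ip => w; ring.
  rewrite (ip_sqrD LA1 LA2) (ip_sqrD L1 L2') (indep_ip_indic LD1 i1 FA) (indep_ip_indic LD2 i2 FA) -/v; lra.
have PA : P A \is a fin_num by exact: fin_num_measure.
transitivity (fine (P A) * v)%:E; first by rewrite EFinM (fineK PA) muleC.
rewrite -e (ipE LA1 LA2).
have m12 : measurable_fun setT (fun w => (D1 w - m1) * (D2 w - m2)).
  by apply: measurable_funM; [have [] := L1|have [] := L2'].
transitivity (\int[P]_(w in A) ((D1 w - m1) * (D2 w - m2))%:E)%E.
  rewrite [in RHS]integral_mkcond; apply: eq_integral => w _.
  rewrite patchE indicE; case: ifPn => _; first by rewrite !mulr1.
  by rewrite !mulr0.
have mce Y Z : is_cond_exp P F Y Z -> measurable_fun setT (cond_exp P F Y).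
  move=> YZ; have [h _ _] := choose_orP (fun=> 0) (ex_intro _ Z YZ).
  by move=> _ B mB; rewrite setTI; apply: Gm; exact: h.
apply: ae_eq_integral => //.
- exact/measurable_EFinP/measurable_funTS.
- apply/measurable_EFinP/measurable_funTS/measurable_funM.
    exact: measurable_funB mY1 (mce _ _ is1).
  exact: measurable_funB mY2 (mce _ _ is2).
- by apply: filterS prod => w -> _.
Qed.

(** The laws of c w + D, with w frozen, form a regular version. The version chosen by [cond_law]
    agrees with it almost surely on every rational ray, hence on all Borel sets. *)
Lemma cond_law_decomposition Y c D (mD : measurable_fun setT D) :
  measurable_fun setT Y -> measurable_fun setT c -> indep_rv P F D ->
  {ae P, forall w, Y w = c w + D w} ->
  {ae P, forall w, forall B, measurable B ->
    cond_law P F Y w B = P [set w' | B (c w + D w')]}.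
Proof.
move=> mY mc ind YcD.
have mcO : measurable_fun setT (c : Omega -> R) := sub_measurable_fun Gm mc.
have mcD w : measurable_fun setT (fun w' => c w + D w') by exact: measurable_funD.
pose kappa w : probability R R := law P (mcD w).
have kappaE w B : kappa w B = law P mD [set y | B (c w + y)] by [].
have isk : is_cond_law P F Y kappa.
  move=> B mB.
  have mYB : measurable (Y @^-1` B) by have := mY measurableT B mB; rewrite setTI.
  have mk : measurable_fun setT (fun w : OF => fine (kappa w B)).
    apply: (measurableT_comp (@fine_measurable R setT measurableT)).
    exact: (measurableT_comp (measurable_translate (law P mD) mB) mc).
  have kfin w : kappa w B \is a fin_num by exact: fin_num_measure.
  split.
  - by move=> D' mD'; have := mk measurableT D' mD'; rewrite setTI.
  - apply: (le_integrable measurableT _ _ (finite_measure_integrable_cst P 1 measurableT)).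
      by apply/measurable_EFinP; exact: sub_measurable_fun mk.
    move=> w _; rewrite /= normr1 lee_fin ger0_norm ?fine_ge0//.
    by have := probability_le1 (kappa w) mB; rewrite -[X in (X <= _)%E](fineK (kfin w)) lee_fin.
  - move=> A FA; have mA : measurable A by exact: Gm.
    rewrite [RHS]integral_indic//.
    transitivity (P (A `&` [set w | B (c w + D w)])).
      rewrite (indep_sum_prob (rho := law P mD) Gm mD ind mc FA mB).
      by apply: eq_integral => w _; rewrite fineK.
    rewrite setIC; apply: ae_eq_prob.
    + apply: measurableI => //.
      by have := measurable_funD mcO mD measurableT mB; rewrite setTI.
    + exact: measurableI.
    + by apply: filterS YcD => w e; rewrite /= /preimage/= e.
have isc : is_cond_law P F Y (cond_law P F Y).
  exact: (choose_orP _ (ex_intro _ kappa isk)).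
pose ray (q : rat) : set R := `]-oo, ratr q[%classic.
have mr q : measurable (ray q) by exact: measurable_itv.
(* [unpickle] enumerates the rationals, with 0 for the codes of none, so that countably many null
   sets are united. *)
have hn : {ae P, forall w, forall n : nat, fine (cond_law P F Y w (ray (odflt 0 (unpickle n)))) =
    fine (kappa w (ray (odflt 0 (unpickle n))))}.
  apply/ae_foralln => n; apply: (is_cond_exp_unique Gm (isc _ (mr _)) (isk _ (mr _))).
apply: filterS hn => w hw B mB; rewrite -[RHS]/(kappa w B).
apply: probability_unique_ratr => // q.
have := hw (pickle q); rewrite pickleK/= => e.
rewrite -[LHS]fineK; last exact: (fin_num_measure _ _ (mr q)).
rewrite -[RHS]fineK; last exact: (fin_num_measure _ _ (mr q)).
by rewrite e.
Qed.

End conditional.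

(** * Increments of the compound Poisson process after a given time *)

Section compound_increments.
Context {R : realType} {d : measure_display} {Omega : measurableType d}
  (P : probability Omega R) (F : probability R R) (xi : nat -> {RV P >-> R})
  (T lambda : R) (N : R -> {RV P >-> nat}) (J : R -> Omega -> R) (mu1 mu2 : R).
Hypothesis lambda_ge0 : 0 <= lambda.
Hypothesis CP : compound_poisson T lambda F N xi J.
Hypothesis xi_N : independent P (sigma_gen setT (fun k => xi k : Omega -> R))
  (natural_filtration (fun r => N r : Omega -> nat) T).
Hypothesis xi_L2 : forall k, L2 P (xi k).
Hypothesis xi_mean : forall k, \int[P]_w xi k w = mu1.
Hypothesis xi_sq : forall k, ip P (xi k) (xi k) = mu2.

Definition incr u t (w : Omega) : R := J t w - J u w.

Let mJ t : 0 <= t <= T -> measurable_fun setT (J t).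
Proof. by move=> tT; exact: (measurable_compound (cp_sum CP)). Qed.

Let rng u t : 0 <= u -> u <= t -> t <= T -> (0 <= u <= T) /\ (0 <= t <= T).
Proof. by move=> u0 ut tT; rewrite u0 (le_trans ut tT) tT (le_trans u0 ut). Qed.

Let r0 u t : u <= t -> 0 <= lambda * (t - u).
Proof. by move=> ut; rewrite mulr_ge0// subr_ge0. Qed.

Lemma measurable_incr u t : 0 <= u -> u <= t -> t <= T -> measurable_fun setT (incr u t).
Proof.
move=> u0 ut tT; have [uT t0] := rng u0 ut tT.
by apply: measurable_funB; exact: mJ.
Qed.

Lemma natural_filtration_compound u : 0 <= u <= T -> natural_filtration J u `<=` measurable.
Proof.
move=> /andP[u0 uT]; apply: sigma_gen_measurable => r /=; rewrite in_itv/= => /andP[r_ge0 ru].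
by apply: mJ; rewrite r_ge0 (le_trans ru uT).
Qed.

Lemma incr_law u t B : 0 <= u -> u <= t -> t <= T -> measurable B ->
  P (incr u t @^-1` B) =
  (\sum_(0 <= m <oo) (poisson_weight (lambda * (t - u)) m)%:E * conv_pow F m B)%E.
Proof.
move=> u0 ut tT mB; have [uT t0] := rng u0 ut tT.
have := increment_indep lambda_ge0 (cp_law CP) (cp_iid CP) (cp_poisson CP) (cp_sum CP)
  xi_N uT ut tT (salgebra_setT (@sigma_gen_salgebra _ _ _ _ _ _ _)) mB.
by rewrite setTI probability_setT mul1e.
Qed.

Lemma incr_indep u t : 0 <= u -> u <= t -> t <= T ->
  indep_rv P (natural_filtration J u) (incr u t).
Proof.
move=> u0 ut tT A B FA mB; have [uT t0] := rng u0 ut tT.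
rewrite incr_law//.
exact: (increment_indep lambda_ge0 (cp_law CP) (cp_iid CP) (cp_poisson CP) (cp_sum CP)
  xi_N uT ut tT FA mB).
Qed.

Lemma incr_L2 u t : 0 <= u -> u <= t -> t <= T -> L2 P (incr u t).
Proof.
move=> u0 ut tT; apply: (compound_L2 (cp_law CP) (cp_iid CP) xi_L2 xi_mean xi_sq (r0 ut)).
  exact: measurable_incr.
by move=> B mB; exact: incr_law.
Qed.

Lemma incr_mean u t : 0 <= u -> u <= t -> t <= T ->
  \int[P]_w incr u t w = lambda * (t - u) * mu1.
Proof.
move=> u0 ut tT.
apply: (compound_mean (cp_law CP) (cp_iid CP) xi_L2 xi_mean xi_sq (r0 ut)).
  exact: measurable_incr.
by move=> B mB; exact: incr_law.
Qed.

Lemma incr_sq u t : 0 <= u -> u <= t -> t <= T ->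
  ip P (incr u t) (incr u t) = lambda * (t - u) * mu2 + (lambda * (t - u) * mu1) ^+ 2.
Proof.
move=> u0 ut tT.
apply: (compound_sq (cp_law CP) (cp_iid CP) xi_L2 xi_mean xi_sq (r0 ut)).
  exact: measurable_incr.
by move=> B mB; exact: incr_law.
Qed.

Lemma incr_past u t v : 0 <= u -> u <= t -> t <= v ->
  measurable_fun setT (incr u t : g_sigma_algebraType (gen `[0, v] J) -> R).
Proof.
move=> u0 ut tv; apply: measurable_funB; apply: sigma_gen_fun; rewrite /= in_itv/=.
  by rewrite tv (le_trans u0 ut).
by rewrite u0 (le_trans ut tv).
Qed.

Let incr_split u t s w : incr u s w = incr u t w + incr t s w.
Proof. by rewrite /incr; ring. Qed.

Let incr_ip_le u t s : 0 <= u -> u <= t -> t <= s -> s <= T ->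
  ip P (incr u t) (incr u s) =
  lambda * (t - u) * mu2 + (lambda * (t - u) * mu1) * (lambda * (s - u) * mu1).
Proof.
move=> u0 ut ts sT; have tT := le_trans ts sT; have t0 := le_trans u0 ut.
have L1 := incr_L2 u0 ut tT; have L3 := incr_L2 t0 ts sT.
rewrite (eq_ip P (f' := incr u t) (g' := fun w => incr u t w + incr t s w))//.
rewrite ipDr// incr_sq//.
have m : <<s gen `[0, t] J >> `<=` measurable by apply: natural_filtration_compound; rewrite t0.
rewrite (indep_ip m (incr_past u0 ut (lexx t)) L1 L3 (incr_indep t0 ts sT)).
by rewrite !incr_mean//; ring.
Qed.

Let incr_sum_indep_le u t s : 0 <= u -> u <= t -> t <= s -> s <= T ->
  indep_rv P (natural_filtration J u) (fun w => incr u t w + incr u s w).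
Proof.
move=> u0 ut ts sT; have tT := le_trans ts sT; have t0 := le_trans u0 ut.
(* In terms of increments over consecutive intervals, the first is known at time t and the second is
   independent of F^J_t. *)
rewrite (_ : (fun w => _) = fun w => 2 * incr u t w + incr t s w); last first.
  by apply/funext => w; rewrite (incr_split u t s); ring.
have m : <<s gen `[0, t] J >> `<=` measurable by apply: natural_filtration_compound; rewrite t0.
have sa := smallest_sigma_algebra setT (gen `[0, t] J).
apply: (@indep_rv_combine _ _ _ P (natural_filtration J u) (natural_filtration J t)
  (incr u t) (incr t s) _ _ m _ _ _ _ _ (fun a b => 2 * a + b)).
- by apply: sigma_genS => r /=; rewrite !in_itv/= => /andP[-> /le_trans]; exact.
- exact: salgebra_setI.
- exact: salgebra_setT.
- by move=> B mB; have := incr_past u0 ut (lexx t) measurableT mB; rewrite setTI.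
- exact: measurable_incr.
- exact: incr_indep.
- exact: incr_indep.
- by apply: measurable_funD => //; apply: measurable_funM.
Qed.

Lemma incr_ip u t s : 0 <= u -> u <= t -> u <= s -> t <= T -> s <= T ->
  ip P (incr u t) (incr u s) - (\int[P]_w incr u t w) * (\int[P]_w incr u s w) =
  lambda * (Num.min t s - u) * mu2.
Proof.
move=> u0 ut us tT sT; rewrite !incr_mean//.
have [ts|/ltW st] := leP t s; first by rewrite incr_ip_le//; ring.
by rewrite ipC incr_ip_le//; ring.
Qed.

Lemma incr_sum_indep u t s : 0 <= u -> u <= t -> u <= s -> t <= T -> s <= T ->
  indep_rv P (natural_filtration J u) (fun w => incr u t w + incr u s w).
Proof.
move=> u0 ut us tT sT; have [ts|/ltW st] := leP t s; first exact: incr_sum_indep_le.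
rewrite (_ : (fun w => _) = fun w => incr u s w + incr u t w); last first.
  by apply/funext => w; rewrite addrC.
exact: incr_sum_indep_le.
Qed.

Lemma compound_process_L2 t : 0 <= t <= T -> L2 P (J t).
Proof.
move=> /andP[t0 tT]; apply: (L2_ae (incr_L2 (lexx 0) t0 tT)); first by apply: mJ; rewrite t0.
apply: filterS (pp_start (cp_poisson CP)) => w N0.
by rewrite /incr (cp_sum CP (t := 0)) ?lexx ?(le_trans t0)// N0 big_ord0 subr0.
Qed.

End compound_increments.

(** * Finiteness and second moments drawn from the hypotheses *)

Lemma stieltjes_finite (R : realType) (T : R) (T0 : 0 <= T) (v : increasing_on T) (a b : R) :
  (stieltjes T0 v `[a, b[%classic < +oo)%E.
Proof.
(* The measure is given explicitly on intervals open at the left and closed at the right; this one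
   covers [a, b[. *)
apply: (@le_lt_trans _ _ (stieltjes T0 v `]a - 1, b]%classic)).
  apply: le_measure; rewrite ?inE.
  - exact: measurable_itv.
  - exact: measurable_itv.
  - move=> x /=; rewrite !in_itv/= => /andP[ax /ltW ->]; rewrite andbT.
    by rewrite (lt_le_trans _ ax)// ltrBlDr ltrDl.
rewrite /stieltjes /lebesgue_stieltjes_measure /measure_extension measurable_mu_extE/=; last first.
  exact: is_ocitv.
by rewrite wlength_itv/=; case: ifP => // _; rewrite ltry.
Qed.

Section moments.
Context {R : realType} {d : measure_display} {Omega : measurableType d}
  (P : probability Omega R).

Lemma expectation_Rintegral (Y : Omega -> R) m : ('E_P[Y] = m%:E)%E -> \int[P]_w Y w = m.
Proof. by rewrite unlock /Rintegral => ->. Qed.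

Lemma expectation_sqr_L2 (Y : {RV P >-> R}) m :
  ('E_P[fun w => (Y w ^+ 2)%R] = m%:E)%E -> L2 P Y /\ ip P Y Y = m.
Proof.
rewrite unlock => h; have mY : measurable_fun setT Y by exact: measurable_funPT.
split.
  split => //; apply/integrableP; split; first exact/measurable_EFinP/measurable_funX.
  under eq_integral do rewrite abse_EFin ger0_norm ?sqr_ge0//.
  by rewrite h ltry.
rewrite /ip /Rintegral; under eq_integral do rewrite -expr2.
by rewrite h.
Qed.

Lemma centered_covariance (X Y : {RV P >-> R}) c :
  ('E_P[X] = 0)%E -> ('E_P[Y] = 0)%E -> covariance P X Y = c%:E ->
  (\int[P]_w (X w * Y w)%:E = c%:E)%E.
Proof.
move=> X0 Y0; rewrite covariance.unlock X0 Y0 /= unlock => <-.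
by apply: eq_integral => w _; rewrite -[RHS]/(((X w - 0) * (Y w - 0))%:E) !subr0.
Qed.

End moments.

Section volterra_moments.
Context {R : realType} {d : measure_display} {Omega : measurableType d}
  (P : probability Omega R) (T : R) (G : R -> {RV P >-> R}) (C K : R -> R -> R)
  (dv : {measure set (measurableTypeR R) -> \bar R}).
Hypothesis GV : gaussian_volterra T G C dv K.

Lemma gv_L2 t : 0 <= t <= T -> L2 P (G t).
Proof.
move=> tT; have c := centered_covariance (gv_centered GV tT) (gv_centered GV tT) (gv_cov GV tT tT).
have mG : measurable_fun setT (G t) by exact: measurable_funPT.
split => //; apply/integrableP; split; first exact/measurable_EFinP/measurable_funX.
under eq_integral do rewrite abse_EFin ger0_norm ?sqr_ge0// expr2.
by rewrite c ltry.
Qed.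

Lemma gv_ip t s : 0 <= t <= T -> 0 <= s <= T -> ip P (G t) (G s) = C t s.
Proof.
move=> tT sT; have c := centered_covariance (gv_centered GV tT) (gv_centered GV sT) (gv_cov GV tT sT).
by rewrite /ip /Rintegral c.
Qed.

Lemma gv_mean t : 0 <= t <= T -> (\int[P]_w (G t w)%:E = 0)%E.
Proof. by move=> tT; have := gv_centered GV tT; rewrite unlock. Qed.

End volterra_moments.

(** * The conditional law as a mixture of normal laws *)

Section mixture.
Context {R : realType} {d : measure_display} {Omega : measurableType d}
  (P : probability Omega R) (F : probability R R) (Gs : set (set Omega)).
Variables (U : Omega -> R) (j : g_sigma_algebraType Gs -> R) (s2 r : R).
Hypothesis Gm : <<s Gs >> `<=` measurable.
Hypothesis mU : measurable_fun setT U.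
Hypothesis mj : measurable_fun setT j.
Hypothesis s2_ge0 : 0 <= s2.
Hypothesis U_law : forall B, measurable B -> P (U @^-1` B) = Phi_prob 0 s2 B.
Hypothesis j_law : forall B, measurable B ->
  P ((j : Omega -> R) @^-1` B) =
  (\sum_(0 <= m <oo) (poisson_weight r m)%:E * conv_pow F m B)%E.
Hypothesis U_indep : indep_rv P <<s Gs >> U.

Lemma gaussian_mixture (a m : R) B : measurable B ->
  P [set w | B (a + m + (U w + j w))] =
  (\int[fun A => \sum_(0 <= n <oo) (poisson_weight r n)%:E * translate (conv_pow F n) a A]_y
    translate (Phi m s2) y B)%E.
Proof.
move=> mB.
have mjO : measurable_fun setT (j : Omega -> R) := sub_measurable_fun Gm mj.
pose B' : set R := [set z | B (z + m)].
have mB' : measurable B'.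
  have : measurable_fun setT (fun z : R => z + m) by exact: measurable_funD.
  by move=> /(_ measurableT B mB); rewrite setTI.
pose f (y : R) := law P mU [set x | B' (y + x)].
have mf : measurable_fun setT f by exact: measurable_translate.
have fE y : translate (Phi m s2) y B = f y.
  rewrite translate_set -Phi_probE Phi_prob_shift//; last exact: measurable_translate_set.
  rewrite /f lawE U_law; last exact: measurable_translate_set.
  by congr (Phi_prob _ _ _); apply/seteqP; split => x; rewrite /B'/= addrA.
have maj : measurable_fun setT (fun w => a + (j : Omega -> R) w) by exact: measurable_funD.
(* The integrator in the statement is a bare set function; on measurable sets it agrees with the law
   of a + j. *)
transitivity (\int[law P maj]_y f y)%E; last first.
  rewrite (_ : (fun y => translate (Phi m s2) y B) = f); last exact/funext/fE.
  apply: raw_integral_ext => A mA; rewrite lawE.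
  rewrite (_ : _ @^-1` A = (j : Omega -> R) @^-1` [set x | A (a + x)])// j_law; last first.
    exact: measurable_translate_set.
  by apply: eq_eseriesr => n _; rewrite translate_set.
rewrite ge0_integral_law//.
have mc : measurable_fun setT (fun w : g_sigma_algebraType Gs => a + m + j w).
  exact: measurable_funD.
have FT : <<s Gs >> setT by exact: salgebra_setT (smallest_sigma_algebra setT Gs).
have := indep_sum_prob (rho := law P mU) Gm mU (fun A B => U_indep (A := A) (B := B)) mc FT mB.
rewrite setTI => h.
transitivity (P [set w | B (a + m + j w + U w)]).
  congr (P _); apply/seteqP.
  by split => w /=; rewrite (_ : a + m + j w + U w = a + m + (U w + j w))//; ring.
rewrite h; apply: eq_integral => w _; rewrite /f; congr (law P mU _); apply/seteqP.
by split => x; rewrite /B'/= (_ : a + m + j w + x = a + j w + x + m)//; ring.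
Qed.

End mixture.

(** * The Gaussian part read off the observed path *)

Section recover.
Context {R : realType} {d : measure_display} {Omega : measurableType d}
  (P : probability Omega R) (T lambda : R) (F : probability R R)
  (G : R -> {RV P >-> R}) (N : R -> {RV P >-> nat}) (xi : nat -> {RV P >-> R})
  (J X : R -> Omega -> R).
Hypothesis G_cont : {ae P, forall w, {within `[0, T], continuous (fun r => G r w)}}.
Hypothesis CP : compound_poisson T lambda F N xi J.
Hypothesis XGJ : forall r w, 0 <= r <= T -> X r w = G r w + J r w.

(* The jumps of the observed path are those of [J]; subtracting them recovers [G]. *)
Lemma continuous_part_ae r : 0 <= r <= T ->
  {ae P, forall w, G r w = X r w - jump_part (X^~ w) r}.
Proof.
move=> r0T; have /andP[r0 rT] := r0T; have T0 := le_trans r0 rT.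
apply: filterS (filterI (filterI G_cont (pp_nondecreasing (cp_poisson CP)))
  (pp_start (cp_poisson CP))) => w [[cw Nw] N0].
pose jf n := \sum_(k < n) xi k w.
have Xw y : 0 <= y <= T -> X y w = G y w + jf (N y w).
  by move=> yT; rewrite XGJ// (cp_sum CP).
have e := @jump_partE _ _ _ (X^~ w) (fun y => G y w) (fun y => N y w) jf r0T cw Nw Xw.
by rewrite e N0 /jf big_ord0 subr0 Xw// addrK.
Qed.

Lemma continuous_part_measurable u r : 0 <= r <= u ->
  measurable_fun setT
    ((fun w => X r w - jump_part (X^~ w) r) : g_sigma_algebraType (gen `[0, u] X) -> R).
Proof.
move=> ru; have mX s : 0 <= s <= u ->
    measurable_fun setT (X s : g_sigma_algebraType (gen `[0, u] X) -> R).
  by move=> su; apply: sigma_gen_fun; rewrite /= in_itv.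
apply: measurable_funB; first exact: mX.
exact: (@measurable_jump_part _ _ (g_sigma_algebraType (gen `[0, u] X)) X r u).
Qed.

(** This inclusion transfers independence of the past to F^X_u; in the other direction almost sure
    versions are used instead. *)
Lemma observed_filtration_sub u : 0 <= u -> u <= T ->
  natural_filtration X u `<=`
  <<s gen `[0, u] (fun r => G r : Omega -> R) `|` gen `[0, u] J >>.
Proof.
move=> u0 uT; apply: smallest_sub; first exact: smallest_sigma_algebra.
move=> _ [r ru [B mB <-]].
have rT : 0 <= r <= T.
  by move: ru; rewrite /= in_itv/= => /andP[-> ru]; exact: le_trans uT.
pose O' := g_sigma_algebraType (gen `[0, u] (fun r => G r : Omega -> R) `|` gen `[0, u] J).
have mG : measurable_fun setT (G r : O' -> R).
  by move=> _ D mD; apply: sub_sigma_algebra; left; exists r => //; exists D.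
have mJ : measurable_fun setT (J r : O' -> R).
  by move=> _ D mD; apply: sub_sigma_algebra; right; exists r => //; exists D.
have e : X r = fun w => G r w + J r w by apply/funext => w; rewrite XGJ.
by have := measurable_funD mG mJ measurableT mB; rewrite !setTI e.
Qed.

End recover.

(** * The prediction formulas for X and G *)

Theorem theorem3p1 (R : realType) (T : R) (T_gt0 : 0 < T)
    (d : measure_display) (Omega : measurableType d) (P : probability Omega R)
    (P_complete : measure_is_complete P)
    (v : increasing_on T) (K C : R -> R -> R) (G : R -> {RV P >-> R})
    (lambda : R) (lambda_gt0 : 0 < lambda) (F : probability R R)
    (N : R -> {RV P >-> nat}) (xi : nat -> {RV P >-> R})
    (J X : R -> Omega -> R) (mu1 mu2 : R) :
  let dv : {measure set (measurableTypeR R) -> \bar R} :=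
    stieltjes (ltW T_gt0) v in
  gaussian_volterra T G C dv K ->
  {ae P, forall w, {within `[0, T], continuous (fun r => G r w)}} ->
  compound_poisson T lambda F N xi J ->
  F.-integrable setT (fun x => (x ^+ 2)%:E) ->
  independent P (sigma_gen setT xi)
    <<s natural_filtration N T `|` natural_filtration G T >> ->
  independent P (natural_filtration J T) (natural_filtration G T) ->
  (forall k, ('E_P[xi k] = mu1%:E)%E) ->
  (forall k, ('E_P[fun w => (xi k w ^+ 2)%R] = mu2%:E)%E) ->
  (forall r w, 0 <= r <= T -> X r w = G r w + J r w) ->
  forall s t u : R, 0 <= u -> u <= Num.min s t -> s <= T -> t <= T ->
  let FX := natural_filtration X u in
  let FG := natural_filtration G u in
  let I := wiener_integral P G (Psi C K dv t u) in
  let mG w := G u w - I w in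
  let RG := C t t - \int[dv]_(x in `[0, u[) (K t x) ^+ 2 in
  [/\ {ae P, forall w, cond_exp P FX (X t) w
        = X u w - I w + lambda * (t - u) * mu1},
      {ae P, forall w, cond_cov P FX (X t) (X s) w
        = C t s - \int[dv]_(x in `[0, u[) (K t x * K s x)
          + lambda * (Num.min t s - u) * mu2},
      {ae P, forall w, forall B, measurable B ->
        cond_law P FX (X t) w B
        = (\int[fun A => \sum_(0 <= n <oo)
                  (poisson_weight (lambda * (t - u)) n)%:E
                  * translate (conv_pow F n) (J u w) A]_y
             translate (Phi (mG w) RG) y B)%E},
      {ae P, forall w, cond_exp P FG (G t) w = mG w} &
      {ae P, forall w, cond_cov P FG (G t) (G t) w = RG}].
Proof.
move=> dv GV cG CP Fsq ind_xi ind_J Exi Exi2 XGJ s t u u0 ust sT tT FX FG I mG RG.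
have /andP[us ut] : (u <= s) && (u <= t) by rewrite -le_min.
have uT := le_trans ut tT.
have u0T : 0 <= u <= T by rewrite u0.
have range r : u <= r -> r <= T -> 0 <= r <= T by move=> ur ->; rewrite (le_trans u0 ur).
have t0T := range t ut tT; have s0T := range s us sT.
have G_gauss := gv_gaussian GV.
have G_L2 := gv_L2 GV; have G_ip := gv_ip GV; have G_mean := gv_mean GV.
have dv_fin : (dv `[0%R, T[%classic < +oo)%E by exact: stieltjes_finite.
have K_meas := gv_measurable GV; have K_sq := gv_square GV.
have K_fac := gv_factor GV; have K_inv := gv_inverse GV.
pose GF (r : R) : Omega -> R := G r.
have xi_mean k : \int[P]_w xi k w = mu1 by exact: expectation_Rintegral.
have xi_L2 k : L2 P (xi k) by have [] := expectation_sqr_L2 (Exi2 k).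
have xi_sq k : ip P (xi k) (xi k) = mu2 by have [] := expectation_sqr_L2 (Exi2 k).
have lambda_ge0 := ltW lambda_gt0.
have xi_N : independent P (sigma_gen setT (fun k => xi k : Omega -> R))
    (natural_filtration (fun r => N r : Omega -> nat) T).
  by move=> A B sA sB; apply: ind_xi => //; apply: sub_sigma_algebra; left.
have mJ r : 0 <= r <= T -> measurable_fun setT (J r).
  by move=> rT; exact: (measurable_compound (cp_sum CP)).
have mGF r : measurable_fun setT (GF r) by exact: measurable_funPT.
have mX r : 0 <= r <= T -> measurable_fun setT (X r).
  move=> rT; rewrite (_ : X r = fun w => G r w + J r w).
    by apply: measurable_funD; [exact: mGF|exact: mJ].
  by apply/funext => w; exact: XGJ.
have FGm b : <<s gen `[0, b] GF >> `<=` measurable.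
  by apply: sigma_gen_measurable => r _; exact: mGF.
have FJm b : b <= T -> <<s gen `[0, b] J >> `<=` measurable.
  move=> bT; apply: sigma_gen_measurable => r /=; rewrite in_itv/= => /andP[r_ge0 rb].
  by apply: mJ; rewrite r_ge0 (le_trans rb).
have FXm : <<s gen `[0, u] X >> `<=` measurable.
  apply: sigma_gen_measurable => r /=; rewrite in_itv/= => /andP[r_ge0 ru].
  by apply: mX; rewrite r_ge0 (le_trans ru).
have itvS b : b <= T -> `[0, b]%classic `<=` `[0, T]%classic.
  by move=> bT r /=; rewrite !in_itv/= => /andP[-> rb]; exact: le_trans bT.
have subT q : 0 <= q <= u -> 0 <= q <= T.
  by move=> /andP[-> qu]; exact: le_trans uT.
have spec r (ur : u <= r) (rT : r <= T) :=
  Psi_spec dv_fin K_meas K_sq K_fac K_inv u0T ur rT.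
(* The Wiener integral has versions measurable for F^G_u and for F^X_u. *)
have versG r : exists Z : Omega -> R, u <= r -> r <= T ->
    [/\ measurable_fun setT (Z : g_sigma_algebraType (gen `[0, u] GF) -> R), L2 P Z &
      cvgL2 P (fun n => step_map G (Psi C K dv r u n)) Z].
  (* The bounds on r sit inside the existential so that [choice] yields one family [Z], with an
     arbitrary value outside [u, T]. *)
  have [[ur rT]|h] := pselect (u <= r /\ r <= T); last first.
    by exists (fun=> 0) => ur rT; exfalso; apply: h.
  have mv q : 0 <= q <= u -> measurable_fun setT (GF q : g_sigma_algebraType (gen `[0, u] GF) -> R).
    by move=> qu; apply: sigma_gen_fun; rewrite /= in_itv.
  have [Z hZ] := wiener_version G_L2 G_ip u0T (spec r ur rT).1 (FGm u) mv
    (fun q _ => aeW _ (fun w => erefl)).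
  by exists Z.
have [Z hZ] := choice versG.
have versX r : u <= r -> r <= T -> exists Y : g_sigma_algebraType (gen `[0, u] X) -> R,
    [/\ measurable_fun setT Y, L2 P Y & {ae P, forall w, Y w = Z r w}].
  move=> ur rT; have [mZ LZ cZ] := hZ r ur rT.
  have [Y [mY LY cY]] := wiener_version G_L2 G_ip u0T (spec r ur rT).1 FXm
    (fun q qu => @continuous_part_measurable _ _ _ X u q qu)
    (fun q qu => continuous_part_ae cG CP XGJ (subT q qu)).
  exists Y; split => //.
  have hY := wiener_ae G_L2 G_ip u0T (spec r ur rT).1 LY cY.
  have hZ' := wiener_ae G_L2 G_ip u0T (spec r ur rT).1 LZ cZ.
  by apply: filterS2 hY hZ' => w <- <-.
have [Yt [mYt LYt Yt_ae]] := versX t ut tT.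
have [Ys [mYs LYs Ys_ae]] := versX s us sT.
have I_ae : {ae P, forall w, I w = Z t w}.
  have [_ LZ cZ] := hZ t ut tT.
  exact: (wiener_ae G_L2 G_ip u0T (spec t ut tT).1 LZ cZ).
pose U r := residual G u Z r.
have U_rep r (ur : u <= r) (rT : r <= T) : gclosure T G (U r).
  have [_ LZ cZ] := hZ r ur rT.
  exact: (represents_gclosure (residual_represents G_L2 dv_fin K_meas K_sq K_fac K_inv u0T ur rT LZ cZ)).
have U_orth r q : u <= r -> r <= T -> 0 <= q <= u -> ip P (U r) (G q) = 0.
  move=> ur rT qu; have [_ LZ cZ] := hZ r ur rT.
  exact: (residual_orth G_L2 G_ip dv_fin K_meas K_sq K_fac K_inv u0T ur rT LZ cZ qu).
have U_ip r q : u <= r -> r <= T -> u <= q -> q <= T ->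
    ip P (U r) (U q) = C r q - \int[dv]_(x in `[0, u[) (K r x * K q x).
  move=> ur rT uq qT; have [_ LZr cZr] := hZ r ur rT; have [_ LZq cZq] := hZ q uq qT.
  exact: (residual_ip G_L2 G_ip dv_fin K_meas K_sq K_fac K_inv u0T ur rT uq qT LZr LZq cZr cZq).
have U_L2 r : u <= r -> r <= T -> L2 P (U r) by move=> ur rT; have [] := U_rep r ur rT.
have U_mean r : u <= r -> r <= T -> \int[P]_w U r w = 0.
  by move=> ur rT; rewrite /Rintegral (gclosure_mean G_gauss G_L2 G_mean (U_rep r ur rT)).
(* Stated for a general W because the covariance also calls for the sum of two residuals. *)
have orth_indep W : gclosure T G W -> (forall q, 0 <= q <= u -> ip P W (G q) = 0) ->
    indep_rv P FG W.
  move=> gW oW A B FA mB; rewrite setIC muleC.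
  exact: (gclosure_indep G_gauss G_L2 G_mean u0T gW oW).
have U_indep r : u <= r -> r <= T -> indep_rv P FG (U r).
  by move=> ur rT; apply: orth_indep; [exact: U_rep|move=> q qu; exact: U_orth].
have U2_indep r q : u <= r -> r <= T -> u <= q -> q <= T ->
    indep_rv P FG (fun w => U r w + U q w).
  move=> ur rT uq qT; apply: orth_indep; first exact: (gclosureD G_L2 (U_rep r ur rT) (U_rep q uq qT)).
  move=> p pu; rewrite ipDl ?U_orth ?addr0//; [exact: U_L2|exact: U_L2|exact/G_L2/subT].
have U_FG r : u <= r -> r <= T ->
    measurable_fun setT (U r : g_sigma_algebraType (gen `[0, T] GF) -> R).
  move=> ur rT; have [mZ _ _] := hZ r ur rT.
  have mGq q : 0 <= q <= T -> measurable_fun setT (GF q : g_sigma_algebraType (gen `[0, T] GF) -> R).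
    by move=> qT; apply: sigma_gen_fun; rewrite /= in_itv.
  apply: measurable_funB; first exact: (mGq r (range r ur rT)).
  apply: measurable_funB; first exact: (mGq u u0T).
  move=> _ B mB; rewrite setTI; apply: (sigma_genS (itvS u uT)).
  by have := mZ measurableT B mB; rewrite setTI.
pose j r := incr J u r.
have j_L2 r (ur : u <= r) (rT : r <= T) : L2 P (j r) :=
  incr_L2 lambda_ge0 CP xi_N xi_L2 xi_mean xi_sq u0 ur rT.
have j_mean r (ur : u <= r) (rT : r <= T) : \int[P]_w j r w = lambda * (r - u) * mu1 :=
  incr_mean lambda_ge0 CP xi_N xi_L2 xi_mean xi_sq u0 ur rT.
have j_FJ r : u <= r -> r <= T ->
    measurable_fun setT (j r : g_sigma_algebraType (gen `[0, T] J) -> R).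
  by move=> ur rT; exact: incr_past.
have j_indep r (ur : u <= r) (rT : r <= T) := incr_indep lambda_ge0 CP xi_N u0 ur rT.
have GJ : independent P (natural_filtration GF T) (natural_filtration J T).
  by move=> A B sA sB; rewrite setIC muleC; exact: ind_J.
(* The innovation of X after u: its mean, covariances and law become the conditional ones. *)
pose D r w := U r w + j r w.
have pairD W k : measurable_fun setT (W : g_sigma_algebraType (gen `[0, T] GF) -> R) ->
    measurable_fun setT (k : g_sigma_algebraType (gen `[0, T] J) -> R) ->
    indep_rv P FG W -> indep_rv P (natural_filtration J u) k ->
    indep_rv P FX (fun w => W w + k w).
  move=> mW mk iW ik; apply: indep_rv_sub (observed_filtration_sub XGJ u0 uT) _.
  apply: (@indep_sum_rv _ _ _ P (gen `[0, T] GF) (gen `[0, T] J)) => //.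
  - exact: FJm.
  - exact: (sigma_genS (itvS u uT)).
  - exact: (sigma_genS (itvS u uT)).
  - by move=> B mB; have := mW measurableT B mB; rewrite setTI.
  - by move=> B mB; have := mk measurableT B mB; rewrite setTI.
have D_L2 r : u <= r -> r <= T -> L2 P (D r) by move=> ur rT; apply: L2D; [exact: U_L2|exact: j_L2].
have D_indep r : u <= r -> r <= T -> indep_rv P FX (D r).
  by move=> ur rT; apply: pairD; [exact: U_FG|exact: j_FJ|exact: U_indep|exact: j_indep].
have D2_indep r q : u <= r -> r <= T -> u <= q -> q <= T ->
    indep_rv P FX (fun w => D r w + D q w).
  move=> ur rT uq qT.
  rewrite (_ : (fun w => _) = fun w => (U r w + U q w) + (j r w + j q w)); last first.
    by apply/funext => w; rewrite /D addrACA.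
  apply: pairD.
  - by apply: measurable_funD; exact: U_FG.
  - by apply: measurable_funD; exact: j_FJ.
  - exact: U2_indep.
  - exact: (incr_sum_indep lambda_ge0 CP xi_N).
have D_mean r : u <= r -> r <= T -> \int[P]_w D r w = lambda * (r - u) * mu1.
  move=> ur rT; rewrite -ip1r ipDl; [|exact: U_L2|exact: j_L2|exact: L2_cst].
  by rewrite !ip1r U_mean// j_mean// add0r.
have Uj r q : u <= r -> r <= T -> u <= q -> q <= T -> ip P (U r) (j q) = 0.
  move=> ur rT uq qT.
  rewrite (indep_ip (FGm T) (U_FG r ur rT)) ?U_mean ?mul0r//; [exact: U_L2|exact: j_L2|].
  move=> A B sA mB; apply: GJ => //.
  by have := j_FJ q uq qT measurableT B mB; rewrite setTI.
have D_cov r q : u <= r -> r <= T -> u <= q -> q <= T ->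
    ip P (D r) (D q) - (\int[P]_w D r w) * (\int[P]_w D q w) =
    C r q - \int[dv]_(x in `[0, u[) (K r x * K q x) + lambda * (Num.min r q - u) * mu2.
  move=> ur rT uq qT; have := incr_ip lambda_ge0 CP xi_N xi_L2 xi_mean xi_sq u0 ur uq rT qT.
  rewrite -/(j r) -/(j q) !D_mean// !j_mean// => <-.
  have LUr := U_L2 r ur rT; have LUq := U_L2 q uq qT.
  have Ljr := j_L2 r ur rT; have Ljq := j_L2 q uq qT.
  have LDq := D_L2 q uq qT.
  have -> : ip P (D r) (D q) = ip P (U r) (U q) + ip P (U r) (j q) +
      (ip P (j r) (U q) + ip P (j r) (j q)).
    rewrite (ipDl (f := U r) (g := j r) LUr Ljr LDq).
    by rewrite (ipDr LUq Ljq LUr) (ipDr LUq Ljq Ljr).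
  rewrite U_ip// Uj// (ipC P (j r)) Uj//; ring.
(* [Z r] is measurable for F^G_u; leaving Y free allows the F^X_u-measurable version in its
   place. *)
have XD r (Y : Omega -> R) : u <= r -> r <= T -> {ae P, forall w, Y w = Z r w} ->
    {ae P, forall w, X r w = (X u w - Y w) + D r w}.
  move=> ur rT; apply: filterS => w ->; rewrite /D /U /residual /j /incr.
  by rewrite !XGJ//; [ring|exact: range].
have LXu : L2 P (X u).
  have := L2D (G_L2 u u0T) (compound_process_L2 lambda_ge0 CP xi_N xi_L2 xi_mean xi_sq u0T).
  by rewrite (_ : (fun w => _) = X u)//; apply/funext => w; rewrite XGJ.
have mXu : measurable_fun setT (X u : g_sigma_algebraType (gen `[0, u] X) -> R).
  by apply: sigma_gen_fun; rewrite /= in_itv/= u0 lexx.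
pose cX (Y : g_sigma_algebraType (gen `[0, u] X) -> R) (w : g_sigma_algebraType (gen `[0, u] X)) :=
  X u w - Y w.
have mcX Y : measurable_fun setT Y -> measurable_fun setT (cX Y).
  by move=> mY; exact: measurable_funB.
have icX Y : L2 P Y -> P.-integrable setT (EFin \o (cX Y : Omega -> R)).
  by move=> LY; apply: L2_finite_integrable; exact: L2B.
have mGu : measurable_fun setT (GF u : g_sigma_algebraType (gen `[0, u] GF) -> R).
  by apply: sigma_gen_fun; rewrite /= in_itv/= u0 lexx.
(* For the conditioning on F^G_u the version [Z t] serves directly. *)
pose cG' (w : g_sigma_algebraType (gen `[0, u] GF)) : R := GF u w - Z t w.
have [mZt LZt _] := hZ t ut tT.
have mcG : measurable_fun setT cG' by exact: measurable_funB.
have icG : P.-integrable setT (EFin \o (cG' : Omega -> R)).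
  by apply: L2_finite_integrable; apply: L2B => //; exact: G_L2.
have GD : {ae P, forall w, G t w = cG' w + U t w}.
  by apply: aeW => w; rewrite /cG' /U /residual /GF; ring.
split.
- have := cond_exp_ae FXm (is_cond_exp_decomposition FXm (mX t t0T) (mcX Yt mYt) (icX Yt LYt)
    (D_L2 t ut tT) (D_indep t ut tT) (XD t Yt ut tT Yt_ae)).
  move=> h; apply: filterS (filterI h (filterI I_ae Yt_ae)) => w [-> [-> Yw]].
  by rewrite D_mean// /cX Yw.
- have := cond_cov_decomposition FXm (mX t t0T) (mX s s0T) (mcX Yt mYt) (mcX Ys mYs)
    (icX Yt LYt) (icX Ys LYs) (D_L2 t ut tT) (D_L2 s us sT) (D_indep t ut tT)
    (D_indep s us sT) (D2_indep t s ut tT us sT) (XD t Yt ut tT Yt_ae) (XD s Ys us sT Ys_ae).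
  by apply: filterS => w ->; rewrite D_cov.
- have [mDt _] := D_L2 t ut tT.
  have := cond_law_decomposition FXm mDt (mX t t0T) (mcX Yt mYt) (D_indep t ut tT)
    (XD t Yt ut tT Yt_ae).
  move=> h; apply: filterS (filterI h (filterI I_ae Yt_ae)) => w [hw [Iw Yw]] B mB.
  rewrite hw//.
  have RGE : RG = ip P (U t) (U t).
    by rewrite U_ip// /RG; congr (_ - _); apply: eq_Rintegral => x _; rewrite expr2.
  have RG0 : 0 <= RG by rewrite RGE; exact: ip_ge0.
  have [mUt _] := U_L2 t ut tT.
  (* The observed values [J u w] and [mG w] are frozen as constants; the sigma-algebra is F^J_T, for
     which [j t] is measurable and of which [U t] is independent. *)
  rewrite -(@gaussian_mixture _ _ _ P F _ (U t) _ RG (lambda * (t - u)) (FJm T (lexx T)) mUt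
    (j_FJ t ut tT) RG0)//.
  + congr (P _); apply/seteqP; split => w' /=;
      rewrite (_ : cX Yt w + D t w' = J u w + mG w + (U t w' + j t w'))//;
      by rewrite /cX /D /mG Iw Yw XGJ//; ring.
  + move=> A mA; rewrite RGE.
    exact: (gclosure_law G_gauss G_L2 G_mean (U_rep t ut tT) mA).
  + by move=> A mA; exact: (incr_law lambda_ge0 CP xi_N u0 ut tT mA).
  + move=> A B' sA mB'; rewrite setIC muleC; apply: GJ => //.
    by have := U_FG t ut tT measurableT B' mB'; rewrite setTI.
- have := cond_exp_ae (FGm u) (is_cond_exp_decomposition (FGm u) (mGF t) mcG icG
    (U_L2 t ut tT) (U_indep t ut tT) GD).
  move=> h; apply: filterS (filterI h I_ae) => w [-> Iw].
  by rewrite U_mean// addr0 /mG Iw.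
- have := cond_cov_decomposition (FGm u) (mGF t) (mGF t) mcG mcG icG icG
    (U_L2 t ut tT) (U_L2 t ut tT) (U_indep t ut tT) (U_indep t ut tT)
    (U2_indep t t ut tT ut tT) GD GD.
  by apply: filterS => w ->; rewrite U_mean// mul0r subr0 U_ip//.
Qed.
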